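(* Let $d\ge 1$ and $\Theta=\Omega_{\langle d],\,|\sim|'\ge 2}$. The space $\mathcal{P}_d^{\mathbf{c}\Theta}$ is homotopy equivalent to a wedge of $\frac{d(d-2)}{4}$ circles for $d$ even, and to a wedge of $\frac{(d-1)^2}{4}$ circles for $d$ odd. In particular, the fundamental group $\pi_1(\mathcal{P}_d^{\mathbf{c}\Theta})$ is the free group on $\frac{d(d-2)}{4}$ generators for even $d$ and on $\frac{(d-1)^2}{4}$ generators for odd $d$, and $\mathcal{P}_d^{\mathbf{c}\Theta}$ is the corresponding $K(\pi,1)$-space.
   Context: $\mathcal{P}_d$ is the space of real monic polynomials of degree $d$ in one variable, identified with $\mathbb{R}^d$ through the coefficients. A composition is a finite, possibly empty, sequence $\omega=(\omega_1,\dots,\omega_\ell)$ of positive integers; $|\omega|=\sum_i\omega_i$ and $|\omega|'=\sum_i(\omega_i-1)$. The real root multiplicity pattern of $P\in\mathcal{P}_d$ is the composition listing the multiplicities of its distinct real roots in increasing order of the roots. $\Omega_{\langle d]}$ is the set of compositions $\omega$ with $|\omega|\le d$ and $|\omega|\equiv d \bmod 2$; $\Omega_{\langle d],\,|\sim|'\ge 2}$ is the subset of those with $|\omega|'\ge 2$. For $\Theta\subseteq\Omega_{\langle d]}$, $\mathcal{P}_d^{\mathbf{c}\Theta}$ is the set of polynomials in $\mathcal{P}_d$ whose pattern does not lie in $\Theta$. Thus here $\mathcal{P}_d^{\mathbf{c}\Theta}$ consists of the polynomials whose real roots are all simple except for at most one real root of multiplicity exactly $2$. A wedge of $0$ circles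 is a point. *)

(* Defs.v *)
From HB Require Import structures.
From mathcomp Require Import all_boot all_order all_algebra generic_quotient.
From mathcomp Require Import all_classical all_reals all_analysis.
From mathcomp Require Import homotopy polyorder polyrcf ring lra.

Set Implicit Arguments.
Unset Strict Implicit.
Unset Printing Implicit Defensive.

Import Order.TTheory GRing.Theory Num.Theory.
Import numFieldNormedType.Exports.

Local Open Scope classical_set_scope.
Local Open Scope ring_scope.
Local Open Scope quotient_scope.

Definition unit_interval (R : realType) : Type := `[0%R, 1%R]%classic : set R.

HB.instance Definition _ (R : realType) := PseudoMetric.on (unit_interval R).

Section unit_interval.
Context {R : realType}.
Local Notation I := (unit_interval R).

Definition ival (t : I) : R := set_val t.

Lemma ival_inj : injective ival.
Proof. exact: val_inj. Qed.

Lemma ival_continuous : continuous ival.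
Proof. exact: initial_continuous. Qed.

Lemma ival_ge0 t : 0 <= ival t.
Proof. by have /= := set_valP t; rewrite in_itv /= => /andP[]. Qed.

Lemma ival_le1 t : ival t <= 1.
Proof. by have /= := set_valP t; rewrite in_itv /= => /andP[]. Qed.

Lemma clamp_subproof (x : R) :
  Num.max 0 (Num.min 1 x) \in (`[0, 1]%classic : set R).
Proof.
apply/mem_set.
by rewrite /= in_itv /= le_max lexx /= ge_max ler01 /= ge_min lexx.
Qed.

Definition clamp (x : R) : I := SigSub (clamp_subproof x).

Lemma ival_clamp x : ival (clamp x) = Num.max 0 (Num.min 1 x).
Proof. by []. Qed.

Lemma clampE x : 0 <= x -> x <= 1 -> ival (clamp x) = x.
Proof. by move=> x0 x1; rewrite ival_clamp min_r // max_r. Qed.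

Lemma clampK t : clamp (ival t) = t.
Proof. by apply: ival_inj; rewrite clampE ?ival_ge0 ?ival_le1. Qed.

Lemma clamp_continuous : continuous clamp.
Proof.
apply: continuous_comp_initial => x.
apply: (@continuous_max R R (cst 0) (fun x : R => Num.min 1 x)).
  exact: cst_continuous.
apply: (@continuous_min R R (cst 1) id); [exact: cst_continuous|exact: id].
Qed.

Lemma unit_interval_neq : clamp 0 != clamp 1.
Proof.
apply/eqP => /(congr1 ival); rewrite !clampE ?lexx ?ler01 // => /eqP.
by rewrite eq_sym oner_eq0.
Qed.

HB.instance Definition _ := isBiPointed.Build I unit_interval_neq.

Lemma ival0 : ival zero = 0.
Proof. by rewrite clampE ?lexx ?ler01. Qed.

Lemma ival1 : ival one = 1.
Proof. by rewrite clampE ?lexx ?ler01. Qed.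

Lemma clamp_le0 x : x <= 0 -> clamp x = zero.
Proof.
move=> x0; apply: ival_inj; rewrite ival0 ival_clamp min_r ?(le_trans x0) //.
by rewrite max_l.
Qed.

Lemma clamp_ge1 x : 1 <= x -> clamp x = one.
Proof.
by move=> x1; apply: ival_inj; rewrite ival1 ival_clamp min_l // max_r.
Qed.

Lemma comp_continuous (T U V : topologicalType) (f : T -> U) (g : U -> V) :
  continuous f -> continuous g -> continuous (fun t => g (f t)).
Proof. by move=> cf cg t; exact: (continuous_comp (cf t) (cg (f t))). Qed.

Lemma pair_continuous (T U V : topologicalType) (f : T -> U) (g : T -> V) :
  continuous f -> continuous g -> continuous (fun t => (f t, g t)).
Proof. by move=> cf cg t; apply: cvg_pair; [exact: cf|exact: cg]. Qed.

Lemma affine_continuous (T : topologicalType) (f : T -> R) (a b : R) :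
  continuous f -> continuous (fun t => a * f t + b).
Proof.
move=> cf t; apply: cvgD; last exact: cvg_cst.
by apply: cvgM; [exact: cvg_cst|exact: cf].
Qed.

Lemma paste_continuous (T X : topologicalType) (phi : T -> R) (f g : T -> X) :
  continuous phi -> continuous f -> continuous g ->
  (forall t, phi t = 0 -> f t = g t) ->
  continuous (fun t => if phi t <= 0 then f t else g t).
Proof.
move=> cphi cf cg fg t U /=; case: (ltgtP (phi t) 0) => [t0|t0|t0] Ut.
- have : \forall s \near t, phi s < 0 by exact: (cphi t _ (lt_nbhsl t0)).
  move=> near0; have := cf t U Ut; rewrite /nbhs /=.
  by apply: filterS2 near0 => s /ltW /= ->.
- have : \forall s \near t, 0 < phi s by exact: (cphi t _ (lt_nbhsr t0)).
  move=> near0; have := cg t U Ut; rewrite /nbhs /=.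
  by apply: filterS2 near0 => s /= s0; rewrite leNgt s0.
- have := cf t U Ut; have := cg t U; rewrite -fg // => /(_ Ut).
  by rewrite /nbhs /=; apply: filterS2 => s /=; case: ifP.
Qed.

End unit_interval.

Section homotopy.
Context (R : realType).
Local Notation I := (unit_interval R).

Definition homotopic_rel (X Y : topologicalType) (A : set X) (f g : X -> Y) :=
  exists H : I * X -> Y, [/\ continuous H,
    forall x, H (zero, x) = f x,
    forall x, H (one, x) = g x &
    forall t x, A x -> H (t, x) = f x].

Definition homotopic (X Y : topologicalType) (f g : X -> Y) :=
  homotopic_rel set0 f g.

Definition homotopy_equivalent (X Y : topologicalType) :=
  exists (f : X -> Y) (g : Y -> X), [/\ continuous f, continuous g,
    homotopic (g \o f) id & homotopic (f \o g) id].

Definition path_connected (X : topologicalType) :=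
  $|X| /\ forall x y : X, $|{path I from x to y in X}|.

Section equivalence.
Context (X Y : topologicalType) (A : set X).
Implicit Types f g h : X -> Y.

Let fst_continuous : continuous (fun p : I * X => ival p.1).
Proof.
apply: (comp_continuous (f := fst)); last exact: ival_continuous.
by move=> p; exact: cvg_fst.
Qed.

Let slice_continuous (H : I * X -> Y) (k : I * X -> R) :
  continuous H -> continuous k -> continuous (fun p => H (clamp (k p), p.2)).
Proof.
move=> cH ck; apply: comp_continuous cH.
apply: pair_continuous; last by move=> p; exact: cvg_snd.
exact: comp_continuous ck clamp_continuous.
Qed.

Lemma homotopic_rel_refl f : continuous f -> homotopic_rel A f f.
Proof.
move=> cf; exists (fun p => f p.2); split=> //.
by apply: comp_continuous cf => p; exact: cvg_snd.
Qed.

Lemma homotopic_rel_sym f g : homotopic_rel A f g -> homotopic_rel A g f.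
Proof.
move=> [H [cH H0 H1 HA]].
exists (fun p => H (clamp (-1 * ival p.1 + 1), p.2)); split.
- exact/slice_continuous/affine_continuous.
- by move=> x /=; rewrite ival0 mulr0 add0r H1.
- by move=> x /=; rewrite ival1 mulr1 addNr H0.
- by move=> t x Ax /=; rewrite HA // -H1 HA.
Qed.

Lemma homotopic_rel_trans f g h :
  homotopic_rel A f g -> homotopic_rel A g h -> homotopic_rel A f h.
Proof.
move=> [H [cH H0 H1 HA]] [K [cK K0 K1 KA]].
exists (fun p => if 2 * ival p.1 - 1 <= 0 then H (clamp (2 * ival p.1 + 0), p.2)
                 else K (clamp (2 * ival p.1 - 1), p.2)); split.
- apply: paste_continuous.
  + exact: affine_continuous.
  + exact/slice_continuous/affine_continuous.
  + exact/slice_continuous/affine_continuous.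
  + move=> [t x] /= t0; rewrite t0 (clamp_ge1 (x := 2 * ival t + 0)) ?H1 ?K0 //.
    by lra.
- by move=> x /=; rewrite ival0 mulr0 sub0r addr0 lerN10 H0.
- by move=> x /=; rewrite ival1 lt_geF ?clamp_ge1 ?K1 //; lra.
- move=> t x Ax /=; case: ifP => _; first by rewrite HA.
  by rewrite KA // -H1 HA.
Qed.

End equivalence.
End homotopy.

Section fundamental_group.
Context (R : realType) (X : topologicalType) (x : X).
Local Notation I := (unit_interval R).
Local Notation loop := {path I from x to x in X}.
Implicit Types f g h : loop.

Definition path_homotopic f g : bool :=
  `[< homotopic_rel R [set zero; one] f g >].

Lemma path_homotopic_refl : reflexive path_homotopic.
Proof. by move=> f; apply/asboolP/homotopic_rel_refl; exact: cts_fun. Qed.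

Lemma path_homotopic_sym : symmetric path_homotopic.
Proof. by move=> f g; apply/asboolP/asboolP; exact: homotopic_rel_sym. Qed.

Lemma path_homotopic_trans : transitive path_homotopic.
Proof.
by move=> g f h /asboolP fg /asboolP gh; apply/asboolP/(homotopic_rel_trans fg).
Qed.

Definition path_homotopic_equiv := EquivRel path_homotopic
  path_homotopic_refl path_homotopic_sym path_homotopic_trans.

Definition fundamental_group := {eq_quot path_homotopic_equiv}.

HB.instance Definition _ := Choice.on fundamental_group.
HB.instance Definition _ := EqQuotient.on fundamental_group.

Definition concat_fun f g (t : I) : X :=
  if 2 * ival t - 1 <= 0 then f (clamp (2 * ival t))
  else g (clamp (2 * ival t - 1)).

Definition reverse_fun f (t : I) : X := f (clamp (1 - ival t)).

Let reparam_continuous f (phi : I -> R) :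
  continuous phi -> continuous (fun t => f (clamp (phi t))).
Proof.
move=> cphi; apply: (comp_continuous (g := f)); last exact: cts_fun.
exact: comp_continuous cphi clamp_continuous.
Qed.

Let double_continuous : continuous (fun t : I => 2 * ival t).
Proof.
under eq_fun do rewrite -[_ * _]addr0.
exact/affine_continuous/ival_continuous.
Qed.

Let opp_continuous : continuous (fun t : I => 1 - ival t).
Proof.
under eq_fun do rewrite addrC -mulN1r.
exact/affine_continuous/ival_continuous.
Qed.

Let double1_continuous : continuous (fun t : I => 2 * ival t - 1).
Proof. exact/affine_continuous/ival_continuous. Qed.

Lemma concat_continuous f g : continuous (concat_fun f g).
Proof.
apply: paste_continuous.
- exact: double1_continuous.
- exact/reparam_continuous/double_continuous.
- exact/reparam_continuous/double1_continuous.
- move=> t t0; rewrite t0 (clamp_ge1 (x := 2 * ival t)); last by lra.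
  by rewrite clamp_le0 // path_zero path_one.
Qed.

Lemma concat_zero f g : concat_fun f g zero = x.
Proof.
by rewrite /concat_fun ival0 mulr0 sub0r lerN10 clamp_le0 // path_zero.
Qed.

Lemma concat_one f g : concat_fun f g one = x.
Proof. by rewrite /concat_fun ival1 lt_geF ?clamp_ge1 ?path_one //; lra. Qed.

Definition concat f g : loop :=
  mk_path (@concat_continuous f g) (concat_zero f g) (concat_one f g).

Lemma concatE f g t : concat f g t =
  if 2 * ival t - 1 <= 0 then f (clamp (2 * ival t))
  else g (clamp (2 * ival t - 1)).
Proof. by []. Qed.

Lemma reverse_continuous f : continuous (reverse_fun f).
Proof. exact/reparam_continuous/opp_continuous. Qed.

Lemma reverse_zero f : reverse_fun f zero = x.
Proof. by rewrite /reverse_fun ival0 subr0 path_one. Qed.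

Lemma reverse_one f : reverse_fun f one = x.
Proof. by rewrite /reverse_fun ival1 subrr path_zero. Qed.

Definition reverse f : loop :=
  mk_path (@reverse_continuous f) (reverse_zero f) (reverse_one f).

Lemma reverseE f t : reverse f t = f (clamp (1 - ival t)).
Proof. by []. Qed.

Definition constant_loop : loop := cst x.

Let snd_continuous (k : I -> R) :
  continuous k -> continuous (fun p : I * I => k p.2).
Proof.
by move=> ck; apply: comp_continuous ck => p; exact: cvg_snd.
Qed.

Lemma reparam_homotopic f g h (phi psi : I -> R) :
  continuous phi -> continuous psi ->
  (forall t, g t = f (clamp (phi t))) -> (forall t, h t = f (clamp (psi t))) ->
  clamp (phi zero) = clamp (psi zero) -> clamp (phi one) = clamp (psi one) ->
  path_homotopic g h.
Proof.
move=> cphi cpsi gE hE pp0 pp1; apply/asboolP.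
have cc (k : I -> R) : continuous k ->
    continuous (fun p : I * I => ival (clamp (k p.2))).
  move=> ck; apply: (comp_continuous (g := ival)); last first.
    exact: ival_continuous.
  exact: comp_continuous (snd_continuous ck) clamp_continuous.
have c1 : continuous (fun p : I * I => ival p.1).
  apply: (comp_continuous (f := fst)); last exact: ival_continuous.
  by move=> p; exact: cvg_fst.
exists (fun p => f (clamp ((1 - ival p.1) * ival (clamp (phi p.2))
                           + ival p.1 * ival (clamp (psi p.2))))); split.
- apply: (comp_continuous (g := f)); last exact: cts_fun.
  apply: comp_continuous clamp_continuous => p.
  apply: cvgD; apply: cvgM; [|exact: (cc _ cphi)|exact: c1|exact: (cc _ cpsi)].
  by apply: cvgB; [exact: cvg_cst|exact: c1].
- by move=> t; rewrite gE ival0 subr0 mul1r mul0r addr0 clampK.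
- by move=> t; rewrite hE ival1 subrr mul1r mul0r add0r clampK.
- by move=> s t [] ->; rewrite gE /= -?pp0 -?pp1 -mulrDl subrK mul1r clampK.
Qed.

Lemma concat_homotopic f f' g g' : path_homotopic f f' ->
  path_homotopic g g' -> path_homotopic (concat f g) (concat f' g').
Proof.
move=> /asboolP[H [cH H0 H1 HA]] /asboolP[K [cK K0 K1 KA]]; apply/asboolP.
have ch (L : I * I -> X) (k : I -> R) : continuous L -> continuous k ->
    continuous (fun p : I * I => L (p.1, clamp (k p.2))).
  move=> cL ck; apply: comp_continuous cL.
  apply: pair_continuous; first by move=> p; exact: cvg_fst.
  exact: comp_continuous (snd_continuous ck) clamp_continuous.
exists (fun p => if 2 * ival p.2 - 1 <= 0 then H (p.1, clamp (2 * ival p.2))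
                 else K (p.1, clamp (2 * ival p.2 - 1))); split.
- apply: paste_continuous; [exact: (snd_continuous double1_continuous)
    |exact: (ch _ _ cH double_continuous)
    |exact: (ch _ _ cK double1_continuous)|].
  move=> [s t] /= t0; rewrite t0 (clamp_ge1 (x := 2 * ival t)); last by lra.
  rewrite clamp_le0 // HA; last by right.
  by rewrite KA; [rewrite path_zero path_one|left].
- by move=> t /=; rewrite H0 K0.
- by move=> t /=; rewrite H1 K1.
- move=> s t [] -> /=.
    rewrite [RHS]concat_zero ival0 mulr0 sub0r lerN10 HA; last first.
      by left; rewrite clamp_le0.
    by rewrite clamp_le0 // path_zero.
  rewrite [RHS]concat_one ival1 lt_geF; last by lra.
  have -> : clamp (2 * 1 - 1) = one :> I by rewrite clamp_ge1 //; lra.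
  by rewrite KA ?path_one //; right.
Qed.

Lemma reverse_homotopic f g :
  path_homotopic f g -> path_homotopic (reverse f) (reverse g).
Proof.
move=> /asboolP[H [cH H0 H1 HA]]; apply/asboolP.
exists (fun p => H (p.1, clamp (1 - ival p.2))); split.
- apply: comp_continuous cH.
  apply: pair_continuous; first by move=> p; exact: cvg_fst.
  exact: comp_continuous (snd_continuous opp_continuous) clamp_continuous.
- by move=> t /=; rewrite H0.
- by move=> t /=; rewrite H1.
- move=> s t [] -> /=.
    by rewrite HA // ival0 subr0; right.
  by rewrite HA // ival1 subrr; left.
Qed.

Let max_continuous (k l : I -> R) : continuous k -> continuous l ->
  continuous (fun t => Num.max (k t) (l t)).
Proof. by move=> ck cl t; exact: (continuous_max (ck t) (cl t)). Qed.

Lemma concatA f g h :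
  path_homotopic (concat f (concat g h)) (concat (concat f g) h).
Proof.
pose phi (s : R) :=
  Num.max (2^-1 * s + 0) (Num.max (1 * s - 4^-1) (2 * s - 1)).
have phi1 s : s <= 2^-1 -> phi s = 2^-1 * s.
  by move=> s1; rewrite /phi addr0 max_l // ge_max; apply/andP; split; lra.
have phi2 s : 2^-1 <= s -> s <= 3 / 4 -> phi s = s - 4^-1.
  move=> s1 s2; rewrite /phi mul1r (max_l (x := s - 4^-1)); last by lra.
  by rewrite max_r //; lra.
have phi3 s : 3 / 4 <= s -> phi s = 2 * s - 1.
  move=> s1; rewrite /phi mul1r (max_r (x := s - 4^-1)); last by lra.
  by rewrite max_r //; lra.
apply: (@reparam_homotopic (concat (concat f g) h) _ _ (phi \o ival) ival).
- do 2?[apply: max_continuous];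
  by apply: affine_continuous; exact: ival_continuous.
- exact: ival_continuous.
- move=> t; have := ival_ge0 t; have := ival_le1 t; set s := ival t => s1 s0.
  rewrite !concatE /= -/s.
  have [h1|h1] := leP s 2^-1.
    rewrite phi1 // (clampE (x := 2^-1 * s)); [|lra|lra].
    have -> : 2 * s - 1 <= 0 by lra.
    have -> : 2 * (2^-1 * s) - 1 <= 0 by lra.
    rewrite clampE; [|lra|lra].
    have -> : 2 * (2 * (2^-1 * s)) - 1 <= 0 by lra.
    by congr (f (clamp _)); lra.
  rewrite [2 * s - 1 <= 0]lt_geF; last by lra.
  rewrite (clampE (x := 2 * s - 1)); [|lra|lra].
  have [h2|h2] := leP s (3 / 4).
    rewrite phi2 //; last exact: ltW.
    rewrite (clampE (x := s - 4^-1)); [|lra|lra].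
    have -> : 2 * (2 * s - 1) - 1 <= 0 by lra.
    have -> : 2 * (s - 4^-1) - 1 <= 0 by lra.
    rewrite (clampE (x := 2 * (s - 4^-1))); [|lra|lra].
    rewrite lt_geF; last by lra.
    by congr (g (clamp _)); lra.
  rewrite phi3; last exact: ltW.
  rewrite (clampE (x := 2 * s - 1)); [|lra|lra].
  by rewrite lt_geF //; lra.
- by move=> t; rewrite clampK.
- by rewrite /= ival0 phi1 ?mulr0 //; lra.
- by rewrite /= ival1 phi3; [congr clamp; lra|lra].
Qed.

Lemma concat1f f : path_homotopic (concat constant_loop f) f.
Proof.
apply: (@reparam_homotopic f _ _ (fun t => 2 * ival t - 1) ival) => //.
- exact: ival_continuous.
- move=> t; rewrite concatE.
  by case: ifP => // t0; rewrite (clamp_le0 t0) path_zero.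
- by move=> t; rewrite clampK.
- by rewrite ival0 !clamp_le0 //; lra.
- by rewrite ival1 !clamp_ge1 //; lra.
Qed.

Lemma concatf1 f : path_homotopic (concat f constant_loop) f.
Proof.
apply: (@reparam_homotopic f _ _ (fun t => 2 * ival t) ival) => //.
- exact: ival_continuous.
- move=> t; rewrite concatE.
  by case: leP => // t0; rewrite (clamp_ge1 (x := 2 * _)) ?path_one //; lra.
- by move=> t; rewrite clampK.
- by rewrite ival0 mulr0.
- by rewrite ival1 !clamp_ge1 //; lra.
Qed.

Lemma concatVf f : path_homotopic (concat (reverse f) f) constant_loop.
Proof.
apply: (@reparam_homotopic f _ _
  (fun t => Num.max (-2 * ival t + 1) (2 * ival t - 1)) (cst 1)).
- apply: max_continuous => //; exact/affine_continuous/ival_continuous.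
- by move=> t; exact: cst_continuous.
- move=> t; have := ival_ge0 t; have := ival_le1 t; set s := ival t => s1 s0.
  rewrite concatE reverseE -/s.
  case: leP => t0.
    rewrite max_l; last by lra.
    by congr (f (clamp _)); rewrite clampE; lra.
  by rewrite max_r //; lra.
- by move=> t; rewrite clamp_ge1 // path_one.
- by rewrite ival0 !mulr0 add0r; congr clamp; rewrite /= max_l //; lra.
- rewrite ival1 mulr1 mulr1; congr clamp; rewrite /= max_r; lra.
Qed.

Lemma concatfV f : path_homotopic (concat f (reverse f)) constant_loop.
Proof.
have revK : reverse (reverse f) = f.
  apply/path_eqP => t; rewrite !reverseE.
  have := ival_ge0 t; have := ival_le1 t => s1 s0.
  by rewrite clampE ?subKr ?clampK //; lra.
by rewrite -{1}revK; exact: concatVf.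
Qed.

Definition loop_class f : fundamental_group := \pi f.

Lemma loop_classP f g : reflect (homotopic_rel R [set zero; one] f g)
  (loop_class f == loop_class g).
Proof. by rewrite /loop_class eqmodE; exact: asboolP. Qed.

Definition pi1_one : fundamental_group := loop_class constant_loop.

Definition pi1_mul (a b : fundamental_group) : fundamental_group :=
  loop_class (concat (repr a) (repr b)).

Definition pi1_inv (a : fundamental_group) : fundamental_group :=
  loop_class (reverse (repr a)).

Let classE f g : path_homotopic f g -> loop_class f = loop_class g.
Proof. by move=> fg; apply/eqP; rewrite /loop_class eqmodE. Qed.

Let reprE f : path_homotopic (repr (loop_class f)) f.
Proof. by have := reprK (loop_class f) => /eqmodP. Qed.

Lemma pi1_mulE f g :
  pi1_mul (loop_class f) (loop_class g) = loop_class (concat f g).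
Proof. by apply: classE; apply: concat_homotopic; exact: reprE. Qed.

Lemma pi1_invE f : pi1_inv (loop_class f) = loop_class (reverse f).
Proof. by apply: classE; apply: reverse_homotopic; exact: reprE. Qed.

Let pi1_ind (P : fundamental_group -> Prop) :
  (forall f, P (loop_class f)) -> forall a, P a.
Proof. by move=> Pf a; rewrite -[a]reprK; exact: Pf. Qed.

Lemma pi1_mulA : associative pi1_mul.
Proof.
elim/pi1_ind => f; elim/pi1_ind => g; elim/pi1_ind => h.
by rewrite !pi1_mulE; exact/classE/concatA.
Qed.

Lemma pi1_mul1 : left_id pi1_one pi1_mul.
Proof. by elim/pi1_ind => f; rewrite pi1_mulE; exact/classE/concat1f. Qed.

Lemma pi1_mulr1 : right_id pi1_one pi1_mul.
Proof. by elim/pi1_ind => f; rewrite pi1_mulE; exact/classE/concatf1. Qed.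

Lemma pi1_mulV : left_inverse pi1_one pi1_inv pi1_mul.
Proof.
by elim/pi1_ind => f; rewrite pi1_invE pi1_mulE; exact/classE/concatVf.
Qed.

Lemma pi1_mulrV : right_inverse pi1_one pi1_inv pi1_mul.
Proof.
by elim/pi1_ind => f; rewrite pi1_invE pi1_mulE; exact/classE/concatfV.
Qed.

HB.instance Definition _ := isGroup.Build fundamental_group
  pi1_mulA pi1_mul1 pi1_mulr1 pi1_mulV pi1_mulrV.

End fundamental_group.

Section homotopy_groups.
Context (R : realType) (k : nat) (X : topologicalType) (x : X).
Local Notation I := (unit_interval R).

Definition cube_boundary : set 'rV[I]_k :=
  [set v | exists i, v ord0 i = zero \/ v ord0 i = one].

Definition cube_map :=
  {f : 'rV[I]_k -> X | continuous f /\ forall v, cube_boundary v -> f v = x}.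

HB.instance Definition _ := gen_eqMixin cube_map.
HB.instance Definition _ := gen_choiceMixin cube_map.

Implicit Types f g h : cube_map.

Definition cube_homotopic f g : bool :=
  `[< homotopic_rel R cube_boundary (sval f) (sval g) >].

Lemma cube_homotopic_refl : reflexive cube_homotopic.
Proof. by case=> f [cf fx]; exact/asboolP/homotopic_rel_refl. Qed.

Lemma cube_homotopic_sym : symmetric cube_homotopic.
Proof. by move=> f g; apply/asboolP/asboolP; exact: homotopic_rel_sym. Qed.

Lemma cube_homotopic_trans : transitive cube_homotopic.
Proof.
by move=> g f h /asboolP fg /asboolP gh; apply/asboolP/(homotopic_rel_trans fg).
Qed.

Definition cube_homotopic_equiv := EquivRel cube_homotopic
  cube_homotopic_refl cube_homotopic_sym cube_homotopic_trans.

(* Only the underlying set of the k-th homotopy group, which is all that its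
   vanishing depends on. *)
Definition homotopy_group_set := {eq_quot cube_homotopic_equiv}.

HB.instance Definition _ := Choice.on homotopy_group_set.
HB.instance Definition _ := EqQuotient.on homotopy_group_set.

End homotopy_groups.

Definition group_isomorphic (G H : groupType) :=
  exists f : {multiplicative G -> H}, bijective f.

Definition eilenberg_maclane1 (R : realType) (G : groupType)
    (X : topologicalType) :=
  [/\ path_connected R X,
    forall x : X, group_isomorphic (fundamental_group R x) G &
    forall (k : nat) (x : X), (2 <= k)%N ->
      forall a b : homotopy_group_set R k x, a = b].

Definition free_basis (B : Type) (G : groupType) (e : B -> G) :=
  forall (H : groupType) (h : B -> H),
    exists2 f : {multiplicative G -> H}, (forall b, f (e b) = h b) &
      forall f' : {multiplicative G -> H},
        (forall b, f' (e b) = h b) -> f' =1 f.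

Definition free_group_on (n : nat) (G : groupType) :=
  exists e : 'I_n -> G, free_basis e.

Definition circle (R : realType) : Type :=
  [set z : R * R | z.1 ^+ 2 + z.2 ^+ 2 = 1].

HB.instance Definition _ (R : realType) := Topological.on (circle R).

Lemma circle_base_subproof (R : realType) :
  (1, 0) \in [set z : R * R | z.1 ^+ 2 + z.2 ^+ 2 = 1].
Proof. by apply/mem_set; rewrite /= expr1n expr0n addr0. Qed.

Definition circle_base (R : realType) : circle R :=
  SigSub (circle_base_subproof R).

(* A quotient of the empty coproduct would be empty, so that the wedge of no
   circles has to be set apart. *)
Definition wedge_of_circles (R : realType) (n : nat) : topologicalType :=
  if n is m.+1 then wedge (fun _ : 'I_m.+1 => circle_base R)
  else discrete_topology unit.

Definition is_composition (w : seq nat) := all (leq 1) w.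

Definition comp_size (w : seq nat) : nat := sumn w.

Definition comp_reduced_size (w : seq nat) : nat := sumn (map predn w).

Definition Omega (d : nat) : set (seq nat) :=
  [set w | [/\ is_composition w, (comp_size w <= d)%N &
             (comp_size w = d %[mod 2])%N]].

Definition Omega_reduced_ge (d k : nat) : set (seq nat) :=
  [set w | Omega d w /\ (k <= comp_reduced_size w)%N].

Section polynomial_space.
Context (R : realType) (d : nat).

Definition monic_of_coefs (a : 'rV[R]_d) : {poly R} := 'X^d + rVpoly a.

Lemma monic_of_coefsP (p : {poly R}) :
  (p \is monic /\ size p = d.+1) <-> exists a, monic_of_coefs a = p.
Proof.
have sz (a : 'rV[R]_d) : (size (rVpoly a) < size ('X^d : {poly R}))%N.
  by rewrite size_polyXn ltnS size_poly.
split=> [[/monicP mp sp]|[a <-]]; last first.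
  by rewrite monicE lead_coefDl // lead_coefXn size_polyDl // size_polyXn.
exists (poly_rV p); apply/polyP => i; rewrite coefD coefXn coef_rVpoly.
case: insubP => [j _ <-|]; first by rewrite mxE (ltn_eqF (ltn_ord j)) add0r.
rewrite -leqNgt leq_eqVlt => /predU1P[<-|di].
  by rewrite eqxx addr0 -mp lead_coefE sp.
by rewrite gtn_eqF // addr0 nth_default // sp.
Qed.

Definition root_pattern (p : {poly R}) : seq nat :=
  [seq \mu_r p | r <- rootsR p].

(* The points are coefficient vectors; monic_of_coefsP gives the dictionary
   with monic polynomials of degree [d]. *)
Definition poly_compl (Theta : set (seq nat)) : set 'rV[R]_d :=
  [set a | ~ Theta (root_pattern (monic_of_coefs a))].

End polynomial_space.

Arguments poly_compl : clear implicits.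

(* Main.v *)
Require Import Defs.
From HB Require Import structures.
From mathcomp Require Import all_boot all_order all_algebra generic_quotient.
From mathcomp Require Import all_classical all_reals all_analysis.
From mathcomp Require Import homotopy polyorder polyrcf zify ring lra.

Set Implicit Arguments.
Unset Strict Implicit.
Unset Printing Implicit Defensive.

Import Order.TTheory GRing.Theory Num.Theory.
Import numFieldNormedType.Exports.

Local Open Scope classical_set_scope.
Local Open Scope ring_scope.

(** The space of the theorem is cut into pieces by the number [k] of real roots,
    counted with multiplicity.  The polynomials with [k] simple real roots form
    an open set U(k), which is contractible: its points are described by the
    roots, that is, by a point of an open convex set, and by a positive
    complementary factor, and the positive monic polynomials of a given degree
    form a convex set.  The other polynomials have [k] real roots of which the
    neighbours number [i] and [i + 1] coincide, counted from [0]; they form a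
    wall W(k, i).  On one side of it the double root splits into two real roots,
    on the other one it leaves the real line, so that the wall separates U(k)
    from U(k - 2) and has no other neighbours.  The union of the wall and of its
    two sides is contractible as well.  Hence the space has the homotopy type of
    a graph whose vertices are the numbers [k] between [0] and [d] with the
    parity of [d], and which has [k - 1] edges between [k] and [k - 2].  The
    edges with [i = 0] form a spanning path of the graph, and the number of the
    remaining ones is the sum of [k - 2] over the vertices [k >= 2], which is the
    number of circles in the theorem ([size_walls]).

    This passage from the pieces to a graph is made for any normal Hausdorff
    space with a [wall_system]: a contractible open set [base], here the union
    of all the U(k) and of the walls of the spanning path, and [n] further walls
    with contractible neighbourhoods ([star]) and contractible sides in [base].

    - For the homotopy equivalence ([wall_system_wedge]), bump functions of the
      walls give a map to the wedge of circles, the transverse coordinate of the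
      wall [i] being the coordinate of the circle [i].  The contractions provide
      a loop through each wall, hence a map back, and the composite [crush] of
      the two maps is homotopic to the identity ([crush_homotopic]).

    - For the fundamental group ([wall_system_pi1]), a family of elements [h i]
      of a group assigns to a path the product of the factors [h i] or their
      inverses for the walls that it crosses, its [holonomy].  It is the
      integral of a [local_cocycle], which is invariant under homotopies since
      local cocycles have primitives over squares ([contractible_primitive]).
      This gives the homomorphisms out of the fundamental group that freeness
      requires.  That the lassos through the walls generate follows from the
      injectivity of one such homomorphism, the one to the bijections of the set
      of reduced words ([holonomy_translation_inj]): a primitive labels the
      points of the loop by vertices of the universal cover of the graph, which
      is a tree, and the contraction of the tree contracts the loop
      ([crush_contract]).

    - The same contraction applies to maps from cubes of dimension at least two,
      over which primitives always exist ([wall_system_aspherical]).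

    For the space of polynomials, the topological input is the continuity of the
    real roots near a polynomial with at most one double root
    ([rootlist_near_admissible]).  The deformation of a wall and its sides into
    U(k - 2) is [split_deformation], and its use along the spanning path
    contracts [base] ([base_contract]). *)

(** * Pointwise continuity *)

Section pointwise_continuity.

Lemma continuous_at_comp (S T U : topologicalType) (f : S -> T) (g : T -> U) z :
  continuous_at z f -> continuous_at (f z) g ->
  continuous_at z (fun s => g (f s)).
Proof. exact: continuous_comp. Qed.

Lemma continuous_at_pair (S T U : topologicalType) (f : S -> T) (g : S -> U) z :
  continuous_at z f -> continuous_at z g ->
  continuous_at z (fun s => (f s, g s)).
Proof. by move=> cf cg; apply: cvg_pair. Qed.

Lemma continuous_at_near (S T : topologicalType) (f g : S -> T) z :
  (\forall s \near z, f s = g s) ->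
  continuous_at z f -> continuous_at z g.
Proof.
move=> fg cf; have fgz : f z = g z by exact: nbhs_singleton fg.
move=> U; rewrite -fgz => /cf /=; apply: filterS2 fg => s /= ->; exact.
Qed.

Lemma continuous_at_subtype (S T : topologicalType) (A : set T) (f : S -> A) z :
  continuous_at z (fun s => set_val (f s)) -> continuous_at z f.
Proof.
move=> cf U [/= _ [[W oW <-]] /= Wz /filterS]; apply.
by apply: cf; exact: open_nbhs_nbhs.
Qed.

Lemma subtype_continuous (T : topologicalType) (A : set T) :
  continuous (fun a : A => set_val a).
Proof. exact: initial_continuous. Qed.

Lemma continuous_at_row (S T : topologicalType) k (f : S -> 'rV[T]_k) z :
  (forall i, continuous_at z (fun s => f s ord0 i)) ->
  continuous_at z f.
Proof.
move=> cf U [P Pz PU].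
apply: (@filterS _ (nbhs z) _ [set s | forall i, P ord0 i (f s ord0 i)]).
  by move=> s Ps; apply: PU => i j; rewrite ord1.
by apply: filter_forall => i; exact: (cf i _ (Pz ord0 i)).
Qed.

Lemma row_continuous (T : topologicalType) k (i : 'I_k) :
  continuous (fun v : 'rV[T]_k => v ord0 i).
Proof.
move=> v U Uv; exists (fun _ j => if j == i then U else setT).
  by move=> a j; rewrite ord1; case: eqP => [->//|_]; exact: filterT.
by move=> w /(_ ord0 i); rewrite eqxx.
Qed.

Lemma fst_continuous_at (S T : topologicalType) z :
  continuous_at z (@fst S T).
Proof. exact: cvg_fst. Qed.

Lemma snd_continuous_at (S T : topologicalType) z :
  continuous_at z (@snd S T).
Proof. exact: cvg_snd. Qed.

Lemma near_snd (S T : topologicalType) (p : S * T) (P : set T) :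
  (\forall t \near p.2, P t) -> \forall q \near p, P q.2.
Proof. by move=> hP; exact: (@snd_continuous_at S T p _ hP). Qed.

End pointwise_continuity.

Section real_continuity.
Context (R : realType) (T : topologicalType).
Implicit Types (f g : T -> R) (z : T).

Lemma ctsC (S : topologicalType) (c : S) z : continuous_at z (fun _ : T => c).
Proof. exact: cst_continuous. Qed.

Lemma ctsI z : continuous_at z (fun t : T => t).
Proof. exact: cvg_id. Qed.

Lemma ctsD f g z : continuous_at z f -> continuous_at z g ->
  continuous_at z (fun t => f t + g t).
Proof. by move=> cf cg; apply: cvgD. Qed.

Lemma ctsN f z : continuous_at z f -> continuous_at z (fun t => - f t).
Proof. by move=> cf; apply: cvgN. Qed.

Lemma ctsM f g z : continuous_at z f -> continuous_at z g ->
  continuous_at z (fun t => f t * g t).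
Proof. by move=> cf cg; apply: cvgM. Qed.

Lemma ctsX f n z : continuous_at z f -> continuous_at z (fun t => f t ^+ n).
Proof.
move=> cf; elim: n => [|n IH]; first exact: ctsC.
under [X in continuous_at _ X]eq_fun do rewrite exprS.
exact: ctsM.
Qed.

Lemma ctsA f z : continuous_at z f -> continuous_at z (fun t => `|f t|).
Proof. by move=> cf; apply: cvg_norm. Qed.

Lemma ctsV f z : f z != 0 -> continuous_at z f ->
  continuous_at z (fun t => (f t)^-1).
Proof. by move=> fz cf; apply: cvgV. Qed.

Lemma cts_max f g z : continuous_at z f -> continuous_at z g ->
  continuous_at z (fun t => Num.max (f t) (g t)).
Proof. exact: continuous_max. Qed.

Lemma cts_min f g z : continuous_at z f -> continuous_at z g ->
  continuous_at z (fun t => Num.min (f t) (g t)).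
Proof. exact: continuous_min. Qed.

Lemma cts_sqrt f z : continuous_at z f ->
  continuous_at z (fun t => Num.sqrt (f t)).
Proof. by move=> cf; apply: continuous_comp => //; exact: sqrt_continuous. Qed.

Lemma cts_sum n (f : 'I_n -> T -> R) z : (forall i, continuous_at z (f i)) ->
  continuous_at z (fun t => \sum_i f i t).
Proof.
move=> cf; rewrite (_ : (fun t => _) = \sum_i f i).
  by elim/big_ind : _ => [|g h cg ch|//]; [exact: ctsC|exact: ctsD].
by apply/funext => t; rewrite fct_sumE.
Qed.

Lemma cts_prod (J : Type) (r : seq J) (f : J -> T -> R) z :
  (forall i, continuous_at z (f i)) ->
  continuous_at z (fun t => \prod_(i <- r) f i t).
Proof.
move=> cf; elim: r => [|i r IH].
  by under [X in continuous_at _ X]eq_fun do rewrite big_nil; exact: ctsC.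
by under [X in continuous_at _ X]eq_fun do rewrite big_cons; exact: ctsM.
Qed.

Lemma cts_bigmax (J : Type) (r : seq J) (P : pred J) (f : J -> T -> R) z :
  (forall i, continuous_at z (f i)) ->
  continuous_at z (fun t => \big[Num.max/0]_(i <- r | P i) f i t).
Proof.
move=> cf; elim: r => [|i r IH].
  by under [X in continuous_at _ X]eq_fun do rewrite big_nil; exact: ctsC.
under [X in continuous_at _ X]eq_fun do rewrite big_cons.
by case: (P i) => //; exact: cts_max.
Qed.

(** At a zero of a function it suffices to control the absolute value, whatever
    happens to the sign nearby. *)
Lemma continuous_at_norm0 f z : f z = 0 ->
  continuous_at z (fun t => `|f t|) -> continuous_at z f.
Proof.
move=> f0 cn; rewrite /continuous_at f0; apply/norm_cvg0P.
by move: cn; rewrite /continuous_at f0 normr0.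
Qed.

Lemma cts_ival (f : T -> unit_interval R) z : continuous_at z f ->
  continuous_at z (fun t => ival (f t)).
Proof. by move=> cf; apply: continuous_comp => //; exact: ival_continuous. Qed.

Lemma cts_clamp f z : continuous_at z f ->
  continuous_at z (fun t => clamp (f t)).
Proof. by move=> cf; apply: continuous_comp => //; exact: clamp_continuous. Qed.

Lemma cts_fst (U V : topologicalType) (f : T -> U * V) z :
  continuous_at z f -> continuous_at z (fun t => (f t).1).
Proof. by move=> cf; apply: continuous_comp => //; exact: fst_continuous_at. Qed.

Lemma cts_snd (U V : topologicalType) (f : T -> U * V) z :
  continuous_at z f -> continuous_at z (fun t => (f t).2).
Proof. by move=> cf; apply: continuous_comp => //; exact: snd_continuous_at. Qed.

Lemma cts_row (U : topologicalType) k (f : T -> 'rV[U]_k) (i : 'I_k) z :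
  continuous_at z f -> continuous_at z (fun t => f t ord0 i).
Proof.
by move=> cf; apply: (@continuous_comp _ _ _ f (fun v : 'rV_k => v ord0 i)) => //;
  exact: row_continuous.
Qed.

Lemma cts_comp (U V : topologicalType) (g : U -> V) (f : T -> U) z :
  continuous g -> continuous_at z f -> continuous_at z (fun t => g (f t)).
Proof. by move=> cg cf; apply: continuous_comp => //; exact: cg. Qed.

End real_continuity.

Ltac cts1 := lazymatch goal with
  | H : continuous_at ?z ?f |- continuous_at ?z ?f => exact H
  | |- continuous_at _ (fun=> ?c) => exact: ctsC
  | |- continuous_at _ (fun x => x) => exact: ctsI
  | |- continuous_at _ id => exact: ctsI
  | |- continuous_at _ fst => exact: fst_continuous_at
  | |- continuous_at _ snd => exact: snd_continuous_at
  | |- continuous_at _ (fun x => @GRing.add _ (@?f x) (@?g x)) =>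
      refine (@ctsD _ _ f g _ _ _)
  | |- continuous_at _ (fun x => @GRing.opp _ (@?f x)) => refine (@ctsN _ _ f _ _)
  | |- continuous_at _ (fun x => @GRing.mul _ (@?f x) (@?g x)) =>
      refine (@ctsM _ _ f g _ _ _)
  | |- continuous_at _ (fun x => @GRing.exp _ (@?f x) ?n) =>
      refine (@ctsX _ _ f n _ _)
  | |- continuous_at _ (fun x => @Num.norm _ _ (@?f x)) => refine (@ctsA _ _ f _ _)
  | |- continuous_at _ (fun x => @Order.max _ _ (@?f x) (@?g x)) =>
      refine (@cts_max _ _ f g _ _ _)
  | |- continuous_at _ (fun x => @Order.min _ _ (@?f x) (@?g x)) =>
      refine (@cts_min _ _ f g _ _ _)
  | |- continuous_at _ (fun x => @Num.sqrt _ (@?f x)) => refine (@cts_sqrt _ _ f _ _)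
  | |- continuous_at _ (fun x => ival (@?f x)) => refine (@cts_ival _ _ f _ _)
  | |- continuous_at _ (fun x => clamp (@?f x)) => refine (@cts_clamp _ _ f _ _)
  | |- continuous_at _ (fun x => (@?f x).1) => refine (@cts_fst _ _ _ f _ _)
  | |- continuous_at _ (fun x => (@?f x).2) => refine (@cts_snd _ _ _ f _ _)
  | |- continuous_at _ (fun x => @fun_of_matrix _ _ _ (@?f x) ord0 ?i) =>
      refine (@cts_row _ _ _ f i _ _)
  | |- continuous_at _ (fun x => (@?f x, @?g x)) =>
      refine (@continuous_at_pair _ _ _ f g _ _ _)
  end.

(** Reduces the continuity of an expression to that of its atoms. *)
Ltac cts := repeat (cts1; try assumption).

Lemma interpolate_near (R : realFieldType) (x y c t e : R) :
  `|x - c| < e -> `|y - c| < e -> 0 <= t -> t <= 1 ->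
  `|(1 - t) * x + t * y - c| < e.
Proof.
move=> xe ye t0 t1.
have -> : (1 - t) * x + t * y - c = (1 - t) * (x - c) + t * (y - c) by ring.
apply: (le_lt_trans (ler_normD _ _)); rewrite !normrM (ger0_norm t0).
rewrite (ger0_norm (_ : 0 <= 1 - t)); last by lra.
have [xy|xy] := leP `|x - c| `|y - c|; nra.
Qed.

Section interval.
Context (R : realType).
Local Notation I := (unit_interval R).

(** The connectedness of the interval, in the form of an induction principle. *)
Lemma interval_clopen (P : I -> Prop) (a b : I) :
  (forall r, \forall s \near r, P s <-> P r) -> P a -> P b.
Proof.
move=> Ploc Pa.
pose B := [set x : R | P (clamp x)].
have locR x : \forall y \near x, P (clamp y) <-> P (clamp x).
  exact: (clamp_continuous (Ploc (clamp x))).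
have oB : open B.
  rewrite openE => x Bx; rewrite /interior /=.
  by apply: filterS (locR x) => y [_ h]; exact: h.
have cB : open (~` B).
  rewrite openE => x Bx; rewrite /interior /=.
  by apply: filterS (locR x) => y [h _] /h.
have BT : B = [set: R].
  have cR : connected [set: R].
    rewrite -set_itvNyy; apply/connected_intervalP; exact: interval_is_interval.
  apply: cR.
  - by exists (ival a); rewrite /B /= clampK.
  - by exists B => //; rewrite setTI.
  - by exists B; [rewrite -openC|rewrite setTI].
have : B (ival b) by rewrite BT.
by rewrite /B /= clampK.
Qed.

Lemma interval_locally_constant (T : Type) (f : I -> T) (a b : I) :
  (forall r, \forall s \near r, f s = f r) -> f a = f b.
Proof.
move=> floc; apply: (@interval_clopen (fun r => f a = f r) a) => // r.
by apply: filterS (floc r) => s ->.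
Qed.

Lemma near_interval (r : I) (P : set I) : nbhs r P ->
  exists2 e, 0 < e & forall s, `|ival s - ival r| < e -> P s.
Proof.
move=> [/= _ [[W oW <-]] /= Wr WP].
have : nbhs (ival r) W by exact: open_nbhs_nbhs.
move=> /nbhs_ballP[e /= e0 eW]; exists e => // s sr.
by apply: WP; apply: eW; rewrite /ball /= distrC.
Qed.

Lemma interval_near (r : I) (e : R) (P : set I) : 0 < e ->
  (forall s, `|ival s - ival r| < e -> P s) -> nbhs r P.
Proof.
move=> e0 eP; apply: (filterS eP).
have : nbhs r [set s | ball (ival r) e (ival s)].
  exact: (@ival_continuous R r _ (nbhsx_ballx (ival r) _ e0)).
by apply: filterS => s; rewrite /ball /= distrC.
Qed.

End interval.

(** * Local cocycles and their primitives *)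

Section cocycle.
Context (H : groupType).
Local Open Scope group_scope.

(** The transition functions of a principal bundle with discrete fibre [H], where
    the cocycle identity is only known near each point; a primitive is a section
    of the bundle. *)
Definition local_cocycle (Y : topologicalType) (g : Y -> Y -> H) :=
  forall y0 : Y, exists2 N, nbhs y0 N & forall y y' y'',
    N y -> N y' -> N y'' -> g y y'' = g y y' * g y' y''.

Definition primitive (Y : topologicalType) (g : Y -> Y -> H) (s : Y -> H) :=
  forall y0 : Y, \forall y \near y0, s y = s y0 * g y0 y.

Section basics.
Context (Y : topologicalType) (g : Y -> Y -> H).
Hypothesis gcoc : local_cocycle g.

Lemma cocycle_diag y : g y y = 1.
Proof.
have [N /nbhs_singleton Ny gN] := gcoc y.
by apply: (mulgI (g y y)); rewrite -gN // mulg1.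
Qed.

Lemma cocycle_pullback (Z : topologicalType) (f : Z -> Y) :
  continuous f -> local_cocycle (fun z z' => g (f z) (f z')).
Proof.
move=> cf z0; have [N Nz gN] := gcoc (f z0).
by exists (f @^-1` N); [exact: cf|move=> z z' z'' *; exact: gN].
Qed.

Lemma primitive_pullback (Z : topologicalType) (f : Z -> Y) s :
  continuous f -> primitive g s ->
  primitive (fun z z' => g (f z) (f z')) (fun z => s (f z)).
Proof. by move=> cf gs z0; exact: (cf _ _ (gs (f z0))). Qed.

Lemma primitive_ratio s s' : primitive g s -> primitive g s' ->
  forall y0 : Y, \forall y \near y0, s y * (s' y)^-1 = s y0 * (s' y0)^-1.
Proof.
move=> gs gs' y0; apply: filterS2 (gs y0) (gs' y0) => y -> ->.
by rewrite invgM mulgA mulgK.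
Qed.

End basics.

Section interval_primitive.
Context (R : realType).
Local Notation I := (unit_interval R).

Lemma primitive_interval_unique (g : I -> I -> H) s s' a b :
  primitive g s -> primitive g s' -> (s a)^-1 * s b = (s' a)^-1 * s' b.
Proof.
move=> gs gs'.
have := interval_locally_constant a b (primitive_ratio gs gs').
move=> e; apply: (mulgI (s a)); apply: (mulIg (s' b)^-1).
by rewrite mulVKg -e !mulgA mulgK.
Qed.

(** The set of end points of intervals on which a primitive exists is open and
    closed: the cocycle identity near [r0] extends a primitive from any point
    close to [r0] to all of them, with the values [s r * g r q]. *)
Lemma primitive_interval (g : I -> I -> H) : local_cocycle g ->
  exists2 s, primitive g s & s zero = 1.
Proof.
move=> gcoc.
pose B (r : I) := exists2 s : I -> H, s zero = 1 &
  forall r1 : I, (ival r1 <= ival r)%R ->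
    \forall r2 \near r1, (ival r2 <= ival r)%R -> s r2 = s r1 * g r1 r2.
have [s s0 gs] : B one.
  apply: (@interval_clopen R B zero) => [r0|]; last first.
    exists (fun=> 1) => // r1; rewrite ival0 => r10.
    apply: (@filterE _ (nbhs r1)) => r2 r20.
    have -> : r1 = r2.
      apply: ival_inj; apply/eqP; rewrite eq_le.
      by rewrite (le_trans r10) ?ival_ge0 // (le_trans r20) ?ival_ge0.
    by rewrite (cocycle_diag gcoc) mulg1.
  have [N /near_interval[e e0 eN] gN] := gcoc r0.
  have ext (r r' : I) : (`|ival r - ival r0| < e)%R ->
      (`|ival r' - ival r0| < e)%R -> B r -> B r'.
    move=> rr0 r'r0 [s s0 gs].
    exists (fun q => if (ival q <= ival r)%R then s q else s r * g r q).
      by rewrite ival0 ival_ge0.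
    move=> r1 r1r'; have [r1r|rr1] := leP (ival r1) (ival r); last first.
      have near1 : \forall r2 \near r1, (ival r < ival r2)%R.
        exact: (@ival_continuous R r1 _ (lt_nbhsr rr1)).
      have near2 : \forall r2 \near r1, (`|ival r2 - ival r1| < e - `|ival r1 - ival r0|)%R.
        apply: (@interval_near _ _ (e - `|ival r1 - ival r0|)) => //.
        rewrite subr_gt0; move: rr0 r'r0; rewrite !ltr_norml.
        by move=> /andP[? ?] /andP[? ?]; apply/andP; split; lra.
      have r1r0 : (`|ival r1 - ival r0| < e)%R.
        move: rr0 r'r0; rewrite !ltr_norml.
        by move=> /andP[? ?] /andP[? ?]; apply/andP; split; lra.
      apply: filterS2 near1 near2 => r2 rr2 r12 r2r'.
      rewrite leNgt rr2 /= -mulgA -gN //; apply: eN => //.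
      have -> : (ival r2 - ival r0 = (ival r2 - ival r1) + (ival r1 - ival r0))%R.
        by rewrite addrA subrK.
      by rewrite (le_lt_trans (ler_normD _ _)) // -ltrBrDr.
    have [r1Er|r1Nr] := eqVneq r1 r.
      rewrite r1Er; apply: filterS (gs r (lexx _)) => r2 sr2 r2r'.
      by case: leP => // r2r; exact: sr2.
    have {}r1r : (ival r1 < ival r)%R.
      by rewrite lt_neqAle r1r andbT; apply: contra r1Nr => /eqP /ival_inj ->.
    have near1 : \forall r2 \near r1, (ival r2 < ival r)%R.
      exact: (@ival_continuous R r1 _ (lt_nbhsl r1r)).
    by apply: filterS2 near1 (gs r1 (ltW r1r)) => r2 /ltW r2r sr2 _; rewrite r2r sr2.
  apply: (@interval_near _ _ e) => // r rr0; split; apply: ext => //.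
  - by rewrite subrr normr0.
  - by rewrite subrr normr0.
exists s => // r0; apply: filterS (gs r0 _) => [r sr|]; last by rewrite ival1 ival_le1.
by apply: sr; rewrite ival1 ival_le1.
Qed.

End interval_primitive.

Section contractible_primitive.
Context (R : realType) (Y : topologicalType).
Local Notation I := (unit_interval R).
Context (c : I * Y -> Y) (y1 : Y).
Hypotheses (cc : continuous c) (c0 : forall y, c (zero, y) = y1)
  (c1 : forall y, c (one, y) = y).

(** The primitives along the tracks of the contraction, normalized at the centre,
    fit together. Indeed the times at which they form a primitive in the
    transverse direction are an open and closed set, because a rectangle that is
    short in the direction of time and thin in the transverse one is mapped into
    a set on which the cocycle identity holds. *)
Lemma contractible_primitive (g : Y -> Y -> H) : local_cocycle g ->
  exists s, primitive g s.
Proof.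
move=> gcoc.
have cray y : continuous (fun r : I => c (r, y)).
  apply: comp_continuous cc; apply: pair_continuous => r.
    exact: cvg_id.
  exact: cst_continuous.
have lift y : {s : I -> H |
    primitive (fun r r' => g (c (r, y)) (c (r', y))) s /\ s zero = 1}.
  apply: cid; have [s sP s0] := primitive_interval (cocycle_pullback gcoc (cray y)).
  by exists s.
pose S y := sval (lift y).
have SP y : primitive (fun r r' => g (c (r, y)) (c (r', y))) (S y).
  by have [] := svalP (lift y).
have S0 y : S y zero = 1 by have [] := svalP (lift y).
exists (fun y => S y one) => y0.
pose A (r : I) := \forall y \near y0, S y r = S y0 r * g (c (r, y0)) (c (r, y)).
suff : A one by apply: filterS => y; rewrite !c1.
apply: (@interval_clopen R A zero) => [r0|]; last first.
  by apply: nearW => y; rewrite !S0 !c0 (cocycle_diag gcoc) mulg1.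
have [M Mn gM] := gcoc (c (r0, y0)).
have [[J N] /= [/near_interval[e e0 eJ] N0] JN] := cc Mn.
have MJN r y : (`|ival r - ival r0| < e)%R -> N y -> M (c (r, y)).
  by move=> rr0 Ny; apply: (JN (r, y)); split => //=; exact: eJ.
have slide r r' y : (`|ival r - ival r0| < e)%R -> (`|ival r' - ival r0| < e)%R ->
    N y -> S y r' = S y r * g (c (r, y)) (c (r', y)).
  move=> rr0 r'r0 Ny.
  pose seg (t : I) : I := clamp ((1 - ival t) * ival r + ival t * ival r')%R.
  have segE t : ival (seg t) = ((1 - ival t) * ival r + ival t * ival r')%R.
    have := ival_ge0 t; have := ival_le1 t; have := ival_ge0 r.
    have := ival_le1 r; have := ival_ge0 r'; have := ival_le1 r'.
    by move=> ? ? ? ? ? ?; rewrite clampE //; nra.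
  have cseg : continuous seg.
    by move=> t; rewrite /seg; cts.
  have seg0 : seg zero = r.
    by apply: ival_inj; rewrite segE ival0 subr0 mul1r mul0r addr0.
  have seg1 : seg one = r'.
    by apply: ival_inj; rewrite segE ival1 subrr mul1r mul0r add0r.
  have segM t : M (c (seg t, y)).
    by apply: MJN => //; rewrite segE; apply: interpolate_near; rewrite ?ival_ge0 ?ival_le1.
  have : S y (seg zero) * (g (c (r, y)) (c (seg zero, y)))^-1 =
         S y (seg one) * (g (c (r, y)) (c (seg one, y)))^-1.
    apply: (@interval_locally_constant R _ (fun t =>
      S y (seg t) * (g (c (r, y)) (c (seg t, y)))^-1)) => t.
    have : \forall t' \near t, S y (seg t') =
        S y (seg t) * g (c (seg t, y)) (c (seg t', y)).
      exact: (cseg t _ (SP y (seg t))).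
    apply: filterS => t' ->.
    have -> : g (c (r, y)) (c (seg t', y)) =
        g (c (r, y)) (c (seg t, y)) * g (c (seg t, y)) (c (seg t', y)).
      by apply: gM; rewrite // -?seg0.
    by rewrite invgM mulgA mulgK.
  rewrite seg0 seg1 (cocycle_diag gcoc) invg1 mulg1 => ->.
  by rewrite mulgVK.
have step r r' : (`|ival r - ival r0| < e)%R -> (`|ival r' - ival r0| < e)%R ->
    A r -> A r'.
  move=> rr0 r'r0 Ar; have Ny0 := nbhs_singleton N0.
  apply: filterS2 Ar N0 => y Ary Ny.
  rewrite (slide r r' y) // Ary (slide r r' y0) // -!mulgA; congr (_ * _).
  by rewrite -!gM //; apply: MJN.
apply: (@interval_near _ _ e) => // r rr0; split; apply: step => //.
- by rewrite subrr normr0.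
- by rewrite subrr normr0.
Qed.

End contractible_primitive.
End cocycle.

(** * Null-homotopies relative to a subspace *)

Section collar.
Context (R : realType) (X Y : topologicalType) (A : set Y).
Local Notation I := (unit_interval R).
Context (kappa : I * Y -> Y) (lambda : Y -> R).
Hypotheses (ckappa : continuous kappa) (kappa0 : forall y, kappa (zero, y) = y).
Hypothesis kappaA : forall t a, A a -> A (kappa (t, a)).
Hypotheses (clambda : continuous lambda) (lambdaA : forall a, A a -> lambda a = 0).
Hypothesis lambdaP : forall y, A (kappa (one, y)) \/ lambda y = 1.

(** A contraction [h] of [f] that moves all the points of [A] along the same path
    [d] can be made stationary on [A] if [A] has a collar, in which there is
    room to run back along [d]. The map [kappa one] collapses the collar into
    [A], and [lambda] measures the position in the collar: the map obtained by
    letting [h] act up to the time [lambda] depends on [lambda] only. *)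
Lemma null_homotopic_rel (f : Y -> X) (x : X) (h : I * Y -> X) (d : I -> X) :
  continuous h -> continuous d -> d zero = x ->
  (forall y, h (zero, y) = f y) -> (forall y, h (one, y) = d one) ->
  (forall t a, A a -> h (t, a) = d t) ->
  homotopic_rel R A f (cst x).
Proof.
move=> ch cd d0 h0 h1 hA.
have fA a : A a -> f a = x by move=> Aa; rewrite -h0 hA.
have cf : continuous f.
  have -> : f = fun y => h (zero, y) by apply/funext => y; rewrite h0.
  by apply: (comp_continuous _ ch); apply: pair_continuous => y;
    [exact: cst_continuous|exact: cvg_id].
have c1 : continuous (fun p : I * Y => ival p.1).
  by apply: (comp_continuous _ (@ival_continuous R)); exact: fst_continuous_at.
have c2 : continuous (fun p : I * Y => p.2) by exact: snd_continuous_at.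
pose f1 y := f (kappa (one, y)).
have ff1 : homotopic_rel R A f f1.
  exists (fun p => f (kappa p)); split => //.
  - exact: comp_continuous ckappa cf.
  - by move=> y; rewrite kappa0.
  - by move=> t a Aa; rewrite !fA //; exact: kappaA.
pose f2 y := d (clamp (lambda y)).
have f12 : homotopic_rel R A f1 f2.
  exists (fun p => h (clamp (ival p.1 * lambda p.2), kappa (one, p.2))); split.
  - apply: (comp_continuous _ ch); apply: pair_continuous.
      apply: (comp_continuous _ (@clamp_continuous R)) => p.
      by apply: cvgM; [exact: c1|exact: (comp_continuous c2 clambda)].
    apply: (comp_continuous _ ckappa); apply: pair_continuous => //.
    by move=> p; exact: cst_continuous.
  - by move=> y /=; rewrite ival0 mul0r clamp_le0 ?lexx // h0.
  - move=> y /=; rewrite ival1 mul1r /f2; have [Ay|->] := lambdaP y.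
      by rewrite hA.
    by rewrite clamp_ge1 ?lexx // h1.
  - by move=> t a Aa /=; rewrite lambdaA // mulr0 clamp_le0 ?lexx // h0.
have f2x : homotopic_rel R A f2 (cst x).
  exists (fun p => d (clamp ((1 - ival p.1) * lambda p.2))); split.
  - apply: (comp_continuous _ cd); apply: (comp_continuous _ (@clamp_continuous R)) => p.
    apply: cvgM; last exact: (comp_continuous c2 clambda).
    by apply: cvgB; [exact: cvg_cst|exact: c1].
  - by move=> y /=; rewrite ival0 subr0 mul1r.
  - by move=> y /=; rewrite ival1 subrr mul0r clamp_le0 ?lexx.
  - by move=> t a Aa /=; rewrite /f2 lambdaA // mulr0.
exact: homotopic_rel_trans ff1 (homotopic_rel_trans f12 f2x).
Qed.

End collar.

Section collar_instances.
Context (R : realType).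
Local Notation I := (unit_interval R).

(** At time [one] the outer quarters of the interval are sent to its end points,
    and [bump] is equal to [1] on the remaining half. *)
Definition stretch (t u : I) : I :=
  clamp ((1 + ival t) * (ival u - 2^-1) + 2^-1).

Definition bump (u : I) : R := ival (clamp (2 - 2 * `|2 * ival u - 1|)).

Lemma stretch_continuous : continuous (fun p : I * I => stretch p.1 p.2).
Proof. by move=> p; rewrite /stretch; cts. Qed.

Lemma stretch_zero u : stretch zero u = u.
Proof. by rewrite /stretch ival0 addr0 mul1r subrK clampK. Qed.

Lemma stretch_endpoint t u : u = zero \/ u = one -> stretch t u = u.
Proof.
rewrite /stretch; have := ival_ge0 t => t0; case=> ->.
  by rewrite clamp_le0 // ival0; nra.
by rewrite clamp_ge1 // ival1; nra.
Qed.

Lemma bump_continuous : continuous bump.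
Proof. by move=> u; rewrite /bump; cts. Qed.

Lemma bump_endpoint u : u = zero \/ u = one -> bump u = 0.
Proof.
rewrite /bump; case=> ->.
  by rewrite ival0 mulr0 sub0r normrN normr1 clamp_le0 ?ival0 //; lra.
by rewrite ival1 mulr1 ger0_norm ?clamp_le0 ?ival0 //; lra.
Qed.

Lemma stretch_bump u : (stretch one u = zero \/ stretch one u = one) \/ bump u = 1.
Proof.
rewrite /stretch /bump ival1; set x := ival u.
have [x1|x1] := leP x 4^-1; first by left; left; apply: clamp_le0; lra.
have [x2|x2] := leP (3 / 4) x; first by left; right; apply: clamp_ge1; lra.
right; rewrite clamp_ge1 ?ival1 //.
by have : `|2 * x - 1| <= 2^-1; [rewrite ler_norml; apply/andP; split|]; lra.
Qed.

Lemma null_homotopic_loop (X : topologicalType) (f : I -> X) (x : X)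
    (h : I * I -> X) (d : I -> X) :
  continuous h -> continuous d -> d zero = x ->
  (forall y, h (zero, y) = f y) -> (forall y, h (one, y) = d one) ->
  (forall t, h (t, zero) = d t) -> (forall t, h (t, one) = d t) ->
  homotopic_rel R [set zero; one] f (cst x).
Proof.
move=> ch cd d0 h0 h1 hz ho.
apply: (@null_homotopic_rel R X I [set zero; one] (fun p => stretch p.1 p.2) bump
  _ _ _ _ _ _ f x h d) => //.
- exact: stretch_continuous.
- exact: stretch_zero.
- by move=> t a Aa; rewrite stretch_endpoint.
- exact: bump_continuous.
- exact: bump_endpoint.
- exact: stretch_bump.
- by move=> t a [] ->.
Qed.

Lemma null_homotopic_cube (X : topologicalType) k (f : 'rV[I]_k -> X) (x : X)
    (h : I * 'rV[I]_k -> X) (d : I -> X) :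
  continuous h -> continuous d -> d zero = x ->
  (forall y, h (zero, y) = f y) -> (forall y, h (one, y) = d one) ->
  (forall t a, @cube_boundary R k a -> h (t, a) = d t) ->
  homotopic_rel R (@cube_boundary R k) f (cst x).
Proof.
move=> ch cd d0 h0 h1 hA.
apply: (@null_homotopic_rel R X 'rV[I]_k _
  (fun p => \row_i stretch p.1 (p.2 ord0 i)) (fun v => \prod_i bump (v ord0 i))
  _ _ _ _ _ _ f x h d) => //.
- move=> p; apply: continuous_at_row => i.
  have -> : (fun s : I * 'rV[I]_k => (\row_j stretch s.1 (s.2 ord0 j)) ord0 i) =
            (fun s => stretch s.1 (s.2 ord0 i)) by apply/funext => s; rewrite mxE.
  by rewrite /stretch; cts.
- by move=> v; apply/rowP => i; rewrite mxE stretch_zero.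
- by move=> t v [i vi]; exists i; rewrite mxE stretch_endpoint.
- move=> v; apply: cts_prod => i.
  by apply: (cts_comp bump_continuous); cts.
- by move=> v [i vi]; rewrite (bigD1 i) //= bump_endpoint // mul0r.
- move=> v; case: (pselect (exists i, stretch one (v ord0 i) = zero \/
    stretch one (v ord0 i) = one)) => [[i vi]|nv].
    by left; exists i; rewrite mxE.
  right; rewrite big1 // => i _.
  by case: (stretch_bump (v ord0 i)) => // vi; case: nv; exists i.
Qed.

End collar_instances.

(** * Wall systems *)

Lemma paste_at (R : realType) (T X : topologicalType) (phi : T -> R)
    (f g : T -> X) z :
  continuous_at z phi ->
  (phi z <= 0 -> continuous_at z f) -> (0 <= phi z -> continuous_at z g) ->
  (phi z = 0 -> f z = g z) ->
  continuous_at z (fun t => if phi t <= 0 then f t else g t).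
Proof.
move=> cphi cf cg fg; case: (ltgtP (phi z) 0) => z0.
- have near0 : \forall s \near z, phi s < 0 by exact: (cphi _ (lt_nbhsl z0)).
  apply: continuous_at_near (cf (ltW z0)).
  by apply: filterS near0 => s /ltW ->.
- have near0 : \forall s \near z, 0 < phi s by exact: (cphi _ (lt_nbhsr z0)).
  apply: continuous_at_near (cg (ltW z0)).
  by apply: filterS near0 => s; rewrite ltNge => /negbTE ->.
- move=> U; rewrite z0 lexx => Ufz.
  have := cf _ U Ufz; have := cg _ U; rewrite -fg // => /(_ _ Ufz).
  rewrite z0 lexx => /(_ isT) h1 /(_ isT) h2.
  by move: h1 h2; rewrite /nbhs /=; apply: filterS2 => s /=; case: ifP.
Qed.

Section wall_system.
Context (R : realType) (X : topologicalType).
Local Notation I := (unit_interval R).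

(** The homotopy is given as a function on the whole space with arbitrary values
    outside of [V]; this avoids subspace topologies. *)
Record contraction (V : set X) := Contraction {
  ctr :> I * X -> X;
  ctr_point : X;
  ctr_point_in : V ctr_point;
  ctr_in : forall t x, V x -> V (ctr (t, x));
  ctr_zero : forall x, V x -> ctr (zero, x) = x;
  ctr_one : forall x, V x -> ctr (one, x) = ctr_point;
  ctr_continuous : forall t x, V x -> continuous_at (t, x) ctr }.

(** The walls cut the space down to [base]. The sides [pos i] and [neg i] of the
    wall [i] are subsets of [base], and together with the wall they form [star i].
    As all these pieces are contractible, the space is expected to look like a
    graph with one vertex and one loop for each wall. *)
Record wall_system (n : nat) := WallSystem {
  base : set X;
  wall : 'I_n -> set X;
  pos : 'I_n -> set X;
  neg : 'I_n -> set X;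
  star := fun i x => [\/ pos i x, wall i x | neg i x];
  base_open : open base;
  pos_open : forall i, open (pos i);
  neg_open : forall i, open (neg i);
  star_open : forall i, open (star i);
  wall_cover : forall x, base x \/ exists i, wall i x;
  wall_base : forall i x, wall i x -> ~ base x;
  wall_inj : forall i j x, wall i x -> wall j x -> i = j;
  pos_base : forall i x, pos i x -> base x;
  neg_base : forall i x, neg i x -> base x;
  pos_neg : forall i x, pos i x -> ~ neg i x;
  ctr_base : contraction base;
  ctr_star : forall i, contraction (star i);
  ctr_pos : forall i, contraction (pos i);
  ctr_neg : forall i, contraction (neg i) }.

Section theory.
Context (n : nat) (ws : wall_system n).

Lemma wall_star i j x : wall ws i x -> star ws j x -> i = j.
Proof.
move=> wx; case=> [px|/(wall_inj wx) //|nx].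
- by case: (wall_base wx); exact: pos_base px.
- by case: (wall_base wx); exact: neg_base nx.
Qed.

Lemma star_wallN i x : star ws i x -> ~ wall ws i x -> base ws x.
Proof. by case=> [/pos_base //|? []//|/neg_base]. Qed.

Lemma wall_closed i : closed (wall ws i).
Proof.
rewrite -[wall ws i]setCK; apply: open_closedC.
rewrite (_ : ~` _ = base ws `|` \bigcup_(j in [set j | j != i]) star ws j).
  apply: openU; first exact: base_open.
  by apply: bigcup_open => j _; exact: star_open.
apply/seteqP; split => x /=.
  have [bx|[j wx] nw] := wall_cover ws x; first by left.
  right; exists j; last by apply: Or32.
  by apply/eqP => ji; apply: nw; rewrite -ji.
by case=> [bx /wall_base //|[j /eqP ji sx] /wall_star /(_ sx) /esym].
Qed.

Definition b0 := ctr_point (ctr_base ws).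
Definition apex i := ctr_point (ctr_star ws i).
Definition bpos i := ctr_point (ctr_pos ws i).
Definition bneg i := ctr_point (ctr_neg ws i).

Lemma bpos_pos i : pos ws i (bpos i). Proof. exact: ctr_point_in. Qed.
Lemma bneg_neg i : neg ws i (bneg i). Proof. exact: ctr_point_in. Qed.

Section bumps.
Hypothesis normalX : normal_space X.

(** Urysohn functions of the walls, made disjoint by subtracting from each of
    them the maximum of the other ones. *)
Lemma wall_bumps (K : 'I_n -> set X) : (forall i, closed (K i)) ->
  (forall i x, wall ws i x -> ~ K i x) ->
  exists phi : 'I_n -> X -> R, [/\ forall i, continuous (phi i),
    forall i x, 0 <= phi i x <= 1,
    forall i x, wall ws i x -> phi i x = 1,
    forall i x, 0 < phi i x -> star ws i x /\ ~ K i x &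
    forall i j x, 0 < phi i x -> 0 < phi j x -> i = j].
Proof.
move=> cK wK.
have ury i : {f : X -> R | [/\ continuous f, forall x, 0 <= f x <= 1,
    forall x, wall ws i x -> f x = 1 & forall x, 0 < f x -> star ws i x /\ ~ K i x]}.
  apply: cid.
  have [] := @urysohn_ext_itv X R normalX (~` star ws i `|` K i) (wall ws i) 0 1.
  - by apply: closedU => //; apply: open_closedC; exact: star_open.
  - exact: wall_closed.
  - apply/seteqP; split => x //= [[nsx|kx] wx]; last exact: wK kx.
    by apply: nsx; apply: Or32.
  - exact: ltr01.
  move=> f [cf f0 f1 f01]; exists f; split => //.
  - by move=> x; have := f01 (f x); rewrite /= in_itv /=; apply; exists x.
  - by move=> x wx; apply: f1; exists x.
  - move=> x fx; split; apply: contrapT => h.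
      by move: fx; rewrite (f0 (f x)) ?ltxx //; exists x => //; left.
    move: fx; rewrite (f0 (f x)) ?ltxx //; exists x => //; right.
    exact: contrapT.
pose f i := sval (ury i).
have cf i : continuous (f i) by rewrite /f; case: (ury i) => ? [].
have f01 i x : 0 <= f i x <= 1 by rewrite /f; case: (ury i) => ? [].
have fw i x : wall ws i x -> f i x = 1.
  by rewrite /f; case: (ury i) => g [? ? + ?]; apply.
have fs i x : 0 < f i x -> star ws i x /\ ~ K i x.
  by rewrite /f; case: (ury i) => g [? ? ?]; apply.
pose rest i x := \big[Num.max/0]_(j | j != i) f j x.
have rest0 i x : 0 <= rest i x by exact: bigmax_ge_id.
have le_rest i j x : j != i -> f j x <= rest i x.
  by move=> ji; rewrite /rest; apply: (le_bigmax_cond _ (fun j => f j x)).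
exists (fun i x => Num.max 0 (f i x - rest i x)); split.
- move=> i x; cts; first exact: cf.
  by apply: cts_bigmax => j; exact: cf.
- move=> i x; rewrite le_max lexx /= ge_max ler01 /= lerBlDr.
  by have /andP[_ f1] := f01 i x; have := rest0 i x; lra.
- move=> i x wx; rewrite fw //.
  have -> : rest i x = 0.
    apply/eqP; rewrite eq_le rest0 andbT; apply/bigmax_leP; split => // j ji.
    rewrite leNgt; apply/negP => /fs[sx _]; move: ji.
    by rewrite (wall_star wx sx) eqxx.
  by rewrite subr0 max_r.
- by move=> i x; rewrite lt_max ltxx /= subr_gt0 => /(le_lt_trans (rest0 i x)) /fs.
- move=> i j x; rewrite !lt_max !ltxx /= !subr_gt0 => fi fj.
  apply/eqP/negPn/negP => ij.
  have := lt_trans (le_lt_trans (le_rest j i x ij) fj) (le_lt_trans (le_rest i j x _) fi).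
  by rewrite eq_sym ltxx => /(_ ij).
Qed.

End bumps.

(** For a point [x] of [base] and [star i], the path from [apex i] to [b0] that
    follows the two contractions and passes through [x] at time [1 / 2]. It is
    constant near its ends, so that continuity is not an issue where the bump
    functions are close to [0] or [1] and [x] may leave one of the two sets. *)
Definition bridge i (p : X * R) : X :=
  if p.2 - 2^-1 <= 0 then ctr_star ws i (clamp (2 - 4 * p.2), p.1)
  else ctr_base ws (clamp (4 * p.2 - 2), p.1).

Lemma bridge_continuous i p : base ws p.1 -> star ws i p.1 ->
  continuous_at p (bridge i).
Proof.
case: p => x a /= bx sx; apply: paste_at.
- by cts.
- move=> _; apply: (@continuous_at_comp _ _ _ (fun p : X * R => (clamp (2 - 4 * p.2), p.1))).
    by cts.
  exact: ctr_continuous.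
- move=> _; apply: (@continuous_at_comp _ _ _ (fun p : X * R => (clamp (4 * p.2 - 2), p.1))).
    by cts.
  exact: ctr_continuous.
- move=> /= a12; rewrite !clamp_le0 ?ctr_zero //; lra.
Qed.

Lemma bridge_low i x a : a <= 4^-1 -> star ws i x -> bridge i (x, a) = apex i.
Proof.
move=> a4 sx; rewrite /bridge /= ifT; last by lra.
by rewrite clamp_ge1 ?ctr_one //; lra.
Qed.

Lemma bridge_high i x a : 3 / 4 <= a -> base ws x -> bridge i (x, a) = b0.
Proof.
move=> a4 sx; rewrite /bridge /= ifF; last by apply/negbTE; rewrite -ltNge; lra.
by rewrite clamp_ge1 ?ctr_one //; lra.
Qed.

(** [circ_at z u] is the continuity at [z] of [u] seen as a function into the
    circle obtained from [-1, 1] by identifying its endpoints. *)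
Definition circ_at (T : topologicalType) (z : T) (u : T -> R) :=
  continuous_at z (fun t => `|u t|) /\ (`|u z| != 1 -> continuous_at z u).

Lemma near_gt (T : topologicalType) (f : T -> R) z a :
  continuous_at z f -> a < f z -> \forall t \near z, a < f t.
Proof. by move=> cf fz; exact: (cf _ (lt_nbhsr fz)). Qed.

Lemma near_lt (T : topologicalType) (f : T -> R) z a :
  continuous_at z f -> f z < a -> \forall t \near z, f t < a.
Proof. by move=> cf fz; exact: (cf _ (lt_nbhsl fz)). Qed.

(** The loop through the wall [i], parametrized by [-1, 1]: it is at the base
    point for [u] close to [1] or [-1], in [bpos i] and [bneg i] for [u] equal to
    [1 / 2] and [- 1 / 2], and at the apex for [u] close to [0]. *)
Definition loop i (u : R) : X :=
  bridge i (if 0 <= u then bpos i else bneg i, `|u|).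

Lemma bpos_base i : base ws (bpos i).
Proof. exact: pos_base (bpos_pos i). Qed.
Lemma bneg_base i : base ws (bneg i).
Proof. exact: neg_base (bneg_neg i). Qed.
Lemma bpos_star i : star ws i (bpos i).
Proof. exact: Or31 (bpos_pos i). Qed.
Lemma bneg_star i : star ws i (bneg i).
Proof. exact: Or33 (bneg_neg i). Qed.

Lemma loop_high i u : 3 / 4 <= `|u| -> loop i u = b0.
Proof.
by move=> u34; apply: bridge_high => //; case: ifP => _;
  [exact: bpos_base|exact: bneg_base].
Qed.

Lemma loop_low i u : `|u| <= 4^-1 -> loop i u = apex i.
Proof.
by move=> u34; apply: bridge_low => //; case: ifP => _;
  [exact: bpos_star|exact: bneg_star].
Qed.

Lemma loop_continuous (T : topologicalType) (u : T -> R) z i :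
  circ_at z u -> continuous_at z (fun t => loop i (u t)).
Proof.
move=> [cu1 cu]; have [u34|u34] := ltP (3 / 4) `|u z|.
  apply: (@continuous_at_near _ _ (fun=> b0)); last exact: ctsC.
  by apply: filterS (near_gt cu1 u34) => t /ltW /loop_high ->.
have [u14|u14] := ltP `|u z| 4^-1.
  apply: (@continuous_at_near _ _ (fun=> apex i)); last exact: ctsC.
  by apply: filterS (near_lt cu1 u14) => t /ltW /loop_low ->.
have {}cu : continuous_at z u by apply: cu; apply/negP => /eqP; lra.
have [u0|u0] := leP 0 (u z).
  apply: (@continuous_at_near _ _ (fun t => bridge i (bpos i, `|u t|))).
    have : 0 < u z by move: u14; rewrite ger0_norm //; lra.
    by move=> /(near_gt cu); apply: filterS => t /ltW; rewrite /loop => ->.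
  apply: (@continuous_at_comp _ _ _ (fun t => (bpos i, `|u t|))); first by cts.
  by apply: bridge_continuous; [exact: bpos_base|exact: bpos_star].
apply: (@continuous_at_near _ _ (fun t => bridge i (bneg i, `|u t|))).
  move/(near_lt cu): u0; apply: filterS => t; rewrite /loop ltNge.
  by move=> /negbTE ->.
apply: (@continuous_at_comp _ _ _ (fun t => (bneg i, `|u t|))); first by cts.
by apply: bridge_continuous; [exact: bneg_base|exact: bneg_star].
Qed.

Lemma loop_star i u : `|u| <= 2^-1 -> star ws i (loop i u).
Proof.
move=> u2; rewrite /loop /bridge /= ifT; last by lra.
by apply: ctr_in; case: ifP => _; [exact: bpos_star|exact: bneg_star].
Qed.

Section coordinate.
Context (phi : 'I_n -> X -> R).
Hypothesis cphi : forall i, continuous (phi i).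
Hypothesis phi01 : forall i x, 0 <= phi i x <= 1.
Hypothesis phi_wall : forall i x, wall ws i x -> phi i x = 1.
Hypothesis phi_star : forall i x, 0 < phi i x -> star ws i x.
Hypothesis phi_inj : forall i j x, 0 < phi i x -> 0 < phi j x -> i = j.

(** A coordinate transverse to the wall [i]. Outside of the support of [phi i] it
    is [1] or [-1], which are the same point of the circle. *)
Definition wcoord i x : R :=
  if `[< neg ws i x >] then - (1 - phi i x) else 1 - phi i x.

Lemma wcoord_norm i x : `|wcoord i x| = 1 - phi i x.
Proof.
by rewrite /wcoord; have /andP[? ?] := phi01 i x; case: ifP => _;
  rewrite ?normrN ger0_norm // subr_ge0.
Qed.

Lemma wcoord_pos i x : pos ws i x -> wcoord i x = 1 - phi i x.
Proof. by move=> px; rewrite /wcoord asboolF //; exact: pos_neg. Qed.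

Lemma wcoord_neg i x : neg ws i x -> wcoord i x = - (1 - phi i x).
Proof. by move=> px; rewrite /wcoord asboolT. Qed.

Lemma wcoord_wall i x : wall ws i x -> wcoord i x = 0.
Proof. by move=> /phi_wall p1; rewrite /wcoord p1 subrr oppr0; case: ifP. Qed.

Lemma wcoord_norm_continuous i x : continuous_at x (fun x => `|wcoord i x|).
Proof.
have -> : (fun x => `|wcoord i x|) = (fun x => 1 - phi i x).
  by apply/funext => y; rewrite wcoord_norm.
by cts; exact: cphi.
Qed.

Lemma wcoord_continuous i x : star ws i x -> continuous_at x (wcoord i).
Proof.
have co : continuous_at x (fun x => 1 - phi i x) by cts; exact: cphi.
case=> hx.
- apply: continuous_at_near co.
  have : nbhs x (pos ws i) by apply: open_nbhs_nbhs; split; first exact: pos_open.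
  by apply: filterS => t /wcoord_pos ->.
- have := @wcoord_norm_continuous i x; have := wcoord_wall hx.
  exact: continuous_at_norm0.
- have : continuous_at x (fun x => - (1 - phi i x)) by cts.
  apply: continuous_at_near.
  have : nbhs x (neg ws i) by apply: open_nbhs_nbhs; split; first exact: neg_open.
  by apply: filterS => t /wcoord_neg ->.
Qed.

Lemma wcoord_circ i x : circ_at x (wcoord i).
Proof.
split; first exact: wcoord_norm_continuous.
move=> c1; apply: wcoord_continuous; apply: phi_star.
rewrite lt_neqAle; have /andP[-> _] := phi01 i x; rewrite andbT.
by apply: contra c1 => /eqP p0; rewrite wcoord_norm -p0 subr0.
Qed.

Lemma phi_lt1_base i x : 0 < phi i x < 1 -> base ws x.
Proof.
move=> /andP[p0 p1]; apply: star_wallN (phi_star p0) _.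
by move=> /phi_wall e; move: p1; rewrite e ltxx.
Qed.

Lemma phi0_base x : (forall i, phi i x = 0) -> base ws x.
Proof.
move=> p0; have [//|[i /phi_wall]] := wall_cover ws x.
by rewrite p0 => /esym/eqP; rewrite oner_eq0.
Qed.

Definition sel x := [pick i | 0 < phi i x].

Lemma selP i x : 0 < phi i x -> sel x = Some i.
Proof.
rewrite /sel => p0; case: pickP => [j pj|/(_ i)]; last by rewrite p0.
by rewrite (phi_inj p0 pj).
Qed.

Lemma selN x : (forall i, phi i x = 0) -> sel x = None.
Proof. by move=> p0; rewrite /sel; case: pickP => // j; rewrite p0 ltxx. Qed.

Lemma sel_cases x : (exists i, 0 < phi i x) \/ (forall i, phi i x = 0).
Proof.
have [?|h] := pselect (exists i, 0 < phi i x); [by left|right => i].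
apply/eqP; rewrite eq_le; have /andP[-> _] := phi01 i x; rewrite andbT leNgt.
by apply/negP => p0; apply: h; exists i.
Qed.

Lemma sel_near i x : 0 < phi i x -> \forall y \near x, 0 < phi i y.
Proof. by apply: near_gt; exact: cphi. Qed.

Lemma phi0_near x (e : R) : 0 < e -> (forall i, phi i x = 0) ->
  \forall y \near x, forall i, phi i y < e.
Proof.
move=> e0 p0; apply: filter_forall => i.
by apply: near_lt; [exact: cphi|rewrite p0].
Qed.

(** The projection of the space to the graph formed by the loops, followed by the
    inclusion of the graph. *)
Definition crush x := if sel x is Some i then loop i (wcoord i x) else b0.

(** A point [x] in the support of [phi i] is first moved along its bridge to the
    point [mid i x], then this bridge is moved to that of [bpos i] or [bneg i] by
    the contraction of the side of [x]. On the wall [x] has no bridge, but near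
    the wall [mid i x] is the apex, from whatever side the wall is approached. *)
Lemma crush_homotopic : homotopic R (@id X) crush.
Proof.
pose mid i x := bridge i (x, 1 - phi i x).
pose crush1 x := if sel x is Some i then mid i x else b0.
pose h1 (p : I * X) := if sel p.2 is Some i then
   if (1 - phi i p.2) - 2^-1 <= 0 then
     ctr_star ws i (clamp (ival p.1 * ival (clamp (2 - 4 * (1 - phi i p.2)))), p.2)
   else ctr_base ws (clamp (ival p.1 * ival (clamp (4 * (1 - phi i p.2) - 2))), p.2)
  else ctr_base ws p.
pose h2 (p : I * X) := if sel p.2 is Some i then
   if `[< pos ws i p.2 >] then bridge i (ctr_pos ws i p, 1 - phi i p.2) else
   if `[< neg ws i p.2 >] then bridge i (ctr_neg ws i p, 1 - phi i p.2) else apex i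
  else b0.
have cphi2 i (p : I * X) : continuous_at p (fun p : I * X => phi i p.2).
  by apply: (@cts_comp _ _ _ (phi i) snd); [exact: cphi|cts].
have near2 (P : set X) (p : I * X) : (\forall x \near p.2, P x) ->
  \forall q \near p, P q.2.
  by move=> hP; exact: (@snd_continuous_at _ _ p _ hP).
apply: (@homotopic_rel_trans _ _ _ _ _ crush1).
  exists h1; split => //.
  - move=> [t x]; have [[i pi]|p0] := sel_cases x.
      apply: (@continuous_at_near _ _ (fun p =>
        if (1 - phi i p.2) - 2^-1 <= 0 then
     ctr_star ws i (clamp (ival p.1 * ival (clamp (2 - 4 * (1 - phi i p.2)))), p.2)
   else ctr_base ws (clamp (ival p.1 * ival (clamp (4 * (1 - phi i p.2) - 2))), p.2))).
        by apply: filterS (near2 _ (t, x) (sel_near pi)) => p /selP; rewrite /h1 => ->.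
      apply: paste_at => /=.
      + by cts.
      + move=> _; apply: (@continuous_at_comp _ _ _ (fun p : I * X =>
          (clamp (ival p.1 * ival (clamp (2 - 4 * (1 - phi i p.2)))), p.2))).
          by cts.
        by apply: ctr_continuous; exact: phi_star.
      + move=> p2; apply: (@continuous_at_comp _ _ _ (fun p : I * X =>
          (clamp (ival p.1 * ival (clamp (4 * (1 - phi i p.2) - 2))), p.2))).
          by cts.
        by apply: ctr_continuous; apply: (@phi_lt1_base i); rewrite pi /=; lra.
      + move=> p2.
        have -> : clamp (2 - 4 * (1 - phi i x)) = zero :> I by apply: clamp_le0; lra.
        have -> : clamp (4 * (1 - phi i x) - 2) = zero :> I by apply: clamp_le0; lra.
        rewrite ival0 mulr0 clamp_le0 // !ctr_zero //; last exact: phi_star.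
        by apply: (@phi_lt1_base i); rewrite pi /=; lra.
    apply: (@continuous_at_near _ _ (ctr_base ws)); last first.
      by apply: ctr_continuous; exact: phi0_base.
    have e0 : 0 < 4^-1 :> R by lra.
    apply: filterS (near2 _ (t, x) (phi0_near e0 p0)) => -[s y] /= py.
    rewrite /h1 /sel /=; case: pickP => // i _; rewrite ifF; last first.
      by apply/negbTE; rewrite -ltNge; have := py i; lra.
    rewrite (clamp_ge1 (x := _ - 2)); last by have := py i; lra.
    by rewrite ival1 mulr1 clampK.
  - move=> x; rewrite /h1 /=; have [[i pi]|p0] := sel_cases x.
      rewrite (selP pi) ival0 !mul0r clamp_le0 ?lexx //; case: leP => h.
        by rewrite ctr_zero //; exact: phi_star.
      by rewrite ctr_zero //; apply: (@phi_lt1_base i); rewrite pi /=; lra.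
    by rewrite selN // ctr_zero //; exact: phi0_base.
  - move=> x; rewrite /h1 /crush1 /mid /bridge /=; have [[i pi]|p0] := sel_cases x.
      by rewrite (selP pi) ival1 !mul1r !clampK.
    by rewrite selN // ctr_one //; exact: phi0_base.
exists h2; split => //.
- move=> [t x]; have [[i pi]|p0] := sel_cases x; last first.
    apply: (@continuous_at_near _ _ (fun=> b0)); last exact: ctsC.
    have e0 : 0 < 4^-1 :> R by lra.
    apply: filterS (near2 _ (t, x) (phi0_near e0 p0)) => -[s y] /= py.
    rewrite /h2 /sel /=; case: pickP => // i pi; case: asboolP => [ny|npy].
      rewrite bridge_high //; first by have := py i; lra.
      by apply: (@pos_base _ ws i); exact: ctr_in.
    case: asboolP => [ny|nny].
      rewrite bridge_high //; first by have := py i; lra.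
      by apply: (@neg_base _ ws i); exact: ctr_in.
    have sy := phi_star pi; have [//|wy|//] := sy.
    by exfalso; move: (phi_wall wy) (py i) => ->; lra.
  have : star ws i x by exact: phi_star.
  have cpair (E : I * X -> X) : continuous_at (t, x) E ->
      continuous_at (t, x) (fun q : I * X => (E q, 1 - phi i q.2)).
    by move=> cE; cts.
  case=> hx.
  - apply: (@continuous_at_near _ _ (fun p : I * X =>
      bridge i (ctr_pos ws i p, 1 - phi i p.2))).
      have : nbhs x (pos ws i) by apply: open_nbhs_nbhs; split; first exact: pos_open.
      move=> np; apply: filterS2 (near2 _ (t, x) (sel_near pi)) (near2 _ (t, x) np).
      by move=> p /selP; rewrite /h2 => -> pp; rewrite asboolT.
    apply: (@continuous_at_comp _ _ _ (fun q : I * X =>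
      (ctr_pos ws i q, 1 - phi i q.2)) (bridge i)).
      by apply: cpair; exact: ctr_continuous.
    have pE := ctr_in (ctr_pos ws i) t hx.
    by apply: bridge_continuous; [exact: pos_base pE|exact: Or31 pE].
  - apply: (@continuous_at_near _ _ (fun=> apex i)); last exact: ctsC.
    have p34 : 3 / 4 < phi i x by rewrite phi_wall //; lra.
    have np := near_gt (@cphi i x) p34.
    apply: filterS2 (near2 _ (t, x) (sel_near pi)) (near2 _ (t, x) np).
    move=> [s y] /= /selP; rewrite /h2 /= => -> py.
    case: asboolP => [hy|_].
      by rewrite bridge_low //; [lra|exact: Or31 (ctr_in _ _ hy)].
    case: asboolP => [hy|//].
    by rewrite bridge_low //; [lra|exact: Or33 (ctr_in _ _ hy)].
  - apply: (@continuous_at_near _ _ (fun p : I * X =>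
      bridge i (ctr_neg ws i p, 1 - phi i p.2))).
      have : nbhs x (neg ws i) by apply: open_nbhs_nbhs; split; first exact: neg_open.
      move=> np; apply: filterS2 (near2 _ (t, x) (sel_near pi)) (near2 _ (t, x) np).
      move=> p /selP; rewrite /h2 => -> pp; rewrite asboolF ?asboolT //.
      by move=> /pos_neg /(_ pp).
    apply: (@continuous_at_comp _ _ _ (fun q : I * X =>
      (ctr_neg ws i q, 1 - phi i q.2)) (bridge i)).
      by apply: cpair; exact: ctr_continuous.
    have pE := ctr_in (ctr_neg ws i) t hx.
    by apply: bridge_continuous; [exact: neg_base pE|exact: Or33 pE].
- move=> x; rewrite /h2 /crush1 /mid /=; have [[i pi]|p0] := sel_cases x; last first.
    by rewrite selN.
  rewrite (selP pi); case: asboolP => [hx|np]; first by rewrite ctr_zero.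
  case: asboolP => [hx|nn]; first by rewrite ctr_zero.
  have sx := phi_star pi; have [//|wx|//] := sx.
  by rewrite (phi_wall wx) bridge_low //; lra.
- move=> x; rewrite /h2 /crush /=; have [[i pi]|p0] := sel_cases x; last first.
    by rewrite selN.
  have /andP[_ p1] := phi01 i x.
  rewrite (selP pi); case: asboolP => [hx|np].
    rewrite ctr_one // wcoord_pos // /loop ifT; last by lra.
    by rewrite ger0_norm //; lra.
  have sx := phi_star pi; have [//|wx|hx] := sx.
    rewrite asboolF; last by move=> /(neg_base) /(wall_base wx).
    by rewrite wcoord_wall // loop_low // normr0; lra.
  rewrite asboolT // ctr_one // wcoord_neg // /loop.
  have [e|p1'] := eqVneq (phi i x) 1.
    rewrite e subrr oppr0 normr0 !bridge_low ?invr_ge0 ?ler0n //.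
      by case: ifP => _; [exact: bpos_star|exact: bneg_star].
    exact: bneg_star.
  rewrite ifF ?normrN ?ger0_norm //; [lra|].
  apply/negbTE; rewrite -ltNge; move: p1'; rewrite neq_lt; lra.
Qed.

End coordinate.
End theory.
End wall_system.

(** * Parametrization of the circle *)

Section circle_param.
Context (R : realType).
Implicit Types (u : R) (z : circle R).

Let trunc u := Num.max (-1) (Num.min 1 u).

Let trunc_id u : `|u| <= 1 -> trunc u = u.
Proof. by rewrite ler_norml => /andP[? ?]; rewrite /trunc min_r // max_r. Qed.

Let trunc_bound u : `|trunc u| <= 1.
Proof.
by rewrite ler_norml /trunc le_max lexx /= ge_max ge_min lexx andbT; lra.
Qed.

Definition zeta1 u := 2 * `|trunc u| - 1.
Definition zeta2 u := 2 * Num.sqrt (trunc u * (1 - trunc u))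
  - 2 * Num.sqrt (- (trunc u * (1 + trunc u))).

Lemma zeta1E u : `|u| <= 1 -> zeta1 u = 2 * `|u| - 1.
Proof. by move=> u1; rewrite /zeta1 trunc_id. Qed.

Lemma zeta2_ge0 u : 0 <= u -> u <= 1 -> zeta2 u = 2 * Num.sqrt (u * (1 - u)).
Proof.
move=> u0 u1; rewrite /zeta2 trunc_id ?ger0_norm //.
rewrite [X in _ - _ * X]ler0_sqrtr ?mulr0 ?subr0 //.
by rewrite oppr_le0 mulr_ge0 //; lra.
Qed.

Lemma zeta2_le0 u : -1 <= u -> u <= 0 ->
  zeta2 u = - (2 * Num.sqrt (`|u| * (1 - `|u|))).
Proof.
move=> u0 u1; rewrite /zeta2 trunc_id ler0_norm //; last by lra.
rewrite ler0_sqrtr ?mulr0 ?sub0r; last by rewrite mulr_le0_ge0 //; lra.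
by rewrite mulNr opprK.
Qed.

Lemma zeta2_norm u : `|u| <= 1 -> `|zeta2 u| = 2 * Num.sqrt (`|u| * (1 - `|u|)).
Proof.
rewrite ler_norml => /andP[u0 u1]; have [v0|/ltW v0] := leP 0 u.
  by rewrite zeta2_ge0 // (ger0_norm v0) ger0_norm // mulr_ge0 ?sqrtr_ge0.
by rewrite zeta2_le0 // normrN ger0_norm // mulr_ge0 ?sqrtr_ge0.
Qed.

Lemma zeta_subproof u :
  (zeta1 u, zeta2 u) \in [set z : R * R | z.1 ^+ 2 + z.2 ^+ 2 = 1].
Proof.
apply/mem_set => /=; have tt : trunc (trunc u) = trunc u by rewrite trunc_id.
rewrite (_ : zeta1 u = zeta1 (trunc u)); last by rewrite /zeta1 tt.
rewrite (_ : zeta2 u = zeta2 (trunc u)); last by rewrite /zeta2 tt.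
have v1 := trunc_bound u; set v := trunc u in v1 *.
rewrite -(real_normK (num_real (zeta2 v))) zeta1E // zeta2_norm //.
rewrite exprMn sqr_sqrtr; last by rewrite mulr_ge0 // subr_ge0.
by ring.
Qed.

(** A parametrization of the circle by [-1, 1], with both end points sent to the
    base point. The first coordinate is affine in the absolute value of [u], so
    that the inverse [arg] needs no trigonometric functions. *)
Definition zeta u : circle R := SigSub (zeta_subproof u).

Definition arg z : R :=
  if 0 <= (set_val z).2 then (1 + (set_val z).1) / 2
  else - ((1 + (set_val z).1) / 2).

Lemma circleP z : (set_val z).1 ^+ 2 + (set_val z).2 ^+ 2 = 1.
Proof. by have := set_valP z. Qed.

Lemma circle_bound z : -1 <= (set_val z).1 <= 1.
Proof.
have := circleP z; set x := (set_val z).1; set y := (set_val z).2 => h.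
by have := sqr_ge0 y; apply: contraPT => /=; rewrite negb_and -!ltNge => /orP[]; nra.
Qed.

Lemma arg_norm z : `|arg z| = (1 + (set_val z).1) / 2.
Proof.
have /andP[? ?] := circle_bound z.
by rewrite /arg; case: ifP => _; rewrite ?normrN ger0_norm //; lra.
Qed.

Lemma arg_bound z : `|arg z| <= 1.
Proof. by rewrite arg_norm; have /andP[? ?] := circle_bound z; lra. Qed.

Lemma argK z : zeta (arg z) = z.
Proof.
apply: val_inj => /=.
have := circleP z; have := circle_bound z; have := arg_norm z; have := arg_bound z.
rewrite /arg; case: z => -[x y] /= zP; rewrite /set_val /=.
case: (leP 0 y) => [y0|y0] a1 aE /andP[x0 x1] xy.
  rewrite zeta1E // zeta2_ge0; [|lra..]; rewrite aE; congr (_, _); first by lra.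
  have -> : (1 + x) / 2 * (1 - (1 + x) / 2) = (y / 2) ^+ 2 by nra.
  by rewrite sqrtr_sqr ger0_norm; lra.
rewrite zeta1E // zeta2_le0; [|lra..]; rewrite aE; congr (_, _); first by lra.
have -> : (1 + x) / 2 * (1 - (1 + x) / 2) = (y / 2) ^+ 2 by nra.
by rewrite sqrtr_sqr ltr0_norm; lra.
Qed.

Lemma zetaK u : `|u| < 1 -> arg (zeta u) = u.
Proof.
move=> u1; rewrite /arg [X in X.1]/= [X in X.2]/= /set_val /= zeta1E; last exact: ltW.
move: (u1); rewrite ltr_norml => /andP[u0 u1'].
have [v0|v0] := leP 0 u.
  by rewrite zeta2_ge0 ?mulr_ge0 ?sqrtr_ge0 ?(ger0_norm v0) //; lra.
rewrite zeta2_le0; [|lra..].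
rewrite oppr_ge0 leNgt mulr_gt0 ?ltr0n //= ?ltr0_norm //; first by lra.
by rewrite sqrtr_gt0 mulr_gt0 //; lra.
Qed.

Lemma zeta_end u : `|u| = 1 -> zeta u = circle_base R.
Proof.
move=> u1; apply: val_inj => /=; have u1' : `|u| <= 1 by rewrite u1.
rewrite zeta1E // u1 (_ : zeta2 u = 0); first by congr (_, _); lra.
by apply: normr0_eq0; rewrite zeta2_norm // u1 subrr mulr0 sqrtr0 mulr0.
Qed.

Lemma zeta_continuous (T : topologicalType) (u : T -> R) (a : T) :
  (forall t, `|u t| <= 1) -> circ_at a u -> continuous_at a (fun t => zeta (u t)).
Proof.
move=> u1 [cn cu]; apply: continuous_at_subtype => /=.
have [ua|/cu cua] := eqVneq `|u a| 1; last first.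
  rewrite (_ : (fun s => _) = (fun s => (zeta1 (u s), zeta2 (u s)))) //.
  by rewrite /zeta1 /zeta2 /trunc; cts.
rewrite (_ : (fun s => _) = (fun s => (zeta1 (u s), zeta2 (u s)))) //.
apply: continuous_at_pair.
  rewrite (_ : (fun t => _) = (fun t => 2 * `|u t| - 1)); first by cts.
  by apply/funext => t; rewrite zeta1E.
have z0 : zeta2 (u a) = 0.
  by apply/normr0_eq0; rewrite zeta2_norm // ua subrr mulr0 sqrtr0 mulr0.
apply: (@continuous_at_norm0 _ _ (fun t => zeta2 (u t))) => //.
rewrite (_ : (fun t => _) = (fun t => 2 * Num.sqrt (`|u t| * (1 - `|u t|)))); first by cts.
by apply/funext => t; rewrite zeta2_norm.
Qed.

Lemma arg_circ z : circ_at z arg.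
Proof.
have c1 : continuous_at z (fun z : circle R => (set_val z).1).
  by apply: (@continuous_at_comp _ _ _ set_val fst); [exact: subtype_continuous|cts].
have c2 : continuous_at z (fun z : circle R => (set_val z).2).
  by apply: (@continuous_at_comp _ _ _ set_val snd); [exact: subtype_continuous|cts].
have cn : continuous_at z (fun z => `|arg z|).
  rewrite (_ : (fun z => _) = (fun z : circle R => (1 + (set_val z).1) / 2)); first by cts.
  by apply/funext => t; rewrite arg_norm.
split=> // az.
have cx : continuous_at z (fun z : circle R => (1 + (set_val z).1) / 2) by cts.
have cNx : continuous_at z (fun z : circle R => - ((1 + (set_val z).1) / 2)) by cts.
case: (ltgtP (set_val z).2 0) => y0.
- apply: continuous_at_near cNx; move/(near_lt c2): y0; apply: filterS => t.
  by rewrite /arg leNgt => ->.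
- apply: continuous_at_near cx; move/(near_gt c2): y0; apply: filterS => t.
  by rewrite /arg => /ltW ->.
- have x1 : (set_val z).1 = -1.
    have := circleP z; rewrite y0 expr0n addr0 => /eqP; rewrite sqrf_eq1.
    by move=> /orP[/eqP x1|/eqP //]; move: az; rewrite arg_norm x1; lra.
  have a0 : arg z = 0 by apply: normr0_eq0; rewrite arg_norm x1 subrr mul0r.
  exact: continuous_at_norm0 a0 cn.
Qed.

Lemma circle_base_closed : closed [set circle_base R].
Proof.
rewrite (_ : [set _] = set_val @^-1` [set ((1, 0) : R * R)]).
  apply: closed_comp => [z _|]; first exact: subtype_continuous.
  apply: accessible_closed_set1; apply: hausdorff_accessible; exact: norm_hausdorff.
apply/seteqP; split => z /=; first by move=> ->.
by move=> e; apply: val_inj.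
Qed.

Lemma arg_base : arg (circle_base R) = 1.
Proof. by rewrite /arg /set_val /= lexx; lra. Qed.

End circle_param.

(** * A space with a wall system is a wedge of circles *)

Section wedge_equivalence.
Context (R : realType) (X : topologicalType).
Local Notation I := (unit_interval R).

Section core.
Context (n : nat) (ws : wall_system R X n).

(** Bump functions that vanish on these closed sets only see the middle part of
    the loop [i] among all the points of the graph; this makes the composite of
    the maps between the wedge and the space explicit. *)
Definition base_tracks : set X :=
  \bigcup_(j in [set: 'I_n]) ((fun t : I => ctr_base ws (t, bpos ws j)) @` setT `|`
                   (fun t : I => ctr_base ws (t, bneg ws j)) @` setT).

Definition star_tracks i : set X :=
  \bigcup_(j in [set j | j != i])
    ((fun t : I => ctr_star ws j (t, bpos ws j)) @` setT `|`
     (fun t : I => ctr_star ws j (t, bneg ws j)) @` setT).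

Lemma unit_interval_compact : compact [set: I].
Proof.
rewrite (_ : [set: I] = clamp @` `[(0 : R), 1]%classic); last first.
  apply/seteqP; split => // t _; exists (ival t); last exact: clampK.
  by rewrite /= in_itv /= ival_ge0 ival_le1.
apply: continuous_compact; last exact: segment_compact.
by apply: continuous_subspaceT; exact: clamp_continuous.
Qed.

Lemma track_closed (c : I -> X) : hausdorff_space X -> continuous c ->
  closed (c @` setT).
Proof.
move=> hX cc; apply: compact_closed => //; apply: continuous_compact.
  exact: continuous_subspaceT.
exact: unit_interval_compact.
Qed.

Lemma ctr_track (V : set X) (c : contraction R V) x : V x ->
  continuous (fun t : I => c (t, x)).
Proof.
move=> Vx t; apply: (@continuous_at_comp _ _ _ (fun t : I => (t, x)) c); first by cts.
exact: ctr_continuous.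
Qed.

Lemma tracks_closed i : hausdorff_space X -> closed (base_tracks `|` star_tracks i).
Proof.
move=> hX; apply: closedU.
  apply: closed_bigcup => [|j _]; first exact: finite_finset.
  by apply: closedU; apply: track_closed => //; apply: ctr_track;
    [exact: bpos_base|exact: bneg_base].
apply: closed_bigcup => [|j _]; first exact: finite_finset.
by apply: closedU; apply: track_closed => //; apply: ctr_track;
  [exact: bpos_star|exact: bneg_star].
Qed.

Lemma wall_tracks i x : wall ws i x -> ~ (base_tracks `|` star_tracks i) x.
Proof.
move=> wx [[j _ [[t _ e]|[t _ e]]]|[j /eqP ji [[t _ e]|[t _ e]]]].
- by apply: (wall_base wx); rewrite -e; apply: ctr_in; exact: bpos_base.
- by apply: (wall_base wx); rewrite -e; apply: ctr_in; exact: bneg_base.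
- by apply: ji; apply/esym; apply: (wall_star wx); rewrite -e; apply: ctr_in; exact: bpos_star.
- by apply: ji; apply/esym; apply: (wall_star wx); rewrite -e; apply: ctr_in; exact: bneg_star.
Qed.

Lemma loop_base_tracks i u : 2^-1 <= `|u| -> base_tracks (loop ws i u).
Proof.
move=> u2; exists i => //; rewrite /loop /bridge /=.
have [u0|u0] := leP; last first.
  by case: ifP => _; [left|right]; exists (clamp (4 * `|u| - 2)).
have u12 : `|u| = 2^-1 by lra.
rewrite u12 (_ : clamp _ = zero); last by apply: clamp_le0; lra.
case: ifP => _; [left|right]; exists zero => //.
  by rewrite !ctr_zero //; [exact: bpos_star|exact: bpos_base].
by rewrite !ctr_zero //; [exact: bneg_star|exact: bneg_base].
Qed.

Lemma loop_tracks i j u : i != j -> (base_tracks `|` star_tracks j) (loop ws i u).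
Proof.
move=> ij; have [u2|u2] := leP 2^-1 `|u|; first by left; exact: loop_base_tracks.
right; exists i => //; rewrite /loop /bridge /= ifT; last by lra.
by case: ifP => _; [left|right]; exists (clamp (2 - 4 * `|u|)).
Qed.

End core.

Section succ.
Context (m : nat) (ws : wall_system R X m.+1).
Local Notation n := m.+1.
Local Notation W := (wedge (fun _ : 'I_n => circle_base R)).
Context (phi : 'I_n -> X -> R).
Hypothesis cphi : forall i, continuous (phi i).
Hypothesis phi01 : forall i x, 0 <= phi i x <= 1.
Hypothesis phi_wall : forall i x, wall ws i x -> phi i x = 1.
Hypothesis phi_star : forall i x, 0 < phi i x -> star ws i x.
Hypothesis phi_inj : forall i j x, 0 < phi i x -> 0 < phi j x -> i = j.
Hypothesis phi_tracks : forall i x, 0 < phi i x ->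
  ~ (base_tracks ws `|` star_tracks ws i) x.

Local Notation lift i := (@wedge_lift 'I_n (fun=> circle R) (fun=> circle_base R) i).
Local Notation wcoord := (wcoord ws phi).

Let wcoord_le1 i x : `|wcoord i x| <= 1.
Proof. by rewrite wcoord_norm //; have /andP[? ?] := phi01 i x; lra. Qed.

Definition to_wedge x : W :=
  if sel phi x is Some i then lift i (zeta (wcoord i x)) else lift ord0 (circle_base R).

Lemma to_wedge_continuous : continuous to_wedge.
Proof.
move=> x; have [[i pi]|p0] := sel_cases phi01 x.
  apply: (@continuous_at_near _ _ (fun x => lift i (zeta (wcoord i x)))).
    by apply: filterS (sel_near cphi pi) => y /(selP phi_inj); rewrite /to_wedge => ->.
  apply: (cts_comp (@wedge_lift_continuous _ _ _ i)).
  by apply: zeta_continuous => //; exact: wcoord_circ.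
rewrite /continuous_at {2}/to_wedge selN // => U.
rewrite wedge_point_nbhs => Ui.
have near i : \forall y \near x, U (lift i (zeta (wcoord i y))).
  have ci : continuous_at x (fun y => zeta (wcoord i y)).
    by apply: zeta_continuous => //; exact: wcoord_circ.
  have hz : zeta (wcoord i x) = circle_base R.
    by rewrite zeta_end // wcoord_norm // p0 subr0.
  have : nbhs (zeta (wcoord i x)) [set z | U (lift i z)] by rewrite hz; exact: (Ui i).
  exact: ci.
have : \forall y \near x, forall i, U (lift i (zeta (wcoord i y))).
  exact: filter_forall.
apply: filterS => y Uy /=; rewrite /to_wedge; case: (sel phi y) => [i|]; first exact: Uy.
exact: (nbhs_singleton (Ui ord0 Logic.I)).
Qed.

Definition of_wedge : W -> X := wedge_fun (fun i z => loop ws i (arg z)).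

Lemma of_wedge_continuous : continuous of_wedge.
Proof.
apply: wedge_fun_continuous => [i z|i j].
  by apply: loop_continuous; exact: arg_circ.
by rewrite arg_base !loop_high // normr1; lra.
Qed.

Lemma of_wedgeE i z : of_wedge (lift i z) = loop ws i (arg z).
Proof.
rewrite /of_wedge wedge_lift_funE // => j k.
by rewrite arg_base !loop_high // normr1; lra.
Qed.

Lemma of_to_wedge x : of_wedge (to_wedge x) = crush ws phi x.
Proof.
rewrite /to_wedge /crush; have [[i pi]|p0] := sel_cases phi01 x.
  by rewrite (selP phi_inj pi) of_wedgeE zetaK // wcoord_norm //; lra.
by rewrite selN // of_wedgeE arg_base loop_high // normr1; lra.
Qed.

(** The circle coordinate of the image of the loop [i] in the space: it has
    the values of [arg] at both ends of the loop, so that the linear homotopy to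
    [arg] is a homotopy of maps of the circle. *)
Definition degree1 i (z : circle R) : R :=
  if `|arg z| - 2^-1 <= 0 then wcoord i (loop ws i (arg z))
  else if 0 <= arg z then 1 else -1.

Lemma to_of_wedge i z : to_wedge (of_wedge (lift i z)) = lift i (zeta (degree1 i z)).
Proof.
rewrite of_wedgeE /degree1; set x := loop ws i (arg z).
have other j : j != i -> phi j x = 0.
  move=> ji; apply/eqP; rewrite eq_le; have /andP[-> _] := phi01 j x; rewrite andbT leNgt.
  apply/negP => /phi_tracks; apply; apply: loop_tracks.
  by rewrite eq_sym.
have base_lift j : lift j (circle_base R) = lift i (circle_base R) by exact: wedge_liftE.
have [a2|a2] := leP (`|arg z| - 2^-1) 0; last first.
  rewrite zeta_end; last by case: ifP => _; rewrite ?normrN normr1.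
  rewrite /to_wedge selN // => j; have [->|/other//] := eqVneq j i.
  apply/eqP; rewrite eq_le; have /andP[-> _] := phi01 i x; rewrite andbT leNgt.
  by apply/negP => /phi_tracks; apply; left; apply: loop_base_tracks; lra.
have [[j pj]|p0] := sel_cases phi01 x.
  have ji : j = i.
    by apply/eqP/negPn/negP => /other e; move: pj; rewrite e ltxx.
  by rewrite -ji /to_wedge (selP phi_inj pj).
by rewrite /to_wedge selN // zeta_end // wcoord_norm // p0 subr0.
Qed.

Lemma to_of_wedge_homotopic : homotopic R (to_wedge \o of_wedge) (@id W).
Proof.
pose w i (p : I * circle R) : R :=
  (1 - ival p.1) * degree1 i p.2 + ival p.1 * arg p.2.
have deg_le1 i z : `|degree1 i z| <= 1.
  rewrite /degree1; case: ifP => _; first exact: wcoord_le1.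
  by case: ifP => _; rewrite ?normrN normr1.
have w_le1 i p : `|w i p| <= 1.
  rewrite /w (le_trans (ler_normD _ _)) // !normrM.
  have := ival_ge0 p.1; have := ival_le1 p.1 => t1 t0.
  rewrite (ger0_norm t0) ger0_norm; last by lra.
  by have := deg_le1 i p.2; have := arg_bound p.2; nra.
have deg_cts i z : `|arg z| != 1 -> continuous_at z (degree1 i).
  move=> az1; have [can ca] := arg_circ z; have {}ca := ca az1.
  have cl : continuous_at z (fun z => loop ws i (arg z)).
    by apply: loop_continuous; exact: arg_circ.
  apply: paste_at.
  - by cts.
  - move=> a2; apply: (@continuous_at_comp _ _ _ (fun z => loop ws i (arg z))) => //.
    by apply: wcoord_continuous => //; apply: loop_star; lra.
  - move=> a2; case: (ltgtP 0 (arg z)) => a0.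
    + apply: (@continuous_at_near (circle R) R (fun=> 1)); last exact: ctsC.
      by apply: filterS (near_gt ca a0) => s /ltW ->.
    + apply: (@continuous_at_near (circle R) R (fun=> -1)); last exact: ctsC.
      by apply: filterS (near_lt ca a0) => s; rewrite ltNge => /negbTE ->.
    + by move: a2; rewrite -a0 normr0; lra.
  - move=> a2; have u2 : `|arg z| = 2^-1 by lra.
    have bt : base_tracks ws (loop ws i (arg z)) by apply: loop_base_tracks; rewrite u2.
    have p0 : phi i (loop ws i (arg z)) = 0.
      apply/eqP; rewrite eq_le; have /andP[-> _] := phi01 i (loop ws i (arg z)).
      by rewrite andbT leNgt; apply/negP => /phi_tracks; apply; left.
    rewrite /loop /bridge /= ifT in p0 *; last by lra.
    rewrite clamp_le0 ?ctr_zero in p0 *; try lra.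
    + case: ifP p0 => _ p0; last by rewrite wcoord_neg ?p0 ?subr0 //; exact: bneg_neg.
      by rewrite wcoord_pos ?p0 ?subr0 //; exact: bpos_pos.
    + by case: ifP => _; [exact: bpos_star|exact: bneg_star].
have w_circ i p : circ_at p (w i).
  have ca1 : continuous_at p (fun p : I * circle R => `|arg p.2|).
    apply: (@continuous_at_comp _ _ _ snd (fun z => `|arg z|)); first by cts.
    by have [] := arg_circ p.2.
  have [a1|a1] := eqVneq `|arg p.2| 1.
    have a2 : 2^-1 < `|arg p.2| by rewrite a1; lra.
    have wE q : 2^-1 < `|arg q.2| -> `|w i q| = (1 - ival q.1) + ival q.1 * `|arg q.2|.
      move=> q2; rewrite /w /degree1 ifF; last by apply/negbTE; rewrite -ltNge; lra.
      have := ival_ge0 q.1; have := ival_le1 q.1 => t1 t0.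
      case: (leP 0 (arg q.2)) q2 => a0.
        by rewrite (ger0_norm a0) => ?; rewrite ger0_norm; nra.
      by rewrite (ltr0_norm a0) => ?; rewrite ler0_norm; nra.
    split; last by rewrite wE // a1 mulr1 subrK eqxx.
    apply: (@continuous_at_near _ _ (fun q => (1 - ival q.1) + ival q.1 * `|arg q.2|)).
      by apply: filterS (near_gt ca1 a2) => q /wE.
    by cts.
  have cw : continuous_at p (w i).
    rewrite /w; cts.
      by apply: (@continuous_at_comp _ _ _ snd (degree1 i)); [cts|exact: deg_cts].
    by apply: (@continuous_at_comp _ (circle R) R snd (@arg R)); [cts|apply: (arg_circ p.2).2].
  by split => //; cts.
pose k i (t : I) (z : circle R) : W := lift i (zeta (w i (t, z))).
have kbase t i j : k i t (circle_base R) = k j t (circle_base R).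
  have wb l : zeta (w l (t, circle_base R)) = circle_base R.
    apply: zeta_end; rewrite /w /degree1 /= arg_base normr1 ifF; last first.
      by apply/negbTE; rewrite -ltNge; lra.
    by rewrite ler01 !mulr1 subrK normr1.
  rewrite /k !wb; exact: (@wedge_liftE _ _ (fun=> circle_base R) j (circle_base R) i (circle_base R)).
exists (uncurry (fun t => wedge_fun (k^~ t))); split => //.
- have cb (_ : 'I_n) : closed [set circle_base R] by exact: circle_base_closed.
  apply: wedge_fun_joint_continuous => //.
    exact: finite_finset.
  move=> i p; have -> : uncurry (k i) = (fun q => lift i (zeta (w i q))).
    by apply/funext => -[].
  apply: (cts_comp (@wedge_lift_continuous _ _ _ i)).
  by apply: zeta_continuous.
- move=> y /=; have : (\bigcup_i (lift i) @` setT) y by rewrite wedgeTE.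
  move=> [i _ [z _ <-]]; rewrite wedge_lift_funE //= to_of_wedge /k /w /=.
  by rewrite ival0 subr0 mul1r mul0r addr0.
- move=> y /=; have : (\bigcup_i (lift i) @` setT) y by rewrite wedgeTE.
  move=> [i _ [z _ <-]]; rewrite wedge_lift_funE //= /k /w /=.
  by rewrite ival1 subrr mul0r mul1r add0r argK.
Qed.

End succ.

Theorem wall_system_wedge n (ws : wall_system R X n) :
  normal_space X -> hausdorff_space X ->
  homotopy_equivalent R X (wedge_of_circles R n).
Proof.
case: n ws => [|m] ws nX hX; last first.
  have [phi [cphi phi01 pw ps pi]] := wall_bumps nX
    (fun i => @tracks_closed _ ws i hX) (@wall_tracks _ ws).
  exists (to_wedge ws phi), (of_wedge ws); split.
  - by apply: to_wedge_continuous => // i x /ps[].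
  - exact: of_wedge_continuous.
  - apply: homotopic_rel_sym.
    rewrite (_ : _ \o _ = crush ws phi); last by apply/funext => x; exact: of_to_wedge.
    by apply: crush_homotopic => // i x /ps[].
  - by apply: to_of_wedge_homotopic => // i x /ps[].
have all_base x : base ws x by have [//|[[]]] := wall_cover ws x.
exists (fun=> tt), (fun=> ctr_point (ctr_base ws)); split.
- by move=> x; exact: ctsC.
- by move=> x; exact: ctsC.
- apply: homotopic_rel_sym; exists (ctr_base ws); split => //.
  + by move=> [t x]; exact: ctr_continuous.
  + by move=> x; rewrite ctr_zero.
  + by move=> x; rewrite ctr_one.
- rewrite (_ : _ \o _ = id); last by apply/funext => -[].
  by apply: homotopic_rel_refl => x; exact: ctsI.
Qed.

End wedge_equivalence.

(** * Groups of bijections and reduced words *)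

Section generated.
Context (B : Type) (G : groupType) (e : B -> G).
Local Open Scope group_scope.

Inductive generated : G -> Prop :=
| generated_one : generated 1
| generated_basis b : generated (e b)
| generated_mul g h : generated g -> generated h -> generated (g * h)
| generated_inv g : generated g -> generated g^-1.

End generated.

Section generated_morphism.
Context (B : Type) (G H : groupType) (e : B -> G) (f : {multiplicative G -> H}).
Local Open Scope group_scope.

Lemma multiplicative1 : f 1 = 1.
Proof. by apply: (mulgI (f 1)); rewrite -gmulfM !mulg1. Qed.

Lemma multiplicativeV g : f g^-1 = (f g)^-1.
Proof.
by apply: (mulgI (f g)); rewrite -gmulfM !mulgV multiplicative1.
Qed.

Lemma generated_image h : generated (fun b => f (e b)) h ->
  exists2 g, generated e g & f g = h.
Proof.
elim=> [|b|h1 h2 _ [g1 e1 <-] _ [g2 e2 <-]|h1 _ [g1 e1 <-]].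
- by exists 1; [exact: generated_one|exact: multiplicative1].
- by exists (e b) => //; exact: generated_basis.
- by exists (g1 * g2); [exact: generated_mul|rewrite gmulfM].
- by exists g1^-1; [exact: generated_inv|rewrite multiplicativeV].
Qed.

End generated_morphism.

Lemma generated_eq (B : Type) (G H : groupType) (e : B -> G)
    (f f' : {multiplicative G -> H}) :
  (forall b, f (e b) = f' (e b)) -> forall g, generated e g -> f g = f' g.
Proof.
move=> ff' g; elim=> [|//|g1 g2 _ e1 _ e2|g1 _ e1].
- by rewrite !multiplicative1.
- by rewrite !gmulfM e1 e2.
- by rewrite !multiplicativeV e1.
Qed.

Section symmetric_group.
Context (T : Type).

Record bijection := Bijection {
  bij :> T -> T; bijV : T -> T; bijK : cancel bij bijV; bijVK : cancel bijV bij }.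

Lemma bijection_eq (a b : bijection) : bij a =1 bij b -> a = b.
Proof.
case: a b => [f f' fK f'K] [g g' gK g'K] /= /funext fg.
move: fK f'K; rewrite fg => fK f'K.
have f'g' : f' = g' by apply/funext => x; rewrite -[x in LHS]g'K fK.
move: fK f'K; rewrite f'g' => fK f'K.
by rewrite (Prop_irrelevance fK gK) (Prop_irrelevance f'K g'K).
Qed.

HB.instance Definition _ := gen_eqMixin bijection.
HB.instance Definition _ := gen_choiceMixin bijection.

Definition bij_one := @Bijection id id (fun _ => erefl) (fun _ => erefl).
Definition bij_mul (a b : bijection) : bijection :=
  @Bijection (b \o a) (bijV a \o bijV b) (can_comp (bijK b) (bijK a))
    (can_comp (bijVK a) (bijVK b)).
Definition bij_inv (a : bijection) : bijection := Bijection (bijVK a) (bijK a).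

Lemma bij_mulA : associative bij_mul.
Proof. by move=> a b c; exact: bijection_eq. Qed.
Lemma bij_mul1 : left_id bij_one bij_mul.
Proof. by move=> a; exact: bijection_eq. Qed.
Lemma bij_mulr1 : right_id bij_one bij_mul.
Proof. by move=> a; exact: bijection_eq. Qed.
Lemma bij_mulV : left_inverse bij_one bij_inv bij_mul.
Proof. by move=> a; apply: bijection_eq => x /=; rewrite bijVK. Qed.
Lemma bij_mulrV : right_inverse bij_one bij_inv bij_mul.
Proof. by move=> a; apply: bijection_eq => x /=; rewrite bijK. Qed.

HB.instance Definition _ := isGroup.Build bijection
  bij_mulA bij_mul1 bij_mulr1 bij_mulV bij_mulrV.

Lemma bij_mulE (a b : bijection) x : (a * b)%g x = b (a x).
Proof. by []. Qed.

End symmetric_group.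

Section words.
Context (n : nat).

Definition letter := ('I_n * bool)%type.
Definition opp (l : letter) : letter := (l.1, ~~ l.2).

Lemma oppK : involutive opp.
Proof. by case=> i b; rewrite /opp /= negbK. Qed.

Definition push l (w : seq letter) : seq letter :=
  if w is l' :: w' then if l' == opp l then w' else l :: w else [:: l].

Definition reduced (w : seq letter) := sorted (fun l l' => l' != opp l) w.

Lemma push_reduced l w : reduced w -> reduced (push l w).
Proof.
case: w => [|l' w] //= rw; case: eqVneq => [_|h] /=; last by rewrite h.
exact: path_sorted rw.
Qed.

Lemma pushK l w : reduced w -> push (opp l) (push l w) = w.
Proof.
case: w => [|l' w] /= rw; first by rewrite oppK eqxx.
case: eqVneq => [h|h] /=; last by rewrite oppK eqxx.
by case: w rw => [|l2 w] /=; rewrite h ?oppK // => /andP[/negbTE ->].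
Qed.

Definition word := {w | reduced w}.
Definition empty_word : word := exist reduced [::] isT.
Definition wpush l (w : word) : word := exist reduced _ (push_reduced l (valP w)).

Lemma wpushK l : cancel (wpush l) (wpush (opp l)).
Proof. by move=> [w rw]; apply: val_inj => /=; exact: pushK. Qed.

Lemma wpushVK l : cancel (wpush (opp l)) (wpush l).
Proof. by move=> w; rewrite -{1}(oppK l) wpushK. Qed.

(** The action of a generator of the free group on the reduced words. Using the
    group of all bijections as the target of the holonomy makes it unnecessary to
    construct the free group. *)
Definition translation (i : 'I_n) : bijection word :=
  Bijection (wpushK (i, true)) (wpushVK (i, true)).

End words.

(** * The cocycle of a wall system *)

Section wall_cocycle.
Context (R : realType) (X : topologicalType) (n : nat) (ws : wall_system R X n).
Local Notation I := (unit_interval R).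
Context (phi : 'I_n -> X -> R).
Hypothesis cphi : forall i, continuous (phi i).
Hypothesis phi01 : forall i x, 0 <= phi i x <= 1.
Hypothesis phi_wall : forall i x, wall ws i x -> phi i x = 1.
Hypothesis phi_star : forall i x, 0 < phi i x -> star ws i x.
Hypothesis phi_inj : forall i j x, 0 < phi i x -> 0 < phi j x -> i = j.

Section crossing.
Context (H : groupType) (h : 'I_n -> H).
Local Open Scope group_scope.

Definition side i x : H := if `[< neg ws i x >] then h i else 1.

(** The cocycle of the covering that is glued from copies of [base]: the passage
    from the positive to the negative side of the wall [i] contributes the factor
    [h i]. The threshold [1 / 2] restricts it to a neighbourhood of the wall. *)
Definition crossing x y : H :=
  if [pick i | (2^-1 < phi i x)%R && (2^-1 < phi i y)%R] is Some i
  then (side i x)^-1 * side i y else 1.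

Lemma crossing_some i x y : (2^-1 < phi i x)%R -> (2^-1 < phi i y)%R ->
  crossing x y = (side i x)^-1 * side i y.
Proof.
move=> xi yi; rewrite /crossing; case: pickP => [j /andP[xj _]|/(_ i)]; last first.
  by rewrite xi yi.
have h0 : (0 < 2^-1 :> R)%R by lra.
by rewrite (phi_inj (lt_trans h0 xi) (lt_trans h0 xj)).
Qed.

Lemma side_near_base i x : base ws x -> star ws i x ->
  \forall y \near x, side i y = side i x.
Proof.
move=> bx; case=> [hx|/wall_base //|hx].
  have : nbhs x (pos ws i) by apply: open_nbhs_nbhs; split; first exact: pos_open.
  by apply: filterS => y py; rewrite /side !asboolF //; exact: pos_neg.
have : nbhs x (neg ws i) by apply: open_nbhs_nbhs; split; first exact: neg_open.
by apply: filterS => y py; rewrite /side !asboolT.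
Qed.

Lemma crossing_base x : base ws x ->
  exists2 N, nbhs x N & forall y y', N y -> N y' -> crossing y y' = 1.
Proof.
move=> bx; have [[i pi]|p0] := pselect (exists i, (2^-1 <= phi i x)%R).
  have i0 : (0 < phi i x)%R by lra.
  have n1 := side_near_base bx (phi_star i0).
  have p4 : (4^-1 < phi i x)%R by lra.
  have n2 := near_gt (@cphi i x) p4.
  exists [set y | side i y = side i x /\ (4^-1 < phi i y)%R]; first exact: filterI.
  move=> y y' [sy py] [sy' py']; rewrite /crossing.
  case: pickP => // j /andP[yj _].
  have ji : j = i by apply: (@phi_inj j i y); lra.
  by rewrite ji sy sy' mulVg.
exists [set y | forall i, (phi i y < 2^-1)%R].
  apply: filter_forall => i; apply: near_lt; first exact: cphi.
  by rewrite ltNge; apply/negP => hi; apply: p0; exists i.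
move=> y y' hy _; rewrite /crossing; case: pickP => // j /andP[? _].
by exfalso; have := hy j; lra.
Qed.

Lemma crossing_cocycle : local_cocycle crossing.
Proof.
move=> x; have [/crossing_base[N Nx N1]|[i wx]] := wall_cover ws x.
  by exists N => // y y' y'' *; rewrite !N1 // mulg1.
have p2 : (2^-1 < phi i x)%R by rewrite phi_wall //; lra.
exists [set y | (2^-1 < phi i y)%R]; first exact: near_gt (@cphi i x) p2.
move=> y y' y'' /= *; rewrite !(@crossing_some i) //.
by rewrite -mulgA mulVKg.
Qed.

Lemma crossing_star i x : star ws i x ->
  \forall y \near x, crossing x y = (side i x)^-1 * side i y.
Proof.
move=> sx; have [bx|[j wx]] := wall_cover ws x.
  have [N Nx N1] := crossing_base bx.
  have Nx0 := nbhs_singleton Nx.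
  apply: filterS2 Nx (side_near_base bx sx) => y Ny ->.
  by rewrite mulVg N1.
have ji := wall_star wx sx; subst j.
have p2 : (2^-1 < phi i x)%R by rewrite phi_wall //; lra.
apply: filterS (near_gt (@cphi i x) p2) => y yi.
exact: crossing_some.
Qed.

Lemma crossing_generated x y : generated h (crossing x y).
Proof.
have gs i z : generated h (side i z).
  by rewrite /side; case: ifP => _; [exact: generated_basis|exact: generated_one].
rewrite /crossing; case: pickP => [i _|_]; last exact: generated_one.
by apply: generated_mul => //; exact: generated_inv.
Qed.

(** ** Holonomy of paths *)

(** The result does not depend on the choice of the primitive, since two of them
    differ by a left translation. *)
Definition holonomy (f : I -> X) : H :=
  let s := xget (fun=> 1) (primitive (fun t t' => crossing (f t) (f t'))) in
  (s zero)^-1 * s one.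

Lemma path_cocycle (f : I -> X) : continuous f ->
  local_cocycle (fun t t' => crossing (f t) (f t')).
Proof. by move=> cf; exact: (cocycle_pullback crossing_cocycle cf). Qed.

Lemma holonomyE (f : I -> X) s : continuous f ->
  primitive (fun t t' => crossing (f t) (f t')) s ->
  holonomy f = (s zero)^-1 * s one.
Proof.
move=> cf ps; apply: primitive_interval_unique ps.
have [s' ps' _] := primitive_interval (path_cocycle cf).
exact: (xgetPex _ (ex_intro _ s' ps')).
Qed.

(** Small pieces of a path contribute values of the cocycle, which are products
    of the [h i] and their inverses. *)
Lemma holonomy_generated (f : I -> X) : continuous f -> generated h (holonomy f).
Proof.
move=> cf; have [s ps _] := primitive_interval (path_cocycle cf).
rewrite (holonomyE cf ps).
apply: (@interval_clopen R (fun t => generated h ((s zero)^-1 * s t)) zero).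
  move=> t; apply: filterS (ps t) => t' ->; rewrite mulgA.
  have gc := crossing_generated (f t) (f t'); split => g.
    rewrite -[_ * s t](mulgK (crossing (f t) (f t'))).
    by apply: generated_mul => //; exact: generated_inv.
  exact: generated_mul.
by rewrite mulVg; exact: generated_one.
Qed.

Lemma holonomy_sub (f g : I -> X) s (a : I -> I) : continuous f -> continuous g ->
  primitive (fun t t' => crossing (f t) (f t')) s ->
  continuous a -> (forall t, g t = f (a t)) ->
  (s (a zero))^-1 * s (a one) = holonomy g.
Proof.
move=> cf cg ps ca gE; apply/esym; rewrite (@holonomyE g (fun t => s (a t))) //.
have -> : g = fun t => f (a t) by apply/funext.
exact: (primitive_pullback ca ps).
Qed.

(** A primitive over the square on which the homotopy is defined is constant on
    the two sides where the homotopy is. *)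
Lemma holonomy_homotopic (f g : I -> X) :
  homotopic_rel R [set zero; one] f g -> holonomy f = holonomy g.
Proof.
move=> [K [cK K0 K1 KA]].
have cc : continuous (fun p : I * (I * I) =>
    (clamp (ival p.1 * ival p.2.1) : I, clamp (ival p.1 * ival p.2.2) : I)).
  by move=> p; cts.
have [S pS] : exists S, primitive (fun p q => crossing (K p) (K q)) S.
  apply: (contractible_primitive cc (y1 := (zero, zero))).
  - by move=> y /=; rewrite ival0 !mul0r clamp_le0 ?lexx.
  - by move=> [a b] /=; rewrite ival1 !mul1r !clampK.
  - exact: (@cocycle_pullback H X _ crossing_cocycle (I * I)%type K cK).
have slice (a b : I -> I) : continuous a -> continuous b ->
    primitive (fun t t' => crossing (K (a t, b t)) (K (a t', b t')))
      (fun t => S (a t, b t)).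
  move=> ca cb; apply: (primitive_pullback (f := fun t => (a t, b t)) _ pS) => t.
  by have := ca t; have := cb t => *; cts.
have cI : continuous (fun t : I => t) by move=> t; cts.
have cst_c (u : I) : continuous (fun _ : I => u) by move=> t; cts.
have fE : f = fun t => K (zero, t) by apply/funext => t; rewrite K0.
have gE : g = fun t => K (one, t) by apply/funext => t; rewrite K1.
have cKI u : continuous (fun t : I => K (u, t)).
  by move=> t; apply: (@continuous_at_comp _ _ _ (fun t : I => (u, t)) K); [cts|exact: cK].
rewrite {1}fE {1}gE (holonomyE (cKI zero) (slice _ _ (cst_c zero) cI)).
rewrite (holonomyE (cKI one) (slice _ _ (cst_c one) cI)).
have side_cst u : u = zero \/ u = one -> S (zero, u) = S (one, u).
  move=> hu; have := slice _ _ cI (cst_c u) => ps.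
  apply: (@interval_locally_constant R H (fun t => S (t, u))) => t.
  apply: filterS (ps t) => t' ->; rewrite !KA //.
  by rewrite (cocycle_diag crossing_cocycle) mulg1.
by rewrite !side_cst //; [right|left].
Qed.

Definition pi1_holonomy x (a : fundamental_group R x) : H := holonomy (repr a).

Lemma pi1_holonomyE x (f : {path I from x to x in X}) :
  pi1_holonomy (loop_class f) = holonomy f.
Proof.
apply: holonomy_homotopic; apply/loop_classP/eqP.
by rewrite /loop_class reprK.
Qed.

Lemma holonomy_concat x (f g : {path I from x to x in X}) :
  holonomy (concat f g) = holonomy f * holonomy g.
Proof.
have cfg : continuous (concat f g) by exact: cts_fun.
have [s ps _] := primitive_interval (path_cocycle cfg).
rewrite (holonomyE cfg ps).
have cl : continuous (fun t : I => clamp (2^-1 * ival t) : I) by move=> t; cts.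
have cr : continuous (fun t : I => clamp (2^-1 * ival t + 2^-1) : I) by move=> t; cts.
have cf : continuous f by exact: cts_fun.
have cg : continuous g by exact: cts_fun.
rewrite -(@holonomy_sub _ f _ _ cfg cf ps cl) -?(@holonomy_sub _ g _ _ cfg cg ps cr).
- rewrite ival0 ival1 !mulr0 !mulr1 add0r (_ : clamp 0 = zero) //.
  rewrite (_ : clamp (2^-1 + 2^-1) = one); last by apply: clamp_ge1; lra.
  by rewrite mulgA mulgK.
- move=> t; have := ival_ge0 t; have := ival_le1 t => t1 t0.
  rewrite concatE clampE; [|lra..].
  case: ifP => [hh|_]; last first.
    by rewrite (_ : 2 * (2^-1 * ival t + 2^-1) - 1 = ival t)%R ?clampK //; lra.
  have t00 : ival t = 0 by lra.
  rewrite t00 mulr0 add0r divff // clamp_ge1 // path_one.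
  have -> : t = zero by apply: ival_inj; rewrite ival0.
  by rewrite path_zero.
- move=> t; have := ival_ge0 t; have := ival_le1 t => t1 t0.
  rewrite concatE clampE; [|lra..].
  by rewrite ifT ?mulrA ?divff ?mul1r ?clampK //; lra.
Qed.

Lemma pi1_holonomyM x :
  {morph @pi1_holonomy x : a b / a * b >-> a * b}.
Proof.
move=> a b.
by rewrite [LHS](pi1_holonomyE (concat (repr a) (repr b))) holonomy_concat.
Qed.

Lemma loop_path_continuous i (u : I -> R) : continuous u ->
  continuous (fun t => loop ws i (u t)).
Proof.
move=> cu t; apply: loop_continuous; split; last by move=> _; exact: cu.
by have := cu t => cut; cts.
Qed.

Lemma side_bpos i : side i (bpos ws i) = 1.
Proof. by rewrite /side asboolF //; apply: pos_neg; exact: bpos_pos. Qed.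

Lemma side_bneg i : side i (bneg ws i) = h i.
Proof. by rewrite /side asboolT //; exact: bneg_neg. Qed.

Lemma loop_base i u : (2^-1 <= `|u|)%R -> base ws (loop ws i u).
Proof.
move=> u2; rewrite /loop /bridge /=; case: leP => u2'; last first.
  by apply: ctr_in; case: ifP => _; [exact: bpos_base|exact: bneg_base].
rewrite clamp_le0; last by lra.
case: ifP => _; rewrite ctr_zero; [exact: bpos_base|exact: bpos_star|
  exact: bneg_base|exact: bneg_star].
Qed.

Lemma loop_half i u : `|u|%R = 2^-1%R ->
  loop ws i u = if (0 <= u)%R then bpos ws i else bneg ws i.
Proof.
move=> u2; rewrite /loop /bridge /= u2 subrr lexx clamp_le0; last by lra.
by case: ifP => _; rewrite ctr_zero; [|exact: bpos_star| |exact: bneg_star].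
Qed.

Lemma holonomy_loop i :
  holonomy (fun t : I => loop ws i (1 - 2 * ival t)%R) = h i.
Proof.
pose u (t : I) := (1 - 2 * ival t)%R.
have cu : continuous u by move=> t; rewrite /u; cts.
have cl := @loop_path_continuous i u cu.
pose S (t : I) : H := if (`|u t| <= 2^-1)%R then side i (loop ws i (u t))
  else if (0 <= u t)%R then 1 else h i.
have far t : (2^-1 <= `|u t|)%R -> S t = if (0 <= u t)%R then 1 else h i.
  rewrite /S; case: ifP => // u2 u2'; rewrite loop_half; last by lra.
  by case: ifP => _; rewrite ?side_bpos ?side_bneg.
rewrite (@holonomyE _ S) //.
  rewrite !far /u ?ival0 ?ival1 ?mulr0 ?mulr1 ?subr0 ?ler01 ?normr1 //.
  - by rewrite invg1 mul1g ifF //; lra.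
  - by rewrite ler0_norm; lra.
  - by lra.
move=> t; have ct := cu t.
have cn : continuous_at t (fun t => `|u t|%R) by cts.
have near_star : \forall t' \near t, star ws i (loop ws i (u t)) ->
    crossing (loop ws i (u t)) (loop ws i (u t')) =
    (side i (loop ws i (u t)))^-1 * side i (loop ws i (u t')).
  have [s|ns] := pselect (star ws i (loop ws i (u t))); last first.
    by apply: (@filterE _ (nbhs t)) => t' /ns.
  have : \forall t' \near t, crossing (loop ws i (u t)) (loop ws i (u t')) =
      (side i (loop ws i (u t)))^-1 * side i (loop ws i (u t')).
    exact: (cl t _ (crossing_star s)).
  by apply: filterS.
have near_far : (2^-1 <= `|u t|)%R -> \forall t' \near t,
    crossing (loop ws i (u t)) (loop ws i (u t')) = 1.
  move=> /(loop_base i) /crossing_base[N Nt N1].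
  have Nt0 := nbhs_singleton Nt.
  have : \forall t' \near t, N (loop ws i (u t')) by exact: (cl t _ Nt).
  by apply: filterS => t' Nt'; apply: N1.
have near_sign : (2^-1 <= `|u t|)%R -> \forall t' \near t,
    (0 <= u t')%R = (0 <= u t)%R.
  move=> ut; case: (leP 0%R (u t)) => ut0.
    have : (0 < u t)%R by move: ut; rewrite ger0_norm //; lra.
    by move=> /(near_gt ct); apply: filterS => t' /ltW ->.
  by apply: filterS (near_lt ct ut0) => t'; rewrite ltNge => /negbTE ->.
have [ut|ut] := ltP (`|u t|)%R 2^-1%R.
  apply: filterS2 (near_lt cn ut) near_star => t' ut' ->; last first.
    by apply: loop_star; exact: ltW.
  by rewrite /S (ltW ut) (ltW ut') mulVKg.
have [ut2|ut'] := leP (`|u t|)%R 2^-1%R.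
  have st := @loop_star _ _ _ ws i _ ut2.
  apply: filterS3 near_star (near_far ut) (near_sign ut) => t' + e1 e2.
  rewrite e1 => /(_ st) e3; rewrite mulg1.
  have [ut'|ut'] := leP 2^-1%R (`|u t'|)%R; first by rewrite !far // e2.
  rewrite /S (ltW ut') ut2.
  by apply: (mulgI (side i (loop ws i (u t)))^-1); rewrite -e3 mulVg.
apply: filterS3 (near_gt cn ut') (near_far ut) (near_sign ut) => t' ut2 -> e2.
by rewrite mulg1 !far ?e2 // ltW.
Qed.

(** The way [d] to the base point, the loop through the wall [i], and the way
    back along [d]. *)
Definition lasso (d : I -> X) i (t : I) : X :=
  if (1 - 3 * Num.min (ival t) (1 - ival t) <= 0)%R
  then loop ws i (3 - 6 * ival t)%R
  else d (clamp (3 * Num.min (ival t) (1 - ival t))%R).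

Lemma lasso_continuous d i : continuous d -> d one = b0 ws -> continuous (lasso d i).
Proof.
move=> cd d1 t; apply: paste_at.
- by cts.
- by move=> _; apply: loop_path_continuous => {}t; cts.
- by move=> _; apply: (cts_comp cd); cts.
- move=> t0; rewrite clamp_ge1 ?d1; last by lra.
  apply: loop_high; move: t0.
  case: (leP (ival t) (1 - ival t)) => h1 t0; last by rewrite ler0_norm; lra.
  by rewrite ger0_norm; lra.
Qed.

Lemma lasso_end d i : lasso d i zero = d zero /\ lasso d i one = d zero.
Proof.
rewrite /lasso ival0 ival1 subr0 subrr min_l ?min_r ?ler01 // mulr0 subr0 ler10.
by rewrite clamp_le0.
Qed.

Lemma lasso_mid d i t : (3^-1 <= ival t)%R -> (ival t <= 2 / 3)%R ->
  lasso d i t = loop ws i (3 - 6 * ival t)%R.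
Proof.
by move=> t1 t2; rewrite /lasso ifT //; case: (leP (ival t) (1 - ival t)); lra.
Qed.

Lemma lasso_low d i t : d one = b0 ws -> (ival t <= 3^-1)%R ->
  lasso d i t = d (clamp (3 * ival t)%R).
Proof.
move=> d1 t1; rewrite /lasso min_l; last by lra.
case: leP => // t2; have t3 : (ival t = 3^-1)%R by lra.
rewrite t3 clamp_ge1 ?d1; last by lra.
by apply: loop_high; rewrite ger0_norm; lra.
Qed.

Lemma lasso_hi d i t : d one = b0 ws -> (2 / 3 <= ival t)%R ->
  lasso d i t = d (clamp (3 - 3 * ival t)%R).
Proof.
move=> d1 t1; rewrite /lasso min_r; last by lra.
case: leP => [t2|_]; last by congr (d (clamp _)); lra.
have t3 : (ival t = 2 / 3)%R by lra.
rewrite t3 clamp_ge1 ?d1; last by lra.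
by apply: loop_high; rewrite ler0_norm; lra.
Qed.

Lemma holonomy_lasso d i : continuous d -> d one = b0 ws ->
  holonomy (lasso d i) = holonomy d * h i * (holonomy d)^-1.
Proof.
move=> cd d1; have cl := @lasso_continuous d i cd d1.
have [s ps _] := primitive_interval (path_cocycle cl).
have ca : continuous (fun t : I => clamp (3^-1 * ival t) : I) by move=> t; cts.
have cb : continuous (fun t : I => clamp (3^-1 * ival t + 3^-1) : I) by move=> t; cts.
have cc : continuous (fun t : I => clamp (1 - 3^-1 * ival t) : I) by move=> t; cts.
have cloop : continuous (fun t : I => loop ws i (1 - 2 * ival t)%R).
  by apply: loop_path_continuous => t; cts.
have e1 : (s (clamp (3^-1 * ival zero)))^-1 * s (clamp (3^-1 * ival one)) = holonomy d.
  apply: (holonomy_sub cl cd ps ca) => t.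
  have := ival_ge0 t; have := ival_le1 t => t1 t0.
  have cE : (ival (clamp (3^-1 * ival t)) = 3^-1 * ival t)%R by rewrite clampE; lra.
  rewrite lasso_low // cE; last by lra.
  by rewrite mulrA divff // mul1r clampK.
have e2 : (s (clamp (3^-1 * ival zero + 3^-1)))^-1 * s (clamp (3^-1 * ival one + 3^-1)) = h i.
  rewrite -(@holonomy_loop i); apply: (holonomy_sub cl cloop ps cb) => t.
  have := ival_ge0 t; have := ival_le1 t => t1 t0.
  have cE : (ival (clamp (3^-1 * ival t + 3^-1)) = 3^-1 * ival t + 3^-1)%R.
    by rewrite clampE; lra.
  by rewrite lasso_mid // cE; [congr (loop _ _ _)| |]; lra.
have e3 : (s (clamp (1 - 3^-1 * ival zero)))^-1 * s (clamp (1 - 3^-1 * ival one)) = holonomy d.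
  apply: (holonomy_sub cl cd ps cc) => t.
  have := ival_ge0 t; have := ival_le1 t => t1 t0.
  have cE : (ival (clamp (1 - 3^-1 * ival t)) = 1 - 3^-1 * ival t)%R by rewrite clampE; lra.
  rewrite lasso_hi // cE; last by lra.
  by rewrite -[t in LHS]clampK; congr (d (clamp _)); lra.
rewrite (holonomyE cl ps) -e2 -{1}e1 -e3 !ival0 !ival1 !mulr0 !mulr1 add0r subr0.
rewrite (_ : clamp 0 = zero) // (_ : clamp 1 = one) //.
rewrite (_ : 1 - 3^-1 = 3^-1 + 3^-1)%R; last by lra.
by rewrite !invgM invgK !mulgA !mulgK.
Qed.

End crossing.

(** ** Contraction along the universal cover *)

Definition edge (l : letter n) (r : R) : X :=
  loop ws l.1 (if l.2 then 1 - 2 * r else 2 * r - 1).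

(** The image in the space of the path in the universal cover of the graph from
    the root to the vertex [w]. The first letter of a word is the last edge of
    the path, and the edge of a letter of depth [m] is passed between the times
    [m] and [m + 1]. *)
Fixpoint branch (w : seq (letter n)) (r : R) : X :=
  if w is l :: w' then
    if r - (size w')%:R <= 0 then branch w' r else edge l (r - (size w')%:R)
  else b0 ws.

Lemma edge_end l r : r <= 8^-1 \/ 1 - 8^-1 <= r -> edge l r = b0 ws.
Proof.
move=> hr; apply: loop_high; case: l.2 hr => -[] hr.
- by rewrite ger0_norm; lra.
- by rewrite ler0_norm; lra.
- by rewrite ler0_norm; lra.
- by rewrite ger0_norm; lra.
Qed.

Lemma branch_high w r : (size w)%:R - 8^-1 <= r -> branch w r = b0 ws.
Proof.
case: w => [//|l w] /=; rewrite -natr1 => hr; rewrite ifF; last first.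
  by apply/negbTE; rewrite -ltNge; lra.
by rewrite edge_end //; right; lra.
Qed.

Lemma branch_cons l w r : r <= (size w)%:R + 8^-1 -> branch (l :: w) r = branch w r.
Proof.
move=> hr /=; case: ifP => // /negbT; rewrite -ltNge => h.
by rewrite edge_end ?branch_high //; [lra|left; lra].
Qed.

Lemma branch0 w r : r <= 0 -> branch w r = b0 ws.
Proof.
move=> r0; elim: w => [//|l w IH] /=; rewrite ifT // subr_le0 (le_trans r0) //.
Qed.

Lemma branch_continuous w : continuous (branch w).
Proof.
elim: w => [|l w IH] r; first exact: ctsC.
apply: paste_at.
- by cts.
- by move=> _; exact: IH.
- move=> _; apply: loop_continuous.
  have cu : continuous_at r (fun t => if l.2 then 1 - 2 * (t - (size w)%:R)
      else 2 * (t - (size w)%:R) - 1).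
    by case: l.2; cts.
  by split => // ; cts.
- move=> hr; rewrite -/(branch _ _) edge_end; last by left; lra.
  by rewrite branch_high //; lra.
Qed.

Definition dir i x : letter n := (i, ~~ `[< neg ws i x >]).

(** The point of the universal cover above [crush x] in the sheet [w], given by
    the branch on which it lies and by its distance from the root. In this sheet
    [x] lies on the half of the edge [dir i x] that is adjacent to the vertex
    [w]; either this edge prolongs the branch of [w], or it is its last edge. *)
Definition tip (w : word n) x : seq (letter n) * R :=
  if sel phi x is Some i then
    if ohead (sval w) == Some (opp (dir i x))
    then (sval w, (size (sval w))%:R - phi i x / 2)
    else (dir i x :: sval w, (size (sval w))%:R + phi i x / 2)
  else (sval w, (size (sval w))%:R).

(** The contraction of the tree moves all points towards the root. *)
Definition retract (t : I) w x : X := branch (tip w x).1 ((tip w x).2 * (1 - ival t)).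

Lemma retract_zero w x : retract zero w x = crush ws phi x.
Proof.
rewrite /retract ival0 subr0 mulr1 /tip /crush.
have [[i pi]|p0] := sel_cases phi01 x; last by rewrite selN //= branch_high //; lra.
have /andP[_ p1] := phi01 i x.
rewrite (selP phi_inj pi); case: ifP => hd /=; last first.
  rewrite ifF; last by apply/negbTE; rewrite -ltNge; lra.
  rewrite /edge /dir /wcoord /=; case: asboolP => _ /=; congr (loop _ _ _); lra.
case: w hd => -[|l v] rw //= /eqP[->].
rewrite -natr1 ifF; last by apply/negbTE; rewrite -ltNge; lra.
by rewrite /edge /dir /wcoord /=; case: asboolP => _ /=; congr (loop _ _ _); lra.
Qed.

Lemma retract_one w x : retract one w x = b0 ws.
Proof. by rewrite /retract ival1 subrr mulr0 branch0. Qed.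

Local Notation tr := (@translation n).

Section lift.
Context (Y : topologicalType) (f : Y -> X) (cf : continuous f).
Context (s : Y -> bijection (word n)).
Hypothesis ps : primitive (fun y y' => crossing tr (f y) (f y')) s.

Definition label y : word n := s y (empty_word n).

Lemma label_near y : \forall y' \near y,
  label y' = crossing tr (f y) (f y') (label y).
Proof. by apply: filterS (ps y) => y' e; rewrite /label e bij_mulE. Qed.

Lemma label_near_base y : base ws (f y) -> \forall y' \near y, label y' = label y.
Proof.
move=> /(crossing_base tr)[N Ny N1]; have Ny0 := nbhs_singleton Ny.
have : \forall y' \near y, N (f y') by exact: (@cf y _ Ny).
by apply: filterS2 (label_near y) => y' -> Ny'; rewrite N1.
Qed.

Lemma phi_near i y e : e < phi i (f y) -> \forall y' \near y, e < phi i (f y').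
Proof. by apply: near_gt; apply: (cts_comp (@cphi i)); exact: cf. Qed.

(** Near a vertex of the tree the branch of the tip may vary, but all these
    branches agree up to the depth of the tip, as edges are constant near their
    ends. *)
Lemma tip_zero y : (forall i, phi i (f y) = 0) ->
  continuous_at y (fun y' => (tip (label y') (f y')).2) /\
  \forall y' \near y, forall r, r <= (tip (label y') (f y')).2 ->
    branch (tip (label y') (f y')).1 r = branch (sval (label y)) r.
Proof.
move=> p0.
have lb := label_near_base (phi0_base phi_wall p0).
have small e : 0 < e -> \forall y' \near y, forall i, phi i (f y') < e.
  move=> e0; apply: filter_forall => i.
  by apply: near_lt; [apply: (cts_comp (@cphi i)); exact: cf|rewrite p0].
split.
  rewrite /continuous_at {2}/tip selN //=.
  apply/cvgrPdist_lt => e e0; apply: filterS2 lb (small e e0) => y' -> se.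
  rewrite /tip; case: (sel phi (f y')) => [i|]; last by rewrite /= subrr normr0.
  have /andP[q0 _] := phi01 i (f y'); have q1 := se i.
  case: ifP => _ /=; first by rewrite opprD addNKr opprK ger0_norm; lra.
  by rewrite opprD addNKr normrN ger0_norm; lra.
have e0 : 0 < 4^-1 :> R by lra.
apply: filterS2 lb (small _ e0) => y' -> se r.
rewrite /tip; case: (sel phi (f y')) => [i|//]; have q1 := se i.
case: ifP => _ //= hr; rewrite -[RHS](@branch_cons (dir i (f y'))) //.
by lra.
Qed.

Lemma tip_base i y : 0 < phi i (f y) -> base ws (f y) ->
  continuous_at y (fun y' => (tip (label y') (f y')).2) /\
  \forall y' \near y, (tip (label y') (f y')).1 = (tip (label y) (f y)).1.
Proof.
move=> pi by_.
have lb := label_near_base by_.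
have dn : \forall y' \near y, dir i (f y') = dir i (f y).
  have [hx|/wall_base //|hx] := phi_star pi.
    have : \forall y' \near y, pos ws i (f y').
      by apply: (@cf y); apply: open_nbhs_nbhs; split; first exact: pos_open.
    apply: filterS => y' hy; rewrite /dir !asboolF //; exact: pos_neg.
  have : \forall y' \near y, neg ws i (f y').
    by apply: (@cf y); apply: open_nbhs_nbhs; split; first exact: neg_open.
  by apply: filterS => y' hy; rewrite /dir !asboolT.
have cp : continuous_at y (fun y' => phi i (f y')).
  by apply: (cts_comp (@cphi i)); exact: cf.
have near3 : \forall y' \near y, tip (label y') (f y') =
    if ohead (sval (label y)) == Some (opp (dir i (f y)))
    then (sval (label y), (size (sval (label y)))%:R - phi i (f y') / 2)
    else (dir i (f y) :: sval (label y), (size (sval (label y)))%:R + phi i (f y') / 2).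
  apply: filterS3 lb dn (phi_near pi) => y' -> e /(selP phi_inj).
  by rewrite /tip => ->; rewrite e.
have near0 := nbhs_singleton near3.
split; last by apply: filterS near3 => y' ->; rewrite near0; case: ifP.
apply: (@continuous_at_near _ _ (fun y' =>
  if ohead (sval (label y)) == Some (opp (dir i (f y)))
  then (size (sval (label y)))%:R - phi i (f y') / 2
  else (size (sval (label y)))%:R + phi i (f y') / 2)).
  by apply: filterS near3 => y' ->; case: ifP.
by case: (_ == _); cts.
Qed.

(** When the wall is crossed, the label is multiplied by a generator, so that the
    half edges on the two sides belong to the same edge of the tree. *)
Lemma tip_wall i y : wall ws i (f y) ->
  continuous_at y (fun y' => (tip (label y') (f y')).2) /\
  \forall y' \near y, (tip (label y') (f y')).1 = (tip (label y) (f y)).1.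
Proof.
move=> wy; have p2 : 2^-1 < phi i (f y) by rewrite phi_wall //; lra.
have nneg : ~ neg ws i (f y) by move=> /neg_base; exact: wall_base wy.
set w := label y.
have near1 : \forall y' \near y, label y' =
    if `[< neg ws i (f y') >] then wpush (i, true) w else w.
  apply: filterS2 (label_near y) (phi_near p2) => y' -> py'.
  rewrite (crossing_some tr p2 py') bij_mulE /side (asboolF nneg).
  by rewrite invg1 /=; case: ifP.
have cc : continuous_at y (fun y' => wcoord ws phi i (f y')).
  apply: (@continuous_at_comp _ _ _ f (wcoord ws phi i)); first exact: cf.
  by apply: wcoord_continuous => //; exact: Or32 wy.
have [hw|hw] := eqVneq (ohead (sval w)) (Some (i, false)).
  case wE : (sval w) hw => [//|l v] /= [lE]; rewrite lE in wE.
  have hv : (ohead v == Some (i, true)) = false.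
    have rv : reduced (sval w) := valP w; rewrite wE in rv.
    case: v {wE} rv => [//|l2 v] /= /andP[h _]; apply/negbTE.
    by apply: contra h => /eqP[->].
  have pE : push (i, true) (sval w) = v by rewrite wE /= /opp /= eqxx.
  have near2 : \forall y' \near y, tip (label y') (f y') =
      ((i, false) :: v, (size v)%:R + 2^-1 + wcoord ws phi i (f y') / 2).
    apply: filterS2 near1 (phi_near p2) => y' -> py'.
    have py0 : 0 < phi i (f y') by lra.
    rewrite /tip (selP phi_inj py0) /dir /wcoord; case: asboolP => hn /=.
      rewrite pE hv; congr (_, _); lra.
    rewrite wE /= eqxx -natr1; congr (_, _); lra.
  have near0 := nbhs_singleton near2.
  split; last by apply: filterS near2 => y' ->; rewrite near0.
  apply: (@continuous_at_near _ _ (fun y' => (size v)%:R + 2^-1 + wcoord ws phi i (f y') / 2)).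
    by apply: filterS near2 => y' ->.
  by cts.
have near2 : \forall y' \near y, tip (label y') (f y') =
    ((i, true) :: sval w, (size (sval w))%:R + 2^-1 - wcoord ws phi i (f y') / 2).
  apply: filterS2 near1 (phi_near p2) => y' -> py'.
  have py0 : 0 < phi i (f y') by lra.
  have pw : push (i, true) (sval w) = (i, true) :: sval w.
    case: (sval w) hw => [//|l v] /=; rewrite /opp /= => hw; rewrite ifF //.
    by apply: contra_neqF hw => /eqP ->.
  rewrite /tip (selP phi_inj py0) /dir /wcoord; case: asboolP => hn /=.
    by rewrite pw /= /opp /= eqxx -natr1; congr (_, _); lra.
  rewrite /opp /= (negbTE hw); congr (_, _); lra.
have near0 := nbhs_singleton near2.
split; last by apply: filterS near2 => y' ->; rewrite near0.
apply: (@continuous_at_near _ _ (fun y' => (size (sval w))%:R + 2^-1 - wcoord ws phi i (f y') / 2)).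
  by apply: filterS near2 => y' ->.
by cts.
Qed.

Lemma tip_near y : exists w,
  continuous_at y (fun y' => (tip (label y') (f y')).2) /\
  \forall y' \near y, forall r, r <= (tip (label y') (f y')).2 ->
    branch (tip (label y') (f y')).1 r = branch w r.
Proof.
have [[i pi]|p0] := sel_cases phi01 (f y); last first.
  by exists (sval (label y)); exact: tip_zero.
exists (tip (label y) (f y)).1.
have : continuous_at y (fun y' => (tip (label y') (f y')).2) /\
  \forall y' \near y, (tip (label y') (f y')).1 = (tip (label y) (f y)).1.
  have [by_|[j wj]] := wall_cover ws (f y); first exact: tip_base pi by_.
  exact: tip_wall wj.
by move=> [c1 c2]; split => //; apply: filterS c2 => y' ->.
Qed.

Lemma tip_ge0 w x : 0 <= (tip w x).2.
Proof.
rewrite /tip; case: (sel phi x) => [i|] /=; last exact: ler0n.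
have /andP[q0 q1] := phi01 i x.
case: ifP => hd /=; last by rewrite addr_ge0 ?divr_ge0.
case: (sval w) hd => [//|l v] _ /=; rewrite -natr1.
by have := ler0n R (size v); lra.
Qed.

Lemma retract_continuous : continuous (fun p : I * Y => retract p.1 (label p.2) (f p.2)).
Proof.
move=> [t y]; have [w [cd near1]] := tip_near y.
apply: (@continuous_at_near _ _ (fun p : I * Y =>
  branch w ((tip (label p.2) (f p.2)).2 * (1 - ival p.1)))).
  apply: filterS (near_snd (p := (t, y)) near1) => p hp; rewrite /retract hp //.
  have := ival_ge0 p.1; have := ival_le1 p.1; have := tip_ge0 (label p.2) (f p.2).
  by move=> *; rewrite ler_piMr //; lra.
apply: (cts_comp (@branch_continuous w)).
have cd2 : continuous_at (t, y) (fun p : I * Y => (tip (label p.2) (f p.2)).2).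
  by apply: (@continuous_at_comp _ _ _ snd (fun y => (tip (label y) (f y)).2)); [cts|exact: cd].
by cts.
Qed.

(** A labelling of the points of [Y] by sheets is a lift of [crush \o f] to the
    universal cover, which is retracted to the root of the tree. The tracks of
    this contraction only depend on [f y] and on the label of [y]. *)
Lemma crush_contract : exists K : I * Y -> X, [/\ continuous K,
  forall y, K (zero, y) = f y, forall y, K (one, y) = b0 ws &
  forall t y y', f y = f y' -> label y = label y' -> K (t, y) = K (t, y')].
Proof.
have [h [ch h0 h1 _]] := crush_homotopic cphi phi01 phi_wall phi_star phi_inj.
exists (fun p => if 2 * ival p.1 - 1 <= 0 then h (clamp (2 * ival p.1), f p.2)
  else retract (clamp (2 * ival p.1 - 1)) (label p.2) (f p.2)); split.
- move=> p; apply: paste_at.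
  + by cts.
  + move=> _; apply: (cts_comp ch); cts.
    by apply: (cts_comp cf); cts.
  + move=> _; apply: (@continuous_at_comp _ _ _
      (fun p : I * Y => (clamp (2 * ival p.1 - 1), p.2))
      (fun q : I * Y => retract q.1 (label q.2) (f q.2))); first by cts.
    exact: retract_continuous.
  + move=> hp; rewrite clamp_ge1; last by lra.
    by rewrite clamp_le0 ?retract_zero ?h1 //; lra.
- by move=> y /=; rewrite ival0 mulr0 sub0r lerN10 clamp_le0 ?h0.
- move=> y /=; rewrite ival1 mulr1 ifF; last by apply/negbTE; rewrite -ltNge; lra.
  by rewrite clamp_ge1 ?retract_one //; lra.
- by move=> t y y' -> ->.
Qed.

End lift.

Section consequences.

(** If the holonomy is trivial, then both ends of the loop have the same label, so
    that the contraction moves them along the same path. *)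
Lemma holonomy_translation_inj x (c : {path I from x to x in X}) :
  holonomy tr c = 1%g -> homotopic_rel R [set zero; one] c (cst x).
Proof.
have cc : continuous c by exact: cts_fun.
have [s ps _] := primitive_interval (path_cocycle tr cc).
rewrite (holonomyE cc ps) => s01.
have s0E1 : s zero = s one by rewrite -[RHS](mulVKg (s zero)) s01 mulg1.
have [K [cK K0 K1 KE]] := crush_contract cc ps.
have hends t : K (t, one) = K (t, zero).
  by apply: KE; rewrite ?path_zero ?path_one // /label s0E1.
apply: (@null_homotopic_loop R X c x K (fun t => K (t, zero))) => //.
- by move=> t; apply: (cts_comp cK); cts.
- by rewrite K0 path_zero.
- by move=> y; rewrite !K1.
Qed.

Lemma cube_contraction k : exists c : I * 'rV[I]_k -> 'rV[I]_k,
  [/\ continuous c, forall v, c (zero, v) = \row_i zero & forall v, c (one, v) = v].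
Proof.
exists (fun p : I * 'rV[I]_k => \row_i clamp (ival p.1 * ival (p.2 ord0 i))); split.
- move=> p; apply: continuous_at_row => i.
  rewrite (_ : (fun s => _) =
    (fun s : I * 'rV[I]_k => clamp (ival s.1 * ival (s.2 ord0 i)))); first by cts.
  by apply/funext => s; rewrite mxE.
- by move=> v; apply/rowP => i; rewrite !mxE ival0 mul0r clamp_le0.
- by move=> v; apply/rowP => i; rewrite !mxE ival1 mul1r clampK.
Qed.

(** The boundary of a cube of dimension at least two is connected: two segments
    lead from any of its points to a vertex. *)
Lemma cube_boundary_constant k (T : Type) (s : 'rV[I]_k -> T) : (2 <= k)%N ->
  (forall v, cube_boundary v -> \forall w \near v, cube_boundary w -> s w = s v) ->
  forall v, cube_boundary v -> s v = s (\row_i zero).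
Proof.
move=> k2 sloc.
pose scale (i : 'I_k) (b : bool) (v : 'rV[I]_k) (t : I) : 'rV[I]_k :=
  \row_j if (j == i) == b then v ord0 j else clamp ((1 - ival t) * ival (v ord0 j)).
have cscale i b v : continuous (scale i b v).
  move=> t; apply: continuous_at_row => j.
  rewrite (_ : (fun s => _) = (fun t : I =>
    if (j == i) == b then v ord0 j else clamp ((1 - ival t) * ival (v ord0 j)))).
    by case: (_ == b); cts.
  by apply/funext => u; rewrite mxE.
have slide i b v : (forall t, cube_boundary (scale i b v t)) ->
    s (scale i b v zero) = s (scale i b v one).
  move=> bd; apply: (@interval_locally_constant R T (fun t => s (scale i b v t))) => t.
  have : \forall t' \near t, cube_boundary (scale i b v t') ->
      s (scale i b v t') = s (scale i b v t).
    exact: (@cscale i b v t _ (sloc _ (bd t))).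
  by apply: filterS => t'; apply.
have scale0 i b v : scale i b v zero = v.
  by apply/rowP => j; rewrite mxE ival0 subr0 mul1r clampK; case: ifP.
move=> v [i vi].
have [j ji] : exists j : 'I_k, j != i.
  pose j0 : 'I_k := Ordinal (ltnW k2); pose j1 : 'I_k := Ordinal k2.
  have [e|] := eqVneq j0 i; last by exists j0.
  by exists j1; rewrite -e.
rewrite -{1}(scale0 i true v) slide; last by move=> t; exists i; rewrite mxE eqxx.
set w := scale i true v one.
have wj : w ord0 j = zero.
  by rewrite mxE (negbTE ji) ival1 subrr mul0r clamp_le0.
rewrite -{1}(scale0 i false w) slide; last first.
  move=> t; exists j; left; rewrite mxE (negbTE ji) eqxx; exact: wj.
congr s; apply/rowP => l; rewrite !mxE ival1 subrr !mul0r.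
case: (eqVneq l i) => li /=; first by rewrite clamp_le0.
by rewrite clamp_le0.
Qed.

(** A primitive exists since the cube is contractible, and it is constant on the
    boundary of the cube, which [f] maps to a point; hence the contraction moves
    the boundary along a single path. *)
Theorem wall_system_aspherical k x (f : 'rV[I]_k -> X) : (2 <= k)%N ->
  continuous f -> (forall v, cube_boundary v -> f v = x) ->
  homotopic_rel R (@cube_boundary R k) f (cst x).
Proof.
move=> k2 cf fx.
have [c [cc c0 c1]] := cube_contraction k.
have [s ps] := contractible_primitive cc c0 c1
  (cocycle_pullback (crossing_cocycle tr) cf).
have bd0 : cube_boundary (\row_i zero : 'rV[I]_k).
  by exists (Ordinal (ltnW k2)); rewrite mxE; left.
have sb v : cube_boundary v -> s v = s (\row_i zero).
  apply: cube_boundary_constant => // {}v bv; apply: filterS (ps v) => w -> bw.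
  by rewrite !fx // (cocycle_diag (crossing_cocycle tr)) mulg1.
have [K [cK K0 K1 KE]] := crush_contract cf ps.
apply: (@null_homotopic_cube R X k f x K (fun t => K (t, \row_i zero))) => //.
- by move=> t; apply: (cts_comp cK); cts.
- by rewrite K0 fx.
- by move=> y; rewrite !K1.
- by move=> t a ba; apply: KE; rewrite ?fx // /label sb.
Qed.

(** ** The fundamental group *)

Section fundamental_group_free.
Context (x : X) (d : I -> X).
Hypotheses (cd : continuous d) (d0 : d zero = x) (d1 : d one = b0 ws).

Lemma lasso_zero i : lasso d i zero = x.
Proof. by rewrite (lasso_end d i).1. Qed.

Lemma lasso_one i : lasso d i one = x.
Proof. by rewrite (lasso_end d i).2. Qed.

Definition lasso_path i : {path I from x to x in X} :=
  mk_path (@lasso_continuous d i cd d1) (lasso_zero i) (lasso_one i).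

Definition lasso_class i : fundamental_group R x := loop_class (lasso_path i).

Section hom.
Context (H : groupType) (h : 'I_n -> H).
Local Open Scope group_scope.

Lemma pi1_holonomy_lasso i :
  pi1_holonomy h (lasso_class i) = holonomy h d * h i * (holonomy h d)^-1.
Proof. by rewrite pi1_holonomyE (holonomy_lasso _ _ cd d1). Qed.

Definition free_map (a : fundamental_group R x) : H :=
  (holonomy h d)^-1 * pi1_holonomy h a * holonomy h d.

Lemma free_mapM : {morph free_map : a b / a * b >-> a * b}.
Proof.
move=> a b; rewrite /free_map pi1_holonomyM.
by move: (pi1_holonomy h a) (holonomy h d) => u v; rewrite !mulgA mulgK.
Qed.

HB.instance Definition _ := isMultiplicative.Build _ _ free_map free_mapM.

Lemma free_map_lasso i : free_map (lasso_class i) = h i.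
Proof. rewrite /free_map pi1_holonomy_lasso.
by move: (holonomy h d) => u; rewrite !mulgA mulVg mul1g mulgVK. Qed.

Lemma free_map_generated a : generated h (free_map a).
Proof.
have gd : generated h (holonomy h d) by exact: holonomy_generated.
apply: generated_mul => //; apply: generated_mul; first exact: generated_inv.
by apply: holonomy_generated; exact: cts_fun.
Qed.

End hom.

(** The holonomy of [a] is a product of holonomies of lassos, and by injectivity
    of the holonomy [a] is the same product of lassos. *)
Lemma lasso_class_generates a : generated lasso_class a.
Proof.
have : generated (fun i => free_map tr (lasso_class i)) (free_map tr a).
  rewrite (_ : (fun i => _) = tr); first exact: free_map_generated.
  by apply/funext => i; rewrite free_map_lasso.
move=> /(generated_image (f := free_map tr))[g gg fg].
suff -> : a = g by [].
have : free_map tr (a * g^-1)%g = 1%g.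
  by rewrite gmulfM multiplicativeV fg mulgV.
rewrite /free_map => e.
have {}e : pi1_holonomy tr (a * g^-1)%g = 1%g.
  apply: (mulgI (holonomy tr d)^-1%g); apply: (mulIg (holonomy tr d)).
  by rewrite e mulg1 mulVg.
have {}e : (a * g^-1 = 1)%g.
  rewrite -[LHS]reprK; apply/eqP/loop_classP.
  exact: holonomy_translation_inj.
by apply: (mulIg g^-1%g); rewrite e mulgV.
Qed.

Lemma lasso_class_free : free_basis lasso_class.
Proof.
move=> H h; exists (free_map h); first exact: free_map_lasso.
move=> f' f'E a; apply: (generated_eq (e := lasso_class)).
  by move=> i; rewrite f'E [RHS]free_map_lasso.
exact: lasso_class_generates.
Qed.

End fundamental_group_free.
End consequences.
End wall_cocycle.

(** * Consequences for spaces with a wall system *)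

Section wall_system_results.
Context (R : realType) (X : topologicalType) (n : nat) (ws : wall_system R X n).
Local Notation I := (unit_interval R).

Lemma path_to_base x : exists d : I -> X, [/\ continuous d, d zero = x & d one = b0 ws].
Proof.
have cat (f g : I -> X) : continuous f -> continuous g -> f one = g zero ->
    exists e : I -> X, [/\ continuous e, e zero = f zero & e one = g one].
  move=> cf cg fg.
  exists (fun t => if 2 * ival t - 1 <= 0 then f (clamp (2 * ival t))
                   else g (clamp (2 * ival t - 1))); split.
  - move=> t; apply: paste_at; first by cts.
    + by move=> _; apply: (cts_comp cf); cts.
    + by move=> _; apply: (cts_comp cg); cts.
    + by move=> t0; rewrite clamp_ge1 ?clamp_le0 //; lra.
  - by rewrite ival0 mulr0 sub0r lerN10 clamp_le0.
  - rewrite ival1 mulr1 ifF; last by apply/negbTE; rewrite -ltNge; lra.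
    by rewrite clamp_ge1 //; lra.
have [bx|[i wx]] := wall_cover ws x.
  exists (fun t => ctr_base ws (t, x)); split.
  - exact: ctr_track.
  - by rewrite ctr_zero.
  - by rewrite ctr_one.
have sx : star ws i x by exact: Or32.
have cl : continuous (fun t : I => loop ws i (ival t)).
  move=> t; apply: (@loop_continuous _ _ _ _ _ (fun t : I => ival t)).
  by split => [|_]; [by cts|exact: (@ival_continuous R t)].
have [|||e [ce e0 e1]] := cat (fun t => ctr_star ws i (t, x)) (fun t => loop ws i (ival t)).
- exact: ctr_track.
- exact: cl.
- by rewrite ctr_one // ival0 loop_low // normr0.
exists e; split => //; first by rewrite e0 ctr_zero.
by rewrite e1 ival1 loop_high // normr1; lra.
Qed.

Lemma wall_system_path_connected : path_connected R X.
Proof.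
split; first exact: (squash (b0 ws)).
move=> x y; have [f [cf f0 f1]] := path_to_base x; have [g [cg g0 g1]] := path_to_base y.
pose e (t : I) := if 2 * ival t - 1 <= 0 then f (clamp (2 * ival t))
                  else g (clamp (2 - 2 * ival t)).
have ce : continuous e.
  move=> t; apply: paste_at; first by cts.
  - by move=> _; apply: (cts_comp cf); cts.
  - by move=> _; apply: (cts_comp cg); cts.
  - by move=> t0; rewrite !clamp_ge1 ?f1 ?g1 //; lra.
have e0 : e zero = x by rewrite /e ival0 mulr0 sub0r lerN10 clamp_le0.
have e1 : e one = y.
  rewrite /e ival1 mulr1 ifF; last by apply/negbTE; rewrite -ltNge; lra.
  by rewrite clamp_le0 ?subrr.
apply: squash; exact: mk_path ce e0 e1.
Qed.

Hypothesis normalX : normal_space X.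

Theorem wall_system_pi1 (x : X) : free_group_on n (fundamental_group R x).
Proof.
have [phi [cphi phi01 pw ps pi]] := wall_bumps normalX (ws := ws) (K := fun=> set0)
  (fun=> @topology_structure.closed0 _) (fun _ _ _ => id).
have [d [cd d0 d1]] := path_to_base x.
exists (lasso_class cd d0 d1); apply: (lasso_class_free (phi := phi)) => //.
by move=> i y /ps[].
Qed.

Lemma free_group_unique (G G' : groupType) :
  free_group_on n G -> free_group_on n G' -> group_isomorphic G G'.
Proof.
move=> [e fe] [e' fe'].
have [f fE _] := fe _ e'; have [g gE _] := fe' _ e.
exists f; exists g => a.
  have [k _ kU] := fe _ e.
  have id_k := kU (idfun : {multiplicative G -> G}) (fun=> erefl).
  have gf_k := kU (g \o f : {multiplicative G -> G}).
  by rewrite [RHS]id_k -gf_k // => i /=; rewrite fE gE.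
have [k _ kU] := fe' _ e'.
have id_k := kU (idfun : {multiplicative G' -> G'}) (fun=> erefl).
have gf_k := kU (f \o g : {multiplicative G' -> G'}).
by rewrite [RHS]id_k -gf_k // => i /=; rewrite gE fE.
Qed.

Theorem wall_system_eilenberg_maclane (G : groupType) :
  free_group_on n G -> eilenberg_maclane1 R G X.
Proof.
move=> fG; split; first exact: wall_system_path_connected.
  by move=> x; apply: free_group_unique => //; exact: wall_system_pi1.
have [phi [cphi phi01 pw ps pi]] := wall_bumps normalX (ws := ws) (K := fun=> set0)
  (fun=> @topology_structure.closed0 _) (fun _ _ _ => id).
move=> k x k2 a b; rewrite -[a]reprK -[b]reprK; apply/eqmodP/asboolP.
have null (f : cube_map R k x) : homotopic_rel R (@cube_boundary R k) (sval f) (cst x).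
  case: f => f [cf fx]; apply: (wall_system_aspherical (phi := phi) (ws := ws)) => //.
  by move=> i y /ps[].
exact: (homotopic_rel_trans (null _) (homotopic_rel_sym (null _))).
Qed.

End wall_system_results.

(** * The list of real roots of a monic polynomial *)

Section root_list.
Context (R : rcfType).
Implicit Types (p q : {poly R}) (xs : seq R).

Definition positive_poly q := forall u, 0 < q.[u].

Definition linear_factors xs : {poly R} := \prod_(x <- xs) ('X - x%:P).

(** The real roots in increasing order, repeated according to multiplicity. *)
Definition rootlist p : seq R :=
  sort <=%R (flatten [seq nseq (\mu_r p) r | r <- rootsR p]).

Lemma linear_factors_monic xs : linear_factors xs \is monic.
Proof. exact: monic_prod_XsubC. Qed.

Lemma mem_rootsR p r : p != 0 -> (r \in rootsR p) = root p r.
Proof. by move=> p0; rewrite -(roots_on_rootsR p0 r) in_itv. Qed.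

Lemma count_rootlist p r : p != 0 -> count_mem r (rootlist p) = \mu_r p.
Proof.
move=> p0; rewrite count_sort count_flatten -map_comp.
have us : uniq (rootsR p) by exact: (sorted_uniq lt_trans ltxx (sorted_roots _ _ _)).
rewrite sumnE big_map (eq_bigr (fun s => if s == r then \mu_r p else 0%N)); last first.
  by move=> s _ /=; rewrite count_nseq /=; case: eqVneq => [->|_]; rewrite ?mul1n.
rewrite -big_mkcond /= big_const_seq (count_uniq_mem _ us) mem_rootsR //.
by have [rp|/muNroot->] := boolP (root p r); rewrite /= ?addn0.
Qed.

Lemma rootlist_sorted p : sorted <=%R (rootlist p).
Proof. exact: sort_le_sorted. Qed.

Lemma mem_rootlist p r : p != 0 -> (r \in rootlist p) = root p r.
Proof. by move=> p0; rewrite -has_pred1 has_count count_rootlist // mu_gt0. Qed.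

Lemma mu_linear_factors xs r : \mu_r (linear_factors xs) = count_mem r xs.
Proof.
elim: xs => [|x xs IH]; first by rewrite /linear_factors big_nil mu_polyC.
rewrite /linear_factors big_cons mu_mul; last first.
  by rewrite mulf_neq0 ?polyXsubC_eq0 // monic_neq0 // linear_factors_monic.
rewrite -/(linear_factors xs) IH /=; congr (_ + _)%N; case: eqVneq => [->|xr].
  by rewrite mu_XsubC.
by rewrite muNroot // root_XsubC eq_sym.
Qed.

Lemma positive_poly_neq0 q : positive_poly q -> q != 0.
Proof. by move=> /(_ 0); apply: contraTneq => ->; rewrite horner0 ltxx. Qed.

Lemma perm_rootlist p xs q : positive_poly q -> p = linear_factors xs * q ->
  perm_eq (rootlist p) xs.
Proof.
move=> q0 ->; apply/allP => r _; apply/eqP => /=.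
have lq0 : linear_factors xs * q != 0.
  rewrite mulf_neq0 ?(positive_poly_neq0 q0) //.
  by rewrite monic_neq0 // linear_factors_monic.
rewrite count_rootlist // mu_mul // mu_linear_factors [X in (_ + X)%N]muNroot ?addn0 //.
by rewrite /root gt_eqF.
Qed.

Lemma rootlist_factors xs q : sorted <=%R xs -> positive_poly q ->
  rootlist (linear_factors xs * q) = xs.
Proof.
move=> sxs q0; apply: (sorted_eq le_trans le_anti) => //; first exact: rootlist_sorted.
exact: (perm_rootlist q0).
Qed.

Lemma monic_rootless_positive p : p \is monic -> (forall u, ~~ root p u) ->
  positive_poly p.
Proof.
move=> pm nr u; have := @sgp_pinftyP R u p; rewrite /sgp_pinfty (monicP pm) sgr1.
by move=> /(_ (fun v _ => nr v) u); rewrite in_itv /= lexx => /(_ isT) /eqP; rewrite sgr_cp0.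
Qed.

Lemma positive_odd_size q : positive_poly q -> odd (size q).
Proof.
move=> q0; apply/negPn/negP => ev.
by have [u] := odd_poly_root ev; rewrite /root gt_eqF.
Qed.

Lemma rootlist_exists p : p \is monic -> exists xs q,
  [/\ q \is monic, positive_poly q & p = linear_factors xs * q].
Proof.
have [n] := ubnP (size p); elim: n p => // n IH p sp pm.
have [[u ru]|nr] := pselect (exists u, root p u); last first.
  exists [::], p; split => //; last by rewrite /linear_factors big_nil mul1r.
  by apply: monic_rootless_positive => // u; apply/negP => ru; apply: nr; exists u.
have /factor_theorem[p' pE] := ru.
have p'm : p' \is monic by rewrite -(monicMr _ (monicXsubC u)) -pE.
have sp' : (size p' < n)%N.
  by move: sp; rewrite pE size_Mmonic ?monicXsubC ?monic_neq0 // size_XsubC addn2.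
have [xs [q [qm q0 p'E]]] := IH _ sp' p'm.
exists (u :: xs), q; split => //.
by rewrite pE p'E /linear_factors big_cons mulrC mulrA.
Qed.

Lemma rootlistP p : p \is monic -> exists q,
  [/\ q \is monic, positive_poly q & p = linear_factors (rootlist p) * q].
Proof.
move=> /rootlist_exists[xs [q [qm q0 pE]]]; exists q; split => //.
by rewrite {1}pE /linear_factors (perm_big _ (perm_rootlist q0 pE)).
Qed.

Lemma size_linear_factors xs : size (linear_factors xs) = (size xs).+1.
Proof. exact: size_prod_XsubC. Qed.

Lemma perm_rootlist_cons p x : p \is monic ->
  perm_eq (rootlist (('X - x%:P) * p)) (x :: rootlist p).
Proof.
move=> /rootlistP[q [qm q0 pE]]; apply: (perm_rootlist q0).
by rewrite {1}pE /linear_factors big_cons mulrA.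
Qed.

Lemma size_rootlist_le p : p \is monic -> (size (rootlist p) < size p)%N.
Proof.
move=> /rootlistP[q [qm q0 {2}->]].
rewrite size_Mmonic ?linear_factors_monic ?monic_neq0 ?linear_factors_monic //.
by rewrite size_linear_factors addSn /= -addn1 leq_add2l lt0n size_poly_eq0 monic_neq0.
Qed.

Lemma size_rootlist_parity p : p \is monic -> odd (size (rootlist p)) = ~~ odd (size p).
Proof.
move=> /rootlistP[q [qm q0 {2}->]].
rewrite size_Mmonic ?linear_factors_monic ?monic_neq0 ?linear_factors_monic //.
by rewrite size_linear_factors addSn /= oddD positive_odd_size // addbT negbK.
Qed.

End root_list.

(** ** The pattern read off from the list of roots *)

Section double_roots.
Context (R : rcfType).
Implicit Types (p q : {poly R}) (xs : seq R).

Definition double xs i := (i.+1 < size xs)%N && (xs`_i == xs`_i.+1).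

(** For the sorted list of the roots of a polynomial this means that all the
    roots are simple, except for at most one double root. *)
Definition admissible xs := forall i j, double xs i -> double xs j -> i = j.

Lemma double_lt xs i : double xs i -> (i < size xs)%N.
Proof. by move=> /andP[/ltnW]. Qed.

(** Equal entries of a sorted list are neighbours. *)
Lemma size_undup_double xs : sorted <=%R xs ->
  (size (undup xs) + count (double xs) (iota 0 (size xs)) = size xs)%N.
Proof.
elim: xs => //= x xs IH xxs.
have {}IH := IH (path_sorted xxs).
rewrite -add1n iotaDl count_map (eq_count (a2 := double xs)); last by [].
have -> : x \in xs = double (x :: xs) 0.
  case: xs xxs {IH} => [|y s] //= /andP[xy ys].
  rewrite /double /= in_cons; case: eqVneq => //= xney.
  apply/negbTE/negP => xs; move: xney.
  have : all (<=%R y) s by apply: order_path_min => //; exact: le_trans.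
  by move=> /allP /(_ _ xs) yx; rewrite eq_le xy yx.
by case: ifP => _ /=; lia.
Qed.

Lemma admissible_count xs :
  admissible xs <-> (count (double xs) (iota 0 (size xs)) <= 1)%N.
Proof.
rewrite -size_filter; set s := (X in size X).
have us : uniq s by rewrite filter_uniq ?iota_uniq.
have ms i : (i \in s) = double xs i.
  rewrite mem_filter mem_iota /= add0n; case: (boolP (double xs i)) => //= di.
  exact: double_lt.
split=> [ad|s1 i j di dj].
  case: s us ms => [|i [|j s]] //= /andP[ij _] ms.
  suff e : i = j by move: ij; rewrite e mem_head.
  by apply: ad; rewrite -ms !in_cons eqxx ?orbT.
apply/eqP/negPn/negP => ij; move: s1; rewrite leqNgt => /negP; apply.
apply: (@uniq_leq_size _ [:: i; j]); first by rewrite /= inE ij.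
by move=> l; rewrite !inE => /orP[] /eqP ->; rewrite ms.
Qed.

End double_roots.

Section pattern.
Context (R : realType).
Implicit Types p : {poly R}.

Lemma size_rootlist p : p != 0 ->
  comp_size (root_pattern p) = size (rootlist p).
Proof.
move=> p0; rewrite /comp_size /root_pattern /rootlist size_sort size_flatten.
rewrite /shape -map_comp; congr sumn; apply: eq_map => r /=.
by rewrite size_nseq.
Qed.

Lemma pattern_composition p : p != 0 -> is_composition (root_pattern p).
Proof.
by move=> p0; apply/allP => _ /mapP[r rr ->]; rewrite mu_gt0 // -mem_rootsR.
Qed.

Lemma reduced_size_rootlist p : p != 0 ->
  (comp_reduced_size (root_pattern p) <= 1)%N <-> admissible (rootlist p).
Proof.
move=> p0; rewrite admissible_count.
suff -> : comp_reduced_size (root_pattern p) =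
  count (double (rootlist p)) (iota 0 (size (rootlist p))) by [].
apply/eqP; rewrite -(eqn_add2l (size (undup (rootlist p)))).
rewrite size_undup_double ?rootlist_sorted // -size_rootlist //.
have -> : size (undup (rootlist p)) = size (root_pattern p).
  rewrite size_map; apply: perm_size; apply: uniq_perm; rewrite ?undup_uniq //.
    exact: (sorted_uniq lt_trans ltxx (sorted_roots _ _ _)).
  by move=> r; rewrite mem_undup mem_rootlist // mem_rootsR.
rewrite /comp_reduced_size /comp_size.
have := pattern_composition p0; elim: (root_pattern p) => //= m w IH /andP[m0 cw].
by move: (IH cw); lia.
Qed.

End pattern.

Section double_value.
Context (R : rcfType).
Implicit Types xs ys : seq R.

Definition drop_pair i xs : seq R := take i xs ++ drop i.+2 xs.

Lemma size_drop_pair i xs : double xs i -> size (drop_pair i xs) = (size xs - 2)%N.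
Proof.
by move=> /andP[si _]; rewrite size_cat size_drop size_takel; lia.
Qed.

Lemma perm_drop_pair i xs : double xs i ->
  perm_eq xs (xs`_i :: xs`_i :: drop_pair i xs).
Proof.
move=> /andP[si /eqP e]; rewrite -{1}(cat_take_drop i xs).
rewrite (drop_nth 0) ?(ltnW si) // (drop_nth 0 si) -e.
by rewrite perm_catC /= !perm_cons perm_catC.
Qed.

Lemma subseq_drop_pair i xs : subseq (drop_pair i xs) xs.
Proof.
rewrite -{2}(cat_take_drop i xs) cat_subseq // -(drop_drop _ 2 i).
exact: drop_subseq.
Qed.

Lemma sorted_uniqN xs : sorted <=%R xs -> (forall i, ~~ double xs i) <-> uniq xs.
Proof.
move=> sxs; rewrite -[uniq xs]negbK -ltn_size_undup -leqNgt.
rewrite -{1}(size_undup_double sxs); split=> [nd|].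
  by rewrite (eq_count (a2 := pred0)) ?count_pred0 ?addn0 // => i; rewrite (negbTE (nd i)).
move=> le i; apply/negP => di.
have : has (double xs) (iota 0 (size xs)).
  by apply/hasP; exists i => //; rewrite mem_iota /= add0n double_lt.
by rewrite has_count; lia.
Qed.

(** Removing one copy of a repeated entry of an admissible list leaves a list
    without repetitions. *)
Lemma admissible_double_value xs z : sorted <=%R xs -> admissible xs ->
  (1 < count_mem z xs)%N -> exists i, [/\ double xs i,
    perm_eq xs (z :: z :: drop_pair i xs),
    forall w, (1 < count_mem w xs)%N -> w = z & (count_mem z xs <= 2)%N].
Proof.
move=> sxs adm z2; have zxs : z \in xs by rewrite -has_pred1 has_count; lia.
have urem : uniq (rem z xs).
  rewrite -[uniq _]negbK -ltn_size_undup -leqNgt size_rem //.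
  suff -> : size (undup (rem z xs)) = size (undup xs).
    have /admissible_count := adm; rewrite -{2}(size_undup_double sxs).
    by move=> c1; rewrite -subn1 leq_subLR addnC leq_add2r.
  apply: perm_size; apply: uniq_perm; rewrite ?undup_uniq // => w.
  rewrite !mem_undup -!has_pred1 !has_count count_rem zxs /=.
  by case: eqVneq => [<-|_]; rewrite ?subn0 // subn_gt0 z2 ltnW.
have pz := perm_to_rem zxs.
have cz w : count_mem w xs = ((z == w) + (w \in rem z xs))%N.
  by rewrite (permP pz) /= count_uniq_mem.
have u w : (1 < count_mem w xs)%N -> w = z.
  by rewrite cz; case: eqVneq => // _; case: (_ \in _).
have [i di] : exists i, double xs i.
  apply: contrapT => nd; have : uniq xs.
    by apply/(sorted_uniqN sxs) => i; apply/negP => di; apply: nd; exists i.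
  by move=> /count_uniq_mem e; move: z2; rewrite e; case: (_ \in _).
exists i; have pi := perm_drop_pair di.
have iz : xs`_i = z by apply: u; rewrite (permP pi) /= eqxx.
split => //; first by rewrite -iz.
by rewrite cz; case: (_ == _); case: (_ \in _).
Qed.

(** Otherwise the [j + 1] smallest entries of [ys] would be paired with entries
    of [xs] that are smaller than the entry number [j] of [xs], while there are
    at most [j] such entries. *)
Lemma sorted_close_le (e : R) (ps : seq (R * R)) xs ys :
  sorted <=%R xs -> sorted <=%R ys ->
  perm_eq (unzip1 ps) xs -> perm_eq (unzip2 ps) ys ->
  all (fun p => p.1 - p.2 < e) ps ->
  forall j, (j < size xs)%N -> xs`_j - ys`_j < e.
Proof.
move=> sx sy px py ce j jx.
have sz : size ys = size xs by rewrite -(perm_size px) -(perm_size py) !size_map.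
rewrite ltNge; apply/negP => h.
have cx : (count (fun x => (x < xs`_j)%R) xs <= j)%N.
  rewrite -{2}(cat_take_drop j xs) count_cat.
  rewrite (_ : count _ (drop j xs) = 0%N) ?addn0.
    by rewrite (leq_trans (count_size _ _)) // size_take_min geq_minl.
  apply/eqP; rewrite -leqn0 leqNgt -has_count; apply/hasPn => x /(nthP 0)[l].
  rewrite size_drop => ls <-; rewrite nth_drop -leNgt.
  by apply: (sorted_leq_nth le_trans le_refl 0 sx);
    rewrite ?inE ?leq_addr // -ltn_subRL.
have cy : (j < count (fun y => (y <= ys`_j)%R) ys)%N.
  rewrite -{2}(cat_take_drop j.+1 ys) count_cat.
  rewrite (_ : count _ (take j.+1 ys) = j.+1) ?leq_addr //.
  rewrite -[RHS](@size_takel _ _ ys) ?sz //; apply/eqP; rewrite -all_count.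
  apply/allP => y /(nthP 0)[l]; rewrite size_takel ?sz // ltnS => lj <-.
  rewrite nth_take //.
  by apply: (sorted_leq_nth le_trans le_refl 0 sy); rewrite ?inE ?sz //; lia.
suff : (count (fun y => (y <= ys`_j)%R) ys <= count (fun x => (x < xs`_j)%R) xs)%N by lia.
rewrite -(permP px) -(permP py) !count_map; elim: (ps) ce => //= p s IH /andP[cp cs].
apply: leq_add; last exact: IH.
have [py'|//] := lerP p.2 ys`_j.
by have -> : p.1 < xs`_j by move: h cp py'; clear; lra.
Qed.

Definition seq_close (e : R) xs ys :=
  size xs = size ys /\ forall j, `|xs`_j - ys`_j| < e.

(** Sorting two lists does not increase the distance between them. *)
Lemma sorted_close (e : R) (ps : seq (R * R)) xs ys : 0 < e ->
  sorted <=%R xs -> sorted <=%R ys ->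
  perm_eq (unzip1 ps) xs -> perm_eq (unzip2 ps) ys ->
  all (fun p => `|p.1 - p.2| < e) ps -> seq_close e xs ys.
Proof.
move=> e0 sx sy px py ce.
have sz : size xs = size ys by rewrite -(perm_size px) -(perm_size py) !size_map.
split => // j; have [jx|jx] := ltnP j (size xs); last first.
  by rewrite !nth_default ?subrr ?normr0 -?sz.
rewrite ltr_norml; apply/andP; split; last first.
  apply: (sorted_close_le sx sy px py) => //; apply: sub_all ce => p.
  by rewrite ltr_norml => /andP[].
rewrite ltrNl opprB.
apply: (@sorted_close_le e [seq (p.2, p.1) | p <- ps] ys xs) => //.
- by rewrite /unzip1 -map_comp.
- by rewrite /unzip2 -map_comp.
- rewrite all_map; apply: sub_all ce => p /=.
  by rewrite ltr_norml => /andP[+ _]; rewrite ltrNl opprB.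
- by rewrite -sz.
Qed.

End double_value.

(** * Continuity of the roots *)

Section polynomial_continuity.
Context (R : realType) (T : topologicalType) (z : T).
Implicit Types (F G : T -> {poly R}) (f : T -> R).

Definition coef_continuous F := forall i, continuous_at z (fun t => (F t)`_i).

Lemma coef_continuousC (p : {poly R}) : coef_continuous (fun=> p).
Proof. by move=> i; cts. Qed.

Lemma coef_continuousD F G : coef_continuous F -> coef_continuous G ->
  coef_continuous (fun t => F t + G t).
Proof.
move=> cF cG i.
rewrite (_ : (fun t => _) = (fun t => (F t)`_i + (G t)`_i)).
  by apply: ctsD; [exact: cF|exact: cG].
by apply/funext => t; rewrite coefD.
Qed.

Lemma coef_continuousM F G : coef_continuous F -> coef_continuous G ->
  coef_continuous (fun t => F t * G t).
Proof.
move=> cF cG i.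
rewrite (_ : (fun t => _) = (fun t => \sum_(j < i.+1) (F t)`_j * (G t)`_(i - j))).
  by apply: cts_sum => j; apply: ctsM; [exact: cF|exact: cG].
by apply/funext => t; rewrite coefM.
Qed.

Lemma coef_continuous_polyC f : continuous_at z f -> coef_continuous (fun t => (f t)%:P).
Proof.
move=> cf [|i].
  rewrite (_ : (fun t => _) = f) //.
  by apply/funext => t; rewrite coefC.
rewrite (_ : (fun t => _) = (fun=> 0)); first by cts.
by apply/funext => t; rewrite coefC.
Qed.

Lemma coef_continuousZ f F : continuous_at z f -> coef_continuous F ->
  coef_continuous (fun t => f t *: F t).
Proof.
move=> cf cF i.
rewrite (_ : (fun t => _) = (fun t => f t * (F t)`_i)).
  by apply: ctsM => //; exact: cF.
by apply/funext => t; rewrite coefZ.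
Qed.

Lemma coef_continuousX F k : coef_continuous F -> coef_continuous (fun t => F t ^+ k).
Proof.
move=> cF; elim: k => [|k IH]; first exact: coef_continuousC.
have := coef_continuousM cF IH.
rewrite (_ : (fun t => F t ^+ k.+1) = (fun t => F t * F t ^+ k)) //.
by apply/funext => t; rewrite exprS.
Qed.

Lemma coef_continuous_XsubC f :
  continuous_at z f -> coef_continuous (fun t => 'X - (f t)%:P).
Proof.
move=> cf.
rewrite (_ : (fun t => _) = (fun t => 'X + (- f t)%:P)).
  apply: coef_continuousD; first exact: coef_continuousC.
  by apply: coef_continuous_polyC; cts.
by apply/funext => t; rewrite polyCN.
Qed.

Lemma coef_continuous_prod k (F : 'I_k -> T -> {poly R}) :
  (forall j, coef_continuous (F j)) -> coef_continuous (fun t => \prod_j F j t).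
Proof.
elim: k F => [|k IH] F cF.
  rewrite (_ : (fun t => _) = (fun=> 1)); first exact: coef_continuousC.
  by apply/funext => t; rewrite big_ord0.
rewrite (_ : (fun t => _) = (fun t => F ord0 t * \prod_(j < k) F (lift ord0 j) t)).
  by apply: coef_continuousM => //; apply: IH.
by apply/funext => t; rewrite big_ord_recl.
Qed.

Lemma coef_continuous_horner n F f : (forall t, (size (F t) <= n)%N) ->
  coef_continuous F -> continuous_at z f -> continuous_at z (fun t => (F t).[f t]).
Proof.
move=> sF cF cf.
rewrite (_ : (fun t => _) = (fun t => \sum_(i < n) (F t)`_i * f t ^+ i)).
  by apply: cts_sum => j; apply: ctsM; [exact: cF|cts].
by apply/funext => t; rewrite (horner_coef_wide _ (sF t)).
Qed.

Lemma coef_continuous_comp n F G : (forall t, (size (F t) <= n)%N) ->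
  coef_continuous F -> coef_continuous G -> coef_continuous (fun t => F t \Po G t).
Proof.
move=> sF cF cG i.
rewrite (_ : (fun t => _) = (fun t => \sum_(j < n) (F t)`_j * (G t ^+ j)`_i)).
  by apply: cts_sum => j; apply: ctsM; [exact: cF|exact: coef_continuousX].
apply/funext => t; rewrite /comp_poly (horner_coef_wide (n := n)).
  by rewrite coef_sum; apply: eq_bigr => j _; rewrite coef_map /= coefCM.
by rewrite (leq_trans (size_poly _ _)).
Qed.

End polynomial_continuity.

Section coefficient_vectors.
Context (R : realType).

Lemma monic_of_coefs_monic d (a : 'rV[R]_d) : monic_of_coefs a \is monic.
Proof. by have [] := (monic_of_coefsP d (monic_of_coefs a)).2 (ex_intro _ a erefl). Qed.

Lemma size_monic_of_coefs d (a : 'rV[R]_d) : size (monic_of_coefs a) = d.+1.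
Proof. by have [] := (monic_of_coefsP d (monic_of_coefs a)).2 (ex_intro _ a erefl). Qed.

Lemma poly_rVK_monic d (p : {poly R}) : p \is monic -> size p = d.+1 ->
  monic_of_coefs (poly_rV p : 'rV_d) = p.
Proof.
move=> pm sp; have [a <-] := (monic_of_coefsP d p).1 (conj pm sp); congr monic_of_coefs.
apply/rowP => i; rewrite mxE coefD coefXn coef_rVpoly ltn_eqF // add0r.
by case: insubP => [j _ /val_inj -> //|]; rewrite ltn_ord.
Qed.

Lemma coef_continuous_monic_of_coefs (T : topologicalType) (z : T) d (f : T -> 'rV[R]_d) :
  continuous_at z f -> coef_continuous z (fun t => monic_of_coefs (f t)).
Proof.
move=> cf; apply: coef_continuousD; first exact: coef_continuousC.
move=> i; case: (ltnP i d) => id.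
  rewrite (_ : (fun t => _) = (fun t => f t ord0 (Ordinal id))); first by cts.
  apply/funext => t; rewrite coef_rVpoly; case: insubP => [j _ e|/negP//].
  by congr (f t _ _); apply: val_inj.
rewrite (_ : (fun t => _) = (fun=> 0)); first by cts.
apply/funext => t; rewrite coef_rVpoly; case: insubP => [j jd _|//].
by move: jd; rewrite ltnNge id.
Qed.

Lemma continuous_at_poly_rV (T : topologicalType) (z : T) d (F : T -> {poly R}) :
  coef_continuous z F -> continuous_at z (fun t => poly_rV (F t) : 'rV_d).
Proof.
move=> cF; apply: continuous_at_row => i.
rewrite (_ : (fun t => _) = (fun t => (F t)`_i)); first exact: cF.
by apply/funext => t; rewrite mxE.
Qed.

End coefficient_vectors.

Section quotient_root.
Context (R : realType).
Implicit Types p : {poly R}.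

(** The quotient by ['X - x], obtained by translating [x] to the origin, where
    the division is a shift of the coefficients; this makes its continuity in
    [p] and [x] visible. *)
Definition quotient_root p x : {poly R} :=
  drop_poly 1 (p \Po ('X + x%:P)) \Po ('X - x%:P).

Lemma quotient_rootP p x : root p x -> p = ('X - x%:P) * quotient_root p x.
Proof.
move=> /rootP px; set r := p \Po ('X + x%:P).
have rE : r = 'X * drop_poly 1 r.
  rewrite -[LHS](poly_take_drop 1) expr1 mulrC -[RHS]add0r; congr (_ + _).
  apply/polyP => i; rewrite coef_take_poly coef0; case: i => //=.
  by rewrite -horner_coef0 horner_comp hornerD hornerX hornerC add0r.
have : r \Po ('X - x%:P) = p.
  by rewrite -comp_polyA comp_polyD comp_polyX comp_polyC subrK comp_polyXr.
by rewrite rE comp_polyM comp_polyX.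
Qed.

Lemma quotient_root_monic p x n : root p x -> p \is monic -> size p = n.+2 ->
  quotient_root p x \is monic /\ size (quotient_root p x) = n.+1.
Proof.
move=> /quotient_rootP pE pm sp; have qm : quotient_root p x \is monic.
  by rewrite -(monicMl _ (monicXsubC x)) -pE.
split=> //; have := size_Mmonic (monic_neq0 (monicXsubC x)) qm.
by rewrite -pE sp size_XsubC => -[->].
Qed.

Lemma coef_continuous_quotient_root (T : topologicalType) (z : T) n
    (F : T -> {poly R}) (f : T -> R) : (forall t, (size (F t) <= n)%N) ->
  coef_continuous z F -> continuous_at z f ->
  coef_continuous z (fun t => quotient_root (F t) (f t)).
Proof.
move=> sF cF cf.
have cadd : coef_continuous z (fun t => 'X + (f t)%:P).
  by apply: coef_continuousD; [exact: coef_continuousC|exact: coef_continuous_polyC].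
apply: (@coef_continuous_comp _ _ _ n); last exact: coef_continuous_XsubC.
- move=> t; rewrite size_drop_poly size_comp_poly2 ?size_XaddC //.
  by rewrite (leq_trans (leq_subr _ _)).
- move=> i; rewrite (_ : (fun t => _) = (fun t => (F t \Po ('X + (f t)%:P))`_(i + 1))).
    exact: (coef_continuous_comp sF).
  by apply/funext => t; rewrite coef_drop_poly.
Qed.

End quotient_root.

Section roots_near.
Context (R : realType).
Implicit Types (e : R) (xs ys : seq R).

(** Entries of [ys] may be left over, since a perturbation can move real roots
    away from the real line. *)
Definition roots_close e xs ys := exists ps rest,
  [/\ perm_eq (unzip1 ps) xs, perm_eq (unzip2 ps ++ rest) ys &
      all (fun p : R * R => `|p.1 - p.2| < e) ps].

Lemma near_fst (S T : topologicalType) (p : S * T) (P : set S) :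
  (\forall s \near p.1, P s) -> \forall q \near p, P q.1.
Proof. by move=> h; exact: (@fst_continuous_at _ _ p _ h). Qed.

Lemma near_neq0 (T : topologicalType) (z : T) (f : T -> R) :
  continuous_at z f -> f z != 0 -> \forall t \near z, f t != 0.
Proof.
move=> cf fz; have : continuous_at z (fun t => `|f t|) by cts.
have h0 : nbhs `|f z| [set y : R | 0 < y] by apply: lt_nbhsr; rewrite normr_gt0.
move=> /(_ _ h0) h; have {}h : \forall t \near z, 0 < `|f t| by exact: h.
by apply: filterS h => t; rewrite normr_gt0.
Qed.

Lemma near_roots_bounded d (a0 : 'rV[R]_d) : exists2 C : R, 0 <= C &
  \forall a \near a0, forall x, root (monic_of_coefs a) x -> `|x| <= C.
Proof.
pose B (a : 'rV[R]_d) : R := 1 + \sum_(i < d.+1) `|(monic_of_coefs a)`_i|.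
have BE a : cauchy_bound (monic_of_coefs a) = B a.
  rewrite /cauchy_bound (monicP (monic_of_coefs_monic a)) normr1 invr1 mul1r.
  by rewrite size_monic_of_coefs.
have cB : continuous_at a0 B.
  apply: ctsD; first by cts.
  apply: cts_sum => i; apply: ctsA.
  by apply: (@coef_continuous_monic_of_coefs R _ a0 d id); cts.
exists (B a0 + 1); first by rewrite -BE addr_ge0 ?cauchy_bound_ge0.
have : nbhs (B a0) [set y | y < B a0 + 1] by apply: lt_nbhsl; lra.
move=> /cB h; have {}h : \forall a \near a0, B a < B a0 + 1 by exact: h.
apply: filterS h => a Ba x /rootP rx.
have := cauchy_boundP (monic_neq0 (monic_of_coefs_monic a)) rx.
by rewrite BE => h; apply: ltW; exact: lt_trans h Ba.
Qed.

Lemma roots_close_cons e x z xs ys : `|x - z| < e -> roots_close e xs ys ->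
  roots_close e (x :: xs) (z :: ys).
Proof.
move=> xz [ps [rest [p1 p2 ca]]]; exists ((x, z) :: ps), rest; split => //=.
- by rewrite perm_cons.
- by rewrite perm_cons.
- by rewrite xz.
Qed.

Lemma roots_close_perm e xs ys xs' ys' : perm_eq xs xs' -> perm_eq ys ys' ->
  roots_close e xs ys -> roots_close e xs' ys'.
Proof.
move=> px py [ps [rest [p1 p2 ca]]]; exists ps, rest; split => //.
  exact: perm_trans p1 px.
exact: perm_trans p2 py.
Qed.

(** The roots of a polynomial close to [monic_of_coefs a0] can be paired with
    nearby roots of the latter, some of which may be left over.  A root [x] of
    the perturbed polynomial lies near a root [z] of the original one, because
    values of polynomials are bounded away from zero on compact sets without
    roots; dividing by ['X - x] and ['X - z] leads to polynomials that are close
    again. *)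
Lemma rootlist_near d (a0 : 'rV[R]_d) e : 0 < e -> \forall a \near a0,
  roots_close e (rootlist (monic_of_coefs a)) (rootlist (monic_of_coefs a0)).
Proof.
move=> e0; elim: d a0 => [|d IH] a0.
  apply: filterE => a; exists [::], (rootlist (monic_of_coefs a0)); split => //=.
  have := size_rootlist_le (monic_of_coefs_monic a).
  by rewrite size_monic_of_coefs; case: rootlist.
have [C C0 bounded] := near_roots_bounded a0.
have ceval (z : R) : continuous_at (z, a0) (fun p : R * 'rV[R]_d.+1 => (monic_of_coefs p.2).[p.1]).
  apply: (@coef_continuous_horner R _ _ d.+2 (fun p : R * 'rV[R]_d.+1 => monic_of_coefs p.2) fst).
  - by move=> p; rewrite size_monic_of_coefs.
  - by apply: coef_continuous_monic_of_coefs; cts.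
  - by cts.
have /compact_near_coveringP cover := @segment_compact R (- C) C.
have := @cover _ (nbhs a0) (fun a x => root (monic_of_coefs a) x ->
  roots_close e (rootlist (monic_of_coefs a)) (rootlist (monic_of_coefs a0))) _.
have local (z : R) : \forall p \near (z, a0), root (monic_of_coefs p.2) p.1 ->
    roots_close e (rootlist (monic_of_coefs p.2)) (rootlist (monic_of_coefs a0)).
  have [rz|rz] := boolP (root (monic_of_coefs a0) z); last first.
    by apply: filterS (near_neq0 (ceval z) rz) => p /= /negbTE h /rootP /eqP; rewrite h.
  pose quo (p : R * 'rV[R]_d.+1) : 'rV[R]_d := poly_rV (quotient_root (monic_of_coefs p.2) p.1).
  have cquo : continuous_at (z, a0) quo.
    apply: continuous_at_poly_rV.
    apply: (@coef_continuous_quotient_root R _ _ d.+2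
      (fun p : R * 'rV[R]_d.+1 => monic_of_coefs p.2) fst).
    - by move=> p; rewrite size_monic_of_coefs.
    - by apply: coef_continuous_monic_of_coefs; cts.
    - by cts.
  have factor p : root (monic_of_coefs p.2) p.1 ->
      perm_eq (rootlist (monic_of_coefs p.2)) (p.1 :: rootlist (monic_of_coefs (quo p))).
    move=> rp; have [qm qs] := quotient_root_monic rp (monic_of_coefs_monic _)
      (size_monic_of_coefs _).
    by rewrite {1}(quotient_rootP rp) poly_rVK_monic // perm_rootlist_cons.
  have near_z : \forall p \near (z, a0), `|p.1 - z| < e.
    have := @near_fst _ _ (z, a0) (fun x => `|x - z| < e); apply.
    by apply: filterS (nbhsx_ballx z e e0) => x; rewrite /ball /= distrC.
  apply: filterS2 near_z (cquo _ (IH (quo (z, a0)))) => p pz close rp.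
  apply: (roots_close_perm _ _ (roots_close_cons pz close)).
    by rewrite perm_sym factor.
  by rewrite perm_sym (factor (z, a0)).
move=> /(_ _ (fun z _ => local z)) near_roots.
apply: filterS2 bounded near_roots => a bounded near_a.
have [[x rx]|nr] := pselect (exists x, root (monic_of_coefs a) x).
  apply: (near_a x) => //; rewrite /= in_itv /=.
  by have := bounded _ rx; rewrite ler_norml.
exists [::], (rootlist (monic_of_coefs a0)); split => //=.
case E : (rootlist (monic_of_coefs a)) => [|x s] //; case: nr; exists x.
by rewrite -mem_rootlist ?monic_neq0 ?monic_of_coefs_monic // E mem_head.
Qed.

(** The polynomial changes its sign at a simple root, and so do all nearby
    polynomials. *)
Lemma simple_root_near d (a0 : 'rV[R]_d) z e : 0 < e ->
  count_mem z (rootlist (monic_of_coefs a0)) = 1%N ->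
  \forall a \near a0, exists2 x, root (monic_of_coefs a) x & `|x - z| < e.
Proof.
move=> e0; have p0 := monic_neq0 (monic_of_coefs_monic a0).
rewrite count_rootlist // => m1; have [q qz pE] := mu_spec z p0.
move: pE; rewrite m1 expr1 => pE.
have cq : continuous_at z (fun y => q.[y] * q.[z]) by cts; exact: continuous_horner.
have near_q : \forall y \near z, 0 < q.[y] * q.[z].
  by apply: cq _ (lt_nbhsr _); rewrite -expr2 exprn_even_gt0.
have /nbhs_ballP[r /= r0 qr] := near_q.
pose h : R := Num.min r e / 2.
have h0 : 0 < h by rewrite divr_gt0 // lt_min r0.
have mr : Num.min r e <= r by rewrite ge_min lexx.
have me : Num.min r e <= e by rewrite ge_min lexx orbT.
have hr : h < r by move: h0; rewrite /h; lra.
have he : h < e by move: h0; rewrite /h; lra.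
have qp : 0 < q.[z + h] * q.[z].
  by apply: qr; rewrite /ball /= opprD addrA subrr sub0r normrN gtr0_norm.
have qm : 0 < q.[z - h] * q.[z].
  by apply: qr; rewrite /ball /= opprB addrC subrK gtr0_norm.
have sign0 : (monic_of_coefs a0).[z - h] * (monic_of_coefs a0).[z + h] < 0.
  rewrite pE !hornerM !hornerXsubC.
  have : 0 < q.[z - h] * q.[z + h].
    by move: (mulr_gt0 qm qp); rewrite mulrACA -expr2 pmulr_lgt0 // exprn_even_gt0.
  have : 0 < h ^+ 2 by rewrite exprn_gt0.
  by nra.
have ceval u : continuous_at a0 (fun a => (monic_of_coefs a).[u]).
  apply: (@coef_continuous_horner R _ _ d.+1 (fun a : 'rV[R]_d => monic_of_coefs a) (fun=> u)).
  - by move=> a; rewrite size_monic_of_coefs.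
  - by apply: (@coef_continuous_monic_of_coefs R _ a0 d id); cts.
  - by cts.
have csign : continuous_at a0 (fun a => (monic_of_coefs a).[z - h] * (monic_of_coefs a).[z + h]).
  by cts; exact: ceval.
have near_sign : \forall a \near a0,
    (monic_of_coefs a).[z - h] * (monic_of_coefs a).[z + h] < 0.
  exact: csign _ (lt_nbhsl sign0).
apply: filterS near_sign => a /poly_ivtoo[|x]; first by lra.
by rewrite in_itv /= => /andP[x1 x2] rx; exists x => //; rewrite ltr_norml; lra.
Qed.

Lemma seq_gap xs : exists2 e, 0 < e &
  forall x y, x \in xs -> y \in xs -> `|x - y| < e -> x = y.
Proof.
elim: xs => [|x xs [e e0 sep]]; first by exists 1.
have [e' e'0 sep'] : exists2 e', 0 < e' & forall y, y \in xs -> `|x - y| < e' -> x = y.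
  elim: xs {e e0 sep} => [|y ys [e e0 sep]]; first by exists 1.
  have [<-|xy] := eqVneq x y.
    by exists e => // u; rewrite inE => /predU1P[//|]; exact: sep.
  exists (Num.min e `|x - y|); first by rewrite lt_min e0 normr_gt0 subr_eq0.
  move=> u; rewrite inE lt_min => /predU1P[->|/sep h] /andP[]; last by move=> /h.
  by rewrite ltxx.
exists (Num.min e e'); first by rewrite lt_min e0.
move=> u v; rewrite !inE lt_min => /predU1P[->|uxs] /predU1P[->|vxs] /andP[d1 d2] //.
- exact: sep'.
- by rewrite -(sep' u) // distrC.
- exact: sep.
Qed.

(** Near a polynomial with at most one double root, the simple roots persist by
    the intermediate value theorem, and the double root either splits into a
    pair of close real roots or, for parity reasons, disappears as a pair. *)
Lemma rootlist_near_admissible d (a0 : 'rV[R]_d) e : 0 < e ->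
  admissible (rootlist (monic_of_coefs a0)) ->
  \forall a \near a0,
    seq_close e (rootlist (monic_of_coefs a)) (rootlist (monic_of_coefs a0)) \/
    exists2 i, double (rootlist (monic_of_coefs a0)) i &
      seq_close e (rootlist (monic_of_coefs a))
                  (drop_pair i (rootlist (monic_of_coefs a0))).
Proof.
set xs := rootlist (monic_of_coefs a0) => e0 adm.
have sxs : sorted <=%R xs by exact: rootlist_sorted.
have [g g0 gap] := seq_gap xs.
pose e' := Num.min e (g / 2).
have e'0 : 0 < e' by rewrite lt_min e0 divr_gt0.
have e'e : e' <= e by rewrite ge_min lexx.
have e'g : e' <= g / 2 by rewrite ge_min lexx orbT.
have retained : \forall a \near a0, forall z, z \in xs -> count_mem z xs = 1%N ->
    exists2 x, root (monic_of_coefs a) x & `|x - z| < e'.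
  have : forall s : seq R, {subset s <= xs} -> \forall a \near a0, forall z, z \in s ->
      count_mem z xs = 1%N -> exists2 x, root (monic_of_coefs a) x & `|x - z| < e'.
    elim=> [|z s IH] sub; first by apply: filterE.
    have {IH} near_s := IH (fun w ws => sub w (mem_behead (s := z :: s) ws)).
    have [c1|c1] := eqVneq (count_mem z xs) 1%N.
      apply: filterS2 near_s (simple_root_near e'0 c1) => a hs hz w.
      by rewrite inE => /predU1P[->|/hs].
    apply: filterS near_s => a hs w; rewrite inE => /predU1P[->|/hs //].
    by move=> c; rewrite c in c1.
  by move=> /(_ xs (fun _ => id)).
apply: filterS2 retained (rootlist_near a0 e'0) => a retained [ps [rest [p1 p2 close]]].
have am := monic_of_coefs_monic a.
have sa := rootlist_sorted (monic_of_coefs a).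
have mult z : z \in rest -> (1 < count_mem z xs)%N.
  move=> zr; have c0 : (0 < count_mem z rest)%N by rewrite -has_count has_pred1.
  have cxs : count_mem z xs = (count_mem z (unzip2 ps) + count_mem z rest)%N.
    by rewrite -(permP p2) count_cat.
  have zxs : z \in xs by rewrite -has_pred1 has_count cxs addn_gt0 c0 orbT.
  rewrite ltn_neqAle eq_sym andbC cxs (leq_trans c0 (leq_addl _ _)) /= -cxs.
  apply/negP => /eqP c1; have [x rx xz] := retained z zxs c1.
  have : x \in unzip1 ps by rewrite (perm_mem p1) mem_rootlist ?monic_neq0.
  move=> /mapP[p pps xp]; have := allP close p pps; rewrite -xp => xp2.
  have p2u : p.2 \in unzip2 ps by apply: map_f.
  have zp : z = p.2.
    apply: gap => //; first by rewrite -(perm_mem p2) mem_cat p2u.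
    have := ler_distD x z p.2; rewrite [`|z - x|]distrC; lra.
  have : (0 < count_mem z (unzip2 ps))%N by rewrite -has_count has_pred1 zp.
  move: c1 c0; rewrite cxs; case: (count_mem z rest) => [|n] //.
  by case: (count_mem _ _) => [|m] //; rewrite addnS addSn.
have closee : all (fun p => `|p.1 - p.2| < e) ps.
  by apply: sub_all close => p h; exact: lt_le_trans h e'e.
have sz : (size (rootlist (monic_of_coefs a)) + size rest = size xs)%N.
  by rewrite -(perm_size p1) -(perm_size p2) size_cat !size_map.
case: rest => [|z rest] in p2 mult sz *.
  left; apply: (sorted_close e0 sa sxs p1 _ closee).
  by move: p2; rewrite cats0.
right; have [i [di pxs uz z2]] := admissible_double_value sxs adm (mult z (mem_head _ _)).
exists i => //.
have restE : rest = nseq (size rest) z.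
  by apply/all_pred1P/allP => w wr /=; apply/eqP/uz/mult; rewrite inE wr orbT.
have r1 : size rest = 1%N.
  have : odd (size rest).
    have := size_rootlist_parity am; have := size_rootlist_parity (monic_of_coefs_monic a0).
    by rewrite !size_monic_of_coefs -/xs -sz => <-; rewrite oddD /=; do 2!case: odd.
  have : (size rest <= 1)%N.
    have crest : count_mem z rest = size rest.
      by rewrite {1}restE count_nseq /= eqxx mul1n.
    rewrite -ltnS; apply: leq_trans z2.
    by rewrite -(permP p2) count_cat /= eqxx crest add1n leq_addl.
  by case: (size rest) => [|[|]].
apply: (sorted_close e0 sa _ p1 _ closee).
  by apply: subseq_sorted sxs; [exact: le_trans|exact: subseq_drop_pair].
move: p2; rewrite restE r1 /= perm_catC /= => p2.
by have := perm_trans p2 pxs; rewrite !perm_cons.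
Qed.

End roots_near.

(** * Deformations *)

Section deformations.
Context (R : realType) (X : topologicalType).
Local Notation I := (unit_interval R).
Implicit Types (V W : set X) (f g h : X -> X).

(** Besides [V], the deformation has to preserve a second set [W], in the
    applications the part of [V] onto which it pushes [V]. *)
Definition deforms V W f g := exists H : I * X -> X,
  [/\ forall t x, V x -> V (H (t, x)), forall t x, W x -> W (H (t, x)),
      forall x, V x -> H (zero, x) = f x, forall x, V x -> H (one, x) = g x &
      forall t x, V x -> continuous_at (t, x) H].

Lemma deforms_self V W f g : deforms V W f g -> deforms V V f g.
Proof. by move=> [H [HV HW H0 H1 cH]]; exists H; split. Qed.

Lemma deforms_trans V W f g h : deforms V W f g -> deforms V W g h -> deforms V W f h.
Proof.
move=> [H [HV HW H0 H1 cH]] [K [KV KW K0 K1 cK]].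
exists (fun p => if 2 * ival p.1 - 1 <= 0 then H (clamp (2 * ival p.1), p.2)
                 else K (clamp (2 * ival p.1 - 1), p.2)); split.
- by move=> t x Vx /=; case: ifP => _; [exact: HV|exact: KV].
- by move=> t x Wx /=; case: ifP => _; [exact: HW|exact: KW].
- by move=> x Vx /=; rewrite ival0 mulr0 sub0r lerN10 clamp_le0 ?H0.
- move=> x Vx /=; rewrite ival1 mulr1 ifF; last by apply/negbTE; rewrite -ltNge; lra.
  by rewrite clamp_ge1 ?K1 //; lra.
- move=> t x Vx; apply: paste_at; first by cts.
  + move=> _; apply: (@continuous_at_comp _ _ _
      (fun p : I * X => (clamp (2 * ival p.1), p.2)) H); first by cts.
    exact: cH.
  + move=> _; apply: (@continuous_at_comp _ _ _
      (fun p : I * X => (clamp (2 * ival p.1 - 1), p.2)) K); first by cts.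
    exact: cK.
  + by move=> /= t0; rewrite clamp_ge1 ?clamp_le0 ?H1 ?K0 //; lra.
Qed.

Lemma deforms_through V W g c : deforms V W id g -> (forall x, V x -> W (g x)) ->
  W `<=` V -> deforms W W id (fun=> c) -> deforms V W id (fun=> c).
Proof.
move=> Vg gW WV [K [KW _ K0 K1 cK]]; apply: (deforms_trans Vg).
have [H [HV HW H0 H1 cH]] := Vg.
exists (fun p => K (p.1, H (one, p.2))); split.
- by move=> t x Vx; rewrite H1 //; apply/WV/KW/gW.
- by move=> t x Wx; apply/KW/HW.
- by move=> x Vx; rewrite H1 // K0 //; exact: gW.
- by move=> x Vx; rewrite H1 // K1 //; exact: gW.
- move=> t x Vx; apply: (@continuous_at_comp _ _ _ (fun p : I * X => (p.1, H (one, p.2))) K).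
    apply: continuous_at_pair; first by cts.
    apply: (@continuous_at_comp _ _ _ (fun p : I * X => (one, p.2)) H); first by cts.
    exact: cH.
  by rewrite /= H1 //; apply/cK/gW.
Qed.

Lemma deforms_contraction V W c : V c -> deforms V W id (fun=> c) -> contraction R V.
Proof. by move=> Vc /cid[H [HV _ H0 H1 cH]]; exact: (@Contraction _ _ _ H c). Qed.

End deformations.

(** * A distance function and an extension theorem *)

Section capped_distance.
Context (R : realType) (X : pseudoMetricType R) (A : set X).

Definition radii (x : X) : set R :=
  [set r | r = 1 \/ 0 < r /\ exists2 a, A a & ball x r a].

(** Capping at [1] keeps the infimum finite for empty [A] as well. *)
Definition capped_distance (x : X) : R := inf (radii x).

Lemma radii_lbound x : lbound (radii x) 0.
Proof. by move=> r [->//|[/ltW]]. Qed.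

Lemma capped_distance_le x r : radii x r -> capped_distance x <= r.
Proof. by apply: ge_inf; exists 0; exact: radii_lbound. Qed.

Lemma capped_distance_ge x m : lbound (radii x) m -> m <= capped_distance x.
Proof. by apply: lb_le_inf; exists 1; left. Qed.

Lemma capped_distance_lipschitz x y e : 0 < e -> ball x e y ->
  capped_distance y <= capped_distance x + e.
Proof.
move=> e0 xy; rewrite -lerBlDr; apply: capped_distance_ge => r [->|[r0 [a Aa xa]]].
  by rewrite lerBlDr (@le_trans _ _ 1) ?capped_distance_le //; [left|lra].
rewrite lerBlDr; apply: capped_distance_le; right; split; first exact: addr_gt0.
by exists a => //; rewrite addrC; apply: ball_triangle xa; exact: ball_sym.
Qed.

Lemma capped_distance_continuous : continuous capped_distance.
Proof.
move=> x; apply/cvgrPdist_le => e e0; apply: filterS (nbhsx_ballx x e e0) => y xy.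
have := capped_distance_lipschitz e0 xy.
have := capped_distance_lipschitz e0 (ball_sym xy).
by move=> *; rewrite ler_norml; lra.
Qed.

Lemma capped_distance0 a : A a -> capped_distance a = 0.
Proof.
move=> Aa; apply/eqP; rewrite eq_le capped_distance_ge ?andbT; last exact: radii_lbound.
apply/ler_addgt0Pr => e e0; rewrite add0r; apply: capped_distance_le; right.
by split=> //; exists a => //; exact: ballxx.
Qed.

Lemma capped_distance_gt0 x : (\forall y \near x, ~ A y) -> 0 < capped_distance x.
Proof.
move=> /nbhs_ballP[r /= r0 xr]; apply: (@lt_le_trans _ _ (Num.min r 1)).
  by rewrite lt_min r0 ltr01.
apply: capped_distance_ge => s [->|[s0 [a Aa xa]]]; first by rewrite ge_min lexx orbT.
rewrite ge_min; apply/orP; left; rewrite leNgt; apply/negP => sr.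
by apply: (xr a _ Aa); apply: le_ball xa; exact: ltW.
Qed.

End capped_distance.

Section extension.
Context (R : realType) (X : pseudoMetricType R) (V A : set X) (f : X -> R).
Hypothesis oV : open V.
Hypothesis AVclosed : forall x, V x -> ~ A x -> \forall y \near x, ~ A y.

Let closedA : closed (A : set (subspace V)).
Proof.
apply/closed_subspaceP; exists (closure A); first exact: closed_closure.
apply/seteqP; split => x [Ax Vx]; split => //; last exact: subset_closure.
apply: contrapT => /(AVclosed Vx) /Ax [y [Ay nAy]]; exact: nAy.
Qed.

Let normalV : normal_space (subspace V).
Proof. exact: (@pseudometric_normal R (subspace V)). Qed.

(** Urysohn's lemma in the open subspace [V], in which the sets in question are
    closed. *)
Lemma relative_bump (B : set X) : (forall x, A x -> ~ B x) ->
  (forall x, V x -> ~ B x -> \forall y \near x, ~ B y) ->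
  exists g : X -> R, [/\ forall x, V x -> continuous_at x g,
    forall x, 0 <= g x <= 1, forall x, A x -> g x = 1 &
    forall x, B x -> g x = 0].
Proof.
move=> AB Bcl.
have closedB : closed (B : set (subspace V)).
  apply/closed_subspaceP; exists (closure B); first exact: closed_closure.
  apply/seteqP; split => x [Bx Vx]; split => //; last exact: subset_closure.
  by apply: contrapT => /(Bcl _ Vx) /Bx [y [By nBy]]; exact: nBy.
have [] := @urysohn_ext_itv (subspace V) R normalV B A 0 1 closedB closedA.
- by apply/seteqP; split => x //= [Bx /AB].
- exact: ltr01.
move=> g [cg g0 g1 g01]; exists g; split.
- move=> x Vx; move: cg; rewrite continuous_open_subspace //; apply.
  exact: mem_set.
- by move=> x; have := g01 (g x); rewrite /= in_itv /=; apply; exists x.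
- by move=> x Ax; apply: g1; exists x.
- by move=> x Bx; apply: g0; exists x.
Qed.

(** The extension theorem for bounded functions is applied to
    [f / (1 + |f|)]. The extension of this function has values in the closed
    interval from [-1] to [1]; dividing it by one plus the distance to [A] keeps
    it away from the end points, where the inverse transformation is not
    defined. *)
Lemma relative_extension :
  (forall x, A x -> forall e, 0 < e -> \forall y \near x, A y -> `|f y - f x| < e) ->
  exists g : X -> R, (forall x, V x -> continuous_at x g) /\ forall x, A x -> g x = f x.
Proof.
move=> cf; pose w x := f x / (1 + `|f x|).
have f1 x : 0 < 1 + `|f x| by rewrite ltr_wpDr.
have w1 x : `|w x| < 1.
  by rewrite normrM normrV ?unitfE ?gt_eqF // (gtr0_norm (f1 x)) ltr_pdivrMr //; lra.
have cw : {within (A : set (subspace V)), continuous (w : subspace V -> R^o)}.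
  apply/subspace_continuousP => x Ax.
  have cfx : f y @[y --> within A (nbhs (x : subspace V))] --> f x.
    apply/cvgrPdist_lt => e e0; have h := @incl_subspace_continuous _ V x _ (cf x Ax e e0).
    have {}h : \forall y \near (x : subspace V), A y -> `|f y - f x| < e by exact: h.
    rewrite /within /=; apply: filterS h => y h Ay.
    by rewrite distrC; exact: h.
  apply: cvgM => //; apply: cvgV; first by rewrite gt_eqF.
  by apply: cvgD; [exact: cvg_cst|exact: cvg_norm].
have [g [gw cg g1]] := @continuous_bounded_extension (subspace V) R normalV A closedA w 1
  ltr01 cw (fun x _ => ltW (w1 x)).
have {}cg x : V x -> continuous_at x (g : X -> R).
  by move=> Vx; move: cg; rewrite continuous_open_subspace //; apply; exact: mem_set.
pose k x := g x / (1 + capped_distance A x).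
have d0 x : 0 <= capped_distance A x by apply: capped_distance_ge; exact: radii_lbound.
have dpos x : 0 < 1 + capped_distance A x by rewrite ltr_wpDr.
have kw x : A x -> k x = w x.
  by move=> Ax; rewrite /k capped_distance0 // addr0 divr1 gw ?inE.
have k1 x : V x -> `|k x| < 1.
  move=> Vx; have [Ax|nAx] := pselect (A x); first by rewrite kw.
  have dx : 0 < capped_distance A x by apply/capped_distance_gt0/AVclosed.
  rewrite normrM normrV ?unitfE ?gt_eqF // (gtr0_norm (dpos x)) ltr_pdivrMr // mul1r.
  by apply: le_lt_trans (g1 x) _; rewrite ltrDl.
exists (fun x => k x / (1 - `|k x|)); split => x Vx.
  have ck : continuous_at x k.
    apply: ctsM; first exact: cg.
    apply: ctsV; first by rewrite gt_eqF.
    by apply: ctsD; [cts|exact: capped_distance_continuous].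
  apply: ctsM => //; apply: ctsV; last by cts.
  by have := k1 x Vx => ?; rewrite gt_eqF // subr_gt0.
rewrite kw // /w normrM normrV ?unitfE ?gt_eqF // (gtr0_norm (f1 x)).
have f0 := f1 x; have -> : 1 - `|f x| / (1 + `|f x|) = (1 + `|f x|)^-1.
  by field; rewrite gt_eqF.
by rewrite invrK mulfVK // gt_eqF.
Qed.

End extension.

(** * The strata of the space of polynomials *)

Section near_strict.
Context (R : realType).
Implicit Types (xs ys : seq R) (i j : nat).

Definition near_strict i xs := forall j, (j.+1 < size xs)%N ->
  if j == i then xs`_j <= xs`_j.+1 else xs`_j < xs`_j.+1.

Lemma near_strict_sorted i xs : near_strict i xs -> sorted <=%R xs.
Proof.
by move=> h; apply/(sortedP 0) => j /h; case: ifP => // _ /ltW.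
Qed.

Lemma near_strict_double i xs j : near_strict i xs -> double xs j -> j = i.
Proof.
move=> h /andP[/h]; case: eqVneq => // _ lt /eqP e.
by move: lt; rewrite e ltxx.
Qed.

Lemma near_strict_admissible i xs : near_strict i xs -> admissible xs.
Proof.
by move=> h j l /(near_strict_double h) -> /(near_strict_double h) ->.
Qed.

Lemma strict_near_strict i xs : sorted <%R xs -> near_strict i xs.
Proof. by move=> /(sortedP 0) h j /h lt; case: ifP => // _; exact: ltW. Qed.

Lemma strict_sorted xs : sorted <%R xs -> sorted <=%R xs.
Proof. by move=> /(strict_near_strict 0) /near_strict_sorted. Qed.

Lemma strict_doubleN xs i : sorted <%R xs -> ~~ double xs i.
Proof.
rewrite lt_sorted_uniq_le => /andP[u s]; exact: (sorted_uniqN s).2.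
Qed.

Lemma near_strict_strict i xs : near_strict i xs -> ~~ double xs i -> sorted <%R xs.
Proof.
move=> h nd; rewrite lt_sorted_uniq_le (near_strict_sorted h) andbT.
apply/(sorted_uniqN (near_strict_sorted h)) => j; apply/negP => dj.
by move: (dj); rewrite (near_strict_double h dj) (negbTE nd).
Qed.

Lemma double_near_strict i xs : sorted <=%R xs -> admissible xs -> double xs i ->
  near_strict i xs.
Proof.
move=> /(sortedP 0) s adm di j js; case: eqVneq => [_|ji]; first exact: s.
rewrite lt_neqAle s // andbT; apply: contra_neq ji => e.
by apply: adm => //; rewrite /double js e eqxx.
Qed.

Lemma seq_close_double e g xs ys j : 2 * e <= g ->
  (forall x y, x \in ys -> y \in ys -> `|x - y| < g -> x = y) ->
  seq_close e xs ys -> double xs j -> double ys j.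
Proof.
move=> eg gap [sz cl] /andP[js /eqP xj]; rewrite sz in js; rewrite /double js /=.
apply/eqP/gap; rewrite ?mem_nth ?(ltnW js) //.
have := cl j; have := cl j.+1; rewrite -xj => c1 c2.
have := ler_distD xs`_j ys`_j ys`_j.+1; rewrite [`|ys`_j - xs`_j|]distrC; lra.
Qed.

Lemma nth_drop_pair i xs j : (i < size xs)%N ->
  (drop_pair i xs)`_j = if (j < i)%N then xs`_j else xs`_j.+2.
Proof.
move=> si; rewrite nth_cat size_takel ?(ltnW si) //; case: ltnP => ij.
  by rewrite nth_take.
by rewrite nth_drop; congr nth; lia.
Qed.

Lemma drop_pair_uniq i xs : sorted <=%R xs -> admissible xs -> double xs i ->
  uniq (drop_pair i xs).
Proof.
move=> s adm di; apply: count_mem_uniq => w.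
have pi := perm_drop_pair di; set z := xs`_i in pi.
have cE v : count_mem v xs = ((z == v) + ((z == v) + count_mem v (drop_pair i xs)))%N.
  by rewrite (permP pi).
have z2 : (1 < count_mem z xs)%N by rewrite cE eqxx.
have [_ [_ _ uz c2]] := admissible_double_value s adm z2.
suff : (count_mem w (drop_pair i xs) <= 1)%N.
  by rewrite -has_pred1 has_count; case: count => [|[]].
rewrite leqNgt; apply/negP => w2.
have wz : w = z by apply: uz; rewrite cE (leq_trans w2) // addnA leq_addl.
by move: c2; rewrite cE eqxx -wz; move: w2; case: count => [|[]].
Qed.

Lemma drop_pair_strict i xs : near_strict i xs -> (i.+1 < size xs)%N ->
  sorted <%R (drop_pair i xs).
Proof.
move=> h si; apply/(sortedP 0) => j.
rewrite size_cat size_drop (size_takel (ltnW (ltnW si))) => js.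
rewrite !nth_drop_pair ?(ltnW si) //.
have {h js} : forall l, (l <= j.+2)%N -> if l == i then xs`_l <= xs`_l.+1 else xs`_l < xs`_l.+1.
  by move=> l lj; apply: h; move: si js lj; move: (size xs) => n; lia.
move=> h; case: (ltngtP j.+1 i) => ji.
- by have := h j (leqW (leqnSn j)); rewrite ltn_eqF ?(ltnW ji).
- by have := h j.+2 (leqnn _); rewrite gtn_eqF // (leq_trans ji).
- have := h j (leqW (leqnSn j)); have := h j.+1 (leqnSn _); have := h j.+2 (leqnn _).
  rewrite -ji eqxx gtn_eqF // ltn_eqF // => h3 h2 h1.
  exact: lt_trans (lt_le_trans h1 h2) h3.
Qed.

Lemma seq_close_drop_pair e xs ys i : (i < size ys)%N ->
  seq_close e xs ys -> seq_close e (drop_pair i xs) (drop_pair i ys).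
Proof.
move=> si [sz cl]; split; first by rewrite !size_cat !size_takel ?size_drop ?sz ?(ltnW si).
by move=> j; rewrite !nth_drop_pair ?sz //; case: ifP.
Qed.

Lemma linear_factors_pair i xs : (i.+1 < size xs)%N ->
  linear_factors xs =
    ('X - (xs`_i)%:P) * ('X - (xs`_i.+1)%:P) * linear_factors (drop_pair i xs).
Proof.
move=> si; have pi : perm_eq xs (xs`_i :: xs`_i.+1 :: drop_pair i xs).
  rewrite -{1}(cat_take_drop i xs) (drop_nth 0) ?(ltnW si) // (drop_nth 0 si).
  by rewrite perm_catC /= !perm_cons perm_catC.
by rewrite /linear_factors (perm_big _ pi) /= !big_cons mulrA.
Qed.

Lemma linear_factors_ord xs k : size xs = k ->
  linear_factors xs = \prod_(j < k) ('X - (xs`_j)%:P).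
Proof. by move=> <-; rewrite /linear_factors (big_nth 0) big_mkord. Qed.

End near_strict.

Lemma near_dist_continuous (R : realType) (T : topologicalType) (f : T -> R) z :
  (forall e, 0 < e -> \forall t \near z, `|f t - f z| < e) -> continuous_at z f.
Proof.
move=> h; apply/cvgrPdist_lt => e e0; apply: filterS (h e e0) => t.
by rewrite distrC.
Qed.

Section strata.
Context (R : realType) (d : nat).
Local Notation I := (unit_interval R).
Local Notation X := (poly_compl R d (Omega_reduced_ge d 2)).
Implicit Types (x : X) (p q : {poly R}) (xs : seq R) (k i j : nat).

Lemma poly_compl_admissible (a : 'rV[R]_d) :
  X a <-> admissible (rootlist (monic_of_coefs a)).
Proof.
have am := monic_of_coefs_monic a; have a0 := monic_neq0 am.
rewrite -reduced_size_rootlist // /poly_compl /=; set w := root_pattern _.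
have Ow : Omega d w.
  split; first exact: pattern_composition.
    by rewrite size_rootlist // -ltnS -(size_monic_of_coefs a) size_rootlist_le.
  by rewrite size_rootlist // !modn2 size_rootlist_parity // size_monic_of_coefs /= negbK.
split=> [nO|le1 [_]]; last by rewrite leqNgt ltnS le1.
by rewrite leqNgt; apply/negP => ge2; apply: nO.
Qed.

Definition pol x := monic_of_coefs (set_val x).

Definition rts x := rootlist (pol x).

Lemma pol_monic x : pol x \is monic. Proof. exact: monic_of_coefs_monic. Qed.

Lemma size_pol x : size (pol x) = d.+1. Proof. exact: size_monic_of_coefs. Qed.

Lemma rts_sorted x : sorted <=%R (rts x). Proof. exact: rootlist_sorted. Qed.

Lemma rts_admissible x : admissible (rts x).
Proof. by apply/poly_compl_admissible; exact: set_valP. Qed.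

Lemma size_rts_le x : (size (rts x) <= d)%N.
Proof. by rewrite -ltnS -(size_pol x) size_rootlist_le ?pol_monic. Qed.

Lemma odd_size_rts x : odd (size (rts x)) = odd d.
Proof. by rewrite size_rootlist_parity ?pol_monic // size_pol /= negbK. Qed.

Definition good p := [/\ p \is monic, size p = d.+1 & admissible (rootlist p)].

(** The point of the space given by a polynomial [p], with a default value [x]
    for polynomials outside of the space. *)
Definition to_point x p : X := insubd x (poly_rV p : 'rV_d).

Lemma set_val_to_point x p : good p -> set_val (to_point x p) = poly_rV p.
Proof.
move=> [pm sp adm]; rewrite /to_point /set_val /=; apply: insubdK.
by apply/mem_set/poly_compl_admissible; rewrite poly_rVK_monic.
Qed.

Lemma pol_to_point x p : good p -> pol (to_point x p) = p.
Proof.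
move=> gp; rewrite /pol set_val_to_point //; case: gp => pm sp _.
by rewrite poly_rVK_monic.
Qed.

Lemma pol_inj : injective pol.
Proof.
move=> x y /(congr1 (poly_rV (d := d))).
have polK z : poly_rV (pol z) = set_val z.
  apply/rowP => i; rewrite mxE coefD coefXn coef_rVpoly ltn_eqF // add0r.
  by case: insubP => [j _ /val_inj -> //|]; rewrite ltn_ord.
by rewrite !polK => /val_inj.
Qed.

Lemma good_pol x : good (pol x).
Proof. by split; [exact: pol_monic|exact: size_pol|exact: rts_admissible]. Qed.

Lemma to_point_pol x y : to_point x (pol y) = y.
Proof. by apply: pol_inj; rewrite pol_to_point //; exact: good_pol. Qed.

Lemma to_point_continuous (T : topologicalType) (z : T) (f : T -> X) (F : T -> {poly R}) :
  (\forall t \near z, good (F t)) -> coef_continuous z F ->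
  continuous_at z (fun t => to_point (f t) (F t)).
Proof.
move=> gF cF; apply: continuous_at_subtype.
apply: (@continuous_at_near _ _ (fun t => poly_rV (F t) : 'rV_d)).
  by apply: filterS gF => t gt; rewrite set_val_to_point.
exact: continuous_at_poly_rV.
Qed.

Lemma coef_continuous_pol x : coef_continuous x pol.
Proof. by apply: coef_continuous_monic_of_coefs; exact: subtype_continuous. Qed.

Lemma good_factors xs q : sorted <=%R xs -> admissible xs -> q \is monic ->
  positive_poly q -> (size xs + size q = d.+1)%N ->
  good (linear_factors xs * q) /\ rootlist (linear_factors xs * q) = xs.
Proof.
move=> s adm qm q0 sz; have rE := rootlist_factors s q0; split => //; split.
- by rewrite monicMl // linear_factors_monic.
- rewrite size_Mmonic ?monic_neq0 ?linear_factors_monic // size_linear_factors.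
  by rewrite addSn.
- by rewrite rE.
Qed.

Definition simple k : set X := [set x | size (rts x) = k /\ sorted <%R (rts x)].

Definition double_at k i : set X := [set x | size (rts x) = k /\ double (rts x) i].

Definition upper k i : set X := [set x | size (rts x) = k /\ near_strict i (rts x)].

Lemma upperE k i x : upper k i x <-> simple k x \/ double_at k i x.
Proof.
split=> [[sk ns]|[[sk s]|[sk di]]].
- have [di|di] := boolP (double (rts x) i); first by right.
  by left; split => //; exact: near_strict_strict ns di.
- by split => //; exact: strict_near_strict.
- split => //; apply: double_near_strict => //; first exact: rts_sorted.
  exact: rts_admissible.
Qed.

Lemma near_rts x0 e : 0 < e -> \forall x \near x0,
  seq_close e (rts x) (rts x0) \/
  exists2 i, double (rts x0) i & seq_close e (rts x) (drop_pair i (rts x0)).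
Proof.
move=> e0.
exact: (@subtype_continuous _ X x0 _ (rootlist_near_admissible e0 (@rts_admissible x0))).
Qed.

Lemma near_simple k x0 e : simple k x0 -> 0 < e ->
  \forall x \near x0, simple k x /\ seq_close e (rts x) (rts x0).
Proof.
move=> [sk s0] e0; have [g g0 gap] := seq_gap (rts x0).
have e'0 : 0 < Num.min e (g / 2) by rewrite lt_min e0 divr_gt0.
have e'e : Num.min e (g / 2) <= e by rewrite ge_min lexx.
have e'g : Num.min e (g / 2) <= g / 2 by rewrite ge_min lexx orbT.
apply: filterS (near_rts x0 e'0) => x [cl|[i di _]]; last first.
  by move: di; rewrite (negbTE (strict_doubleN i s0)).
split; last by split=> [|j]; [case: cl|exact: lt_le_trans (cl.2 j) e'e].
split; first by rewrite cl.1.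
rewrite lt_sorted_uniq_le rts_sorted andbT; apply/(sorted_uniqN (rts_sorted x)) => j.
have e'2 : 2 * Num.min e (g / 2) <= g by lra.
by apply: contra (strict_doubleN j s0); exact: seq_close_double e'2 gap cl.
Qed.

(** Gaps between distinct roots are not closed by a small perturbation, so that a
    double root can only appear at [i]. *)
Lemma near_upper k i x0 e : upper k i x0 -> 0 < e -> \forall x \near x0,
  upper k i x /\ seq_close e (rts x) (rts x0) \/
  [/\ double_at k i x0, simple (k - 2) x & seq_close e (rts x) (drop_pair i (rts x0))].
Proof.
move=> [sk s0] e0; have [g g0 gap] := seq_gap (rts x0).
have e'0 : 0 < Num.min e (g / 2) by rewrite lt_min e0 divr_gt0.
have e'e : Num.min e (g / 2) <= e by rewrite ge_min lexx.
have e'g : Num.min e (g / 2) <= g / 2 by rewrite ge_min lexx orbT.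
have e'2 : 2 * Num.min e (g / 2) <= g by lra.
have s0' := near_strict_sorted s0.
apply: filterS (near_rts x0 e'0) => x [cl|[j dj cl]].
  left; split; last by split=> [|j]; [case: cl|exact: lt_le_trans (cl.2 j) e'e].
  have sx : size (rts x) = k by rewrite cl.1.
  apply/upperE; have [[j dj]|nd] := pselect (exists j, double (rts x) j).
    right; split => //.
    by rewrite -(near_strict_double s0 (seq_close_double e'2 gap cl dj)).
  left; split => //; rewrite lt_sorted_uniq_le rts_sorted andbT.
  by apply/(sorted_uniqN (rts_sorted x)) => j; apply/negP => dj; apply: nd; exists j.
right; have ji := near_strict_double s0 dj; rewrite ji in dj cl.
split => //; last by split=> [|l]; [case: cl|exact: lt_le_trans (cl.2 l) e'e].
split; first by rewrite cl.1 size_drop_pair // sk.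
rewrite lt_sorted_uniq_le rts_sorted andbT; apply/(sorted_uniqN (rts_sorted x)) => l.
apply/negP => /(seq_close_double e'2 _ cl) dl.
have sdp : sorted <=%R (drop_pair i (rts x0)).
  by apply: subseq_sorted s0'; [exact: le_trans|exact: subseq_drop_pair].
have := (sorted_uniqN sdp).2 (drop_pair_uniq s0' (@rts_admissible x0) dj) l.
rewrite dl // => u v ud vd; apply: gap; exact: mem_subseq (subseq_drop_pair i _) _ _.
Qed.

Lemma rts_continuous k x0 j : simple k x0 -> continuous_at x0 (fun x => (rts x)`_j).
Proof.
move=> sx; apply: near_dist_continuous => e e0.
by apply: filterS (near_simple sx e0) => x [_ [_ cl]]; exact: cl.
Qed.

Lemma exists_point p : good p -> exists x, pol x = p.
Proof.
move=> [pm sp adm]; have /mem_set Xp : X (poly_rV p).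
  by apply/poly_compl_admissible; rewrite poly_rVK_monic.
by exists (SigSub Xp : X); rewrite /pol /= poly_rVK_monic.
Qed.

(** ** Positive factors *)

Definition mix (t : R) p q := (1 - t) *: p + t *: q.

Lemma mix0 p q : mix 0 p q = p.
Proof. by rewrite /mix subr0 scale1r scale0r addr0. Qed.

Lemma mix1 p q : mix 1 p q = q.
Proof. by rewrite /mix subrr scale0r add0r scale1r. Qed.

Lemma mixMl t p q r : mix t (p * q) (p * r) = p * mix t q r.
Proof. by rewrite /mix mulrDr !scalerAr. Qed.

Definition positive_monic n p := [/\ p \is monic, size p = n.+1 & positive_poly p].

Lemma positive_monicM n m p q : positive_monic n p -> positive_monic m q ->
  positive_monic (n + m) (p * q).
Proof.
move=> [pm sp p0] [qm sq q0]; split; first by rewrite monicMl.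
  by rewrite size_Mmonic ?monic_neq0 // sp sq addSn addnS.
by move=> u; rewrite hornerM mulr_gt0.
Qed.

Lemma positive_monic_mix n t p q : 0 <= t <= 1 -> positive_monic n p ->
  positive_monic n q -> positive_monic n (mix t p q).
Proof.
move=> /andP[t0 t1] [pm sp p0] [qm sq q0].
have cn : (mix t p q)`_n = 1.
  rewrite coefD !coefZ -[n in p`_n]/(n.+1.-1) -[n in q`_n]/(n.+1.-1).
  rewrite -{1}sp -sq -!lead_coefE (monicP pm) (monicP qm); ring.
have sz : size (mix t p q) = n.+1.
  apply/eqP; rewrite eqn_leq; apply/andP; split.
    rewrite (leq_trans (size_polyD _ _)) // geq_max.
    by rewrite !(leq_trans (size_scale_leq _ _)) ?sp ?sq.
  rewrite ltnNge; apply/negP => le; move: cn; rewrite nth_default // => /eqP.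
  by rewrite eq_sym oner_eq0.
split => //; first by rewrite monicE lead_coefE sz cn.
move=> u; rewrite hornerD !hornerZ; have := p0 u; have := q0 u.
have [->|tn0] := eqVneq t 0; first by rewrite mul0r subr0 mul1r addr0.
have t0' : 0 < t by rewrite lt_neqAle eq_sym tn0.
by move=> qu pu; apply: ltr_wpDl; [apply: mulr_ge0; lra|exact: mulr_gt0].
Qed.

Definition quad (y s : R) : {poly R} := ('X - y%:P) ^+ 2 + s%:P.

Lemma quad_monic y s : quad y s \is monic /\ size (quad y s) = 3%N.
Proof.
have s3 : size (('X - y%:P) ^+ 2 : {poly R}) = 3%N.
  by rewrite size_exp_XsubC.
have lt : (size (s%:P : {poly R}) < size (('X - y%:P) ^+ 2 : {poly R}))%N.
  by rewrite s3 size_polyC; case: eqP.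
split; last by rewrite size_polyDl.
by rewrite monicE lead_coefDl // -monicE monic_exp // monicXsubC.
Qed.

Lemma positive_quad y s : 0 < s -> positive_monic 2 (quad y s).
Proof.
move=> s0; have [qm sq] := quad_monic y s; split=> // u.
by rewrite hornerD horner_exp hornerXsubC hornerC ltr_wpDl // sqr_ge0.
Qed.

Lemma positive_monic_exp n m p : positive_monic n p -> positive_monic (n * m) (p ^+ m).
Proof.
move=> pp; elim: m => [|m IH].
  rewrite muln0; split; [exact: monic1|exact: size_poly1|].
  by move=> u; rewrite hornerC ltr01.
by rewrite mulnS exprS; exact: positive_monicM.
Qed.

(** The standard positive factor for a polynomial with [k] real roots. *)
Definition filler k : {poly R} := quad 0 1 ^+ (d - k)./2.

Lemma filler_positive k : (k <= d)%N -> odd k = odd d -> positive_monic (d - k) (filler k).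
Proof.
move=> kd ok; have := positive_monic_exp (d - k)./2 (positive_quad 0 ltr01).
by rewrite mul2n halfK oddB // ok addbb subn0.
Qed.

Lemma good_positive n xs q : sorted <=%R xs -> admissible xs -> positive_monic n q ->
  (size xs + n = d)%N ->
  good (linear_factors xs * q) /\ rootlist (linear_factors xs * q) = xs.
Proof.
by move=> s adm [qm sq q0] sz; apply: good_factors => //; rewrite sq addnS sz.
Qed.

Lemma pol_factor x : exists2 q, positive_monic (d - size (rts x)) q &
  pol x = linear_factors (rts x) * q.
Proof.
have [q [qm q0 pE]] := rootlistP (pol_monic x); exists q => //; split => //.
have := size_pol x; rewrite pE size_Mmonic ?monic_neq0 ?linear_factors_monic //.
rewrite size_linear_factors addSn /= -/(rts x) => e; apply/eqP.
by rewrite -(eqn_add2l (size (rts x))) e addnS subnKC // size_rts_le.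
Qed.

(** ** The strata without double roots are contractible *)

Section simple.
Context (k : nat) (kd : (k <= d)%N) (ok : odd k = odd d).

Lemma simple_point xs q x : sorted <%R xs -> size xs = k -> positive_monic (d - k) q ->
  good (linear_factors xs * q) /\ simple k (to_point x (linear_factors xs * q)).
Proof.
move=> s sk qp; have s' := strict_sorted s.
have adm := near_strict_admissible (strict_near_strict 0 s).
have [|g rE] := good_positive s' adm qp; first by rewrite sk subnKC.
by split => //; rewrite /simple /= /rts pol_to_point // rE.
Qed.

Definition nats : seq R := mkseq (fun j => j%:R) k.

Lemma nats_strict : sorted <%R nats.
Proof.
by apply/(sortedP 0) => j; rewrite size_mkseq => jk; rewrite !nth_mkseq ?ltr_nat // ltnW.
Qed.

Definition slide (t : R) xs := mkseq (fun j => (1 - t) * xs`_j + t * j%:R) k.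

Lemma slide_strict t xs : 0 <= t <= 1 -> size xs = k -> sorted <%R xs -> sorted <%R (slide t xs).
Proof.
move=> /andP[t0 t1] sk /(sortedP 0) s; apply/(sortedP 0) => j.
rewrite size_mkseq => jk; rewrite !nth_mkseq //; last exact: ltnW.
have := s j; rewrite sk => /(_ jk) lt.
have nlt : (j%:R : R) < j.+1%:R by rewrite ltr_nat.
have [->|tn0] := eqVneq t 0; first by rewrite !subr0 !mul1r !mul0r !addr0.
have t0' : 0 < t by rewrite lt_neqAle eq_sym tn0.
by rewrite ler_ltD ?ltr_pM2l // ler_wpM2l ?subr_ge0 // ltW.
Qed.

(** The complementary factor is moved linearly to [filler k], which does not
    change the real roots; then the roots are moved linearly to the numbers from
    [0] to [k - 1]. *)
Lemma simple_contract : exists2 c, simple k c & deforms R (simple k) (simple k) id (fun=> c).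
Proof.
have fp := filler_positive kd ok.
have [c cE] : exists c, pol c = linear_factors nats * filler k.
  apply: exists_point.
  have [|? _] := good_positive (strict_sorted nats_strict)
    (near_strict_admissible (strict_near_strict 0 nats_strict)) fp => //.
  by rewrite size_mkseq subnKC.
have sc : simple k c.
  have [_] := simple_point c nats_strict (size_mkseq _ _) fp.
  by rewrite -cE to_point_pol.
exists c => //.
pose std (ys : X -> R -> nat -> R) := fun p : I * X =>
  \prod_(j < k) ('X - (ys p.2 (ival p.1) j)%:P) * filler k.
pose fixed := std (fun x _ j => (rts x)`_j).
pose moved := std (fun x t j => (slide t (rts x))`_j).
have fixedE t x : simple k x -> fixed (t, x) = linear_factors (rts x) * filler k.
  by move=> [sk _]; rewrite (linear_factors_ord sk).
have movedE t x : moved (t, x) = linear_factors (slide (ival t) (rts x)) * filler k.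
  by rewrite (linear_factors_ord (size_mkseq _ _)).
have cstd ys (t : I) x : (forall j, continuous_at (t, x) (fun p : I * X => ys p.2 (ival p.1) j)) ->
    coef_continuous (t, x) (std ys).
  move=> cy; apply: coef_continuousM; last exact: coef_continuousC.
  by apply: coef_continuous_prod => j; exact: coef_continuous_XsubC.
have t01 (t : I) : 0 <= ival t <= 1 by rewrite ival_ge0 ival_le1.
have near2 (t : I) x : simple k x -> \forall p \near (t, x), simple k p.2.
  move=> sx; apply: (@near_snd _ _ (t, x)).
  by apply: filterS (near_simple sx ltr01) => y [].
have crts (t : I) x j : simple k x -> continuous_at (t, x) (fun p : I * X => (rts p.2)`_j).
  by move=> sx; apply: (@continuous_at_comp _ _ _ snd (fun x => (rts x)`_j));
    [cts|exact: rts_continuous sx].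
pose H1 (p : I * X) := to_point p.2 (mix (ival p.1) (pol p.2) (fixed p)).
pose H2 (p : I * X) := to_point p.2 (moved p).
have P1 t x : simple k x -> good (mix (ival t) (pol x) (fixed (t, x))) /\ simple k (H1 (t, x)).
  move=> sx; have [sk s] := sx; have [q qp pE] := pol_factor x.
  rewrite sk in qp; rewrite /H1 /= fixedE // pE mixMl.
  by apply: simple_point => //; exact: positive_monic_mix.
have P2 t x : simple k x -> good (moved (t, x)) /\ simple k (H2 (t, x)).
  move=> [sk s]; rewrite /H2 /= movedE.
  by apply: simple_point; rewrite ?size_mkseq // slide_strict.
apply: (@deforms_trans _ _ _ _ _ (fun x => to_point x (linear_factors (rts x) * filler k))).
- exists H1; split.
  + by move=> t x sx; exact: (P1 t x sx).2.
  + by move=> t x sx; exact: (P1 t x sx).2.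
  + by move=> x sx; rewrite /H1 /= ival0 mix0 to_point_pol.
  + by move=> x sx; rewrite /H1 /= ival1 mix1 fixedE.
  + move=> t x sx; apply: to_point_continuous.
      by apply: filterS (near2 t x sx) => -[t' x'] /= sx'; exact: (P1 t' x' sx').1.
    apply: coef_continuousD; apply: coef_continuousZ; [by cts| |by cts|].
      by move=> i; apply: (@continuous_at_comp _ _ _ snd (fun x => (pol x)`_i));
        [cts|exact: coef_continuous_pol].
    by apply: (cstd (fun x _ j => (rts x)`_j)) => j; exact: crts.
- exists H2; split.
  + by move=> t x sx; exact: (P2 t x sx).2.
  + by move=> t x sx; exact: (P2 t x sx).2.
  + move=> x [sk _]; rewrite /H2 /= movedE ival0.
    rewrite (_ : slide 0 (rts x) = rts x) // -[RHS](mkseq_nth 0) sk.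
    by apply: eq_mkseq => j; rewrite subr0 mul1r mul0r addr0.
  + move=> x [sk _]; rewrite /H2 /= movedE ival1.
    rewrite (_ : slide 1 (rts x) = nats) -?cE ?to_point_pol //.
    by apply: eq_mkseq => j; rewrite subrr mul0r add0r mul1r.
  + move=> t x sx; apply: to_point_continuous.
      by apply: filterS (near2 t x sx) => -[t' x'] /= sx'; exact: (P2 t' x' sx').1.
    apply: (cstd (fun x t j => (slide t (rts x))`_j)) => j.
    have [jk|jk] := ltnP j k.
      rewrite (_ : (fun z => _) =
        (fun p : I * X => (1 - ival p.1) * (rts p.2)`_j + ival p.1 * j%:R)).
        by cts; exact: crts.
      by apply/funext => z; rewrite nth_mkseq.
    rewrite (_ : (fun z => _) = (fun=> 0)); first by cts.
    by apply/funext => z; rewrite nth_default // size_mkseq.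
Qed.

End simple.

End strata.

Section spread.
Context (R : realType).
Implicit Types (xs : seq R) (y r : R).

Definition spread i y r xs : seq R :=
  mkseq (fun j => if j == i then y - r else if j == i.+1 then y + r else xs`_j) (size xs).

Lemma spread_near_strict i y r xs : near_strict i xs -> (i.+1 < size xs)%N ->
  0 <= r -> xs`_i <= y - r -> y + r <= xs`_i.+1 -> near_strict i (spread i y r xs).
Proof.
move=> h si r0 y1 y2 j; rewrite size_mkseq => js.
have js' : (j < size xs)%N by exact: ltnW.
rewrite !nth_mkseq //; have hj := h j js.
case: (ltngtP j i) => ji.
- move: hj; rewrite (ltn_eqF ji) (ltn_eqF (leqW ji)).
  have [e|ne] := eqVneq j.+1 i; last first.
    by rewrite eqSS (ltn_eqF ji).
  by rewrite e => lt; exact: lt_le_trans lt y1.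
- move: hj; rewrite eqSS (gtn_eqF ji) (gtn_eqF (leqW ji)); have [e|ne //] := eqVneq j i.+1.
  by rewrite e => lt; exact: le_lt_trans y2 lt.
- by rewrite ji gtn_eqF // eqxx; lra.
Qed.

Lemma drop_pair_spread i y r xs : (i.+1 < size xs)%N ->
  drop_pair i (spread i y r xs) = drop_pair i xs.
Proof.
move=> si; apply: (@eq_from_nth _ 0).
  by rewrite !size_cat !size_drop !size_take size_mkseq.
move=> j; rewrite size_cat size_drop size_takel ?size_mkseq ?(ltnW (ltnW si)) // => js.
rewrite !nth_drop_pair ?size_mkseq ?(ltnW si) //.
case: ltnP => ji; rewrite nth_mkseq.
- by rewrite (ltn_eqF ji) ltn_eqF // leqW.
- exact: ltn_trans ji (ltnW si).
- by rewrite !gtn_eqF // ltnS // leqW.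
- by move: js si ji; move: (size xs) => n; lia.
Qed.

Lemma quad_roots y r : ('X - (y - r)%:P) * ('X - (y + r)%:P) = quad y (- r ^+ 2).
Proof. by rewrite /quad polyCN polyC_exp !polyCD polyCN; ring. Qed.

Lemma linear_factors_spread i y r xs : (i.+1 < size xs)%N ->
  linear_factors (spread i y r xs) =
    linear_factors (drop_pair i xs) * quad y (- r ^+ 2).
Proof.
move=> si; rewrite (@linear_factors_pair _ i) ?size_mkseq // drop_pair_spread // mulrC.
by rewrite -quad_roots !nth_mkseq ?eqxx ?gtn_eqF ?(ltnW si).
Qed.

End spread.

Section split.
Context (R : realType) (d k i : nat).
Hypotheses (ik : (i.+1 < k)%N) (kd : (k <= d)%N) (ok : odd k = odd d).
Local Notation I := (unit_interval R).
Local Notation X := (poly_compl R d (Omega_reduced_ge d 2)).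
Implicit Types (x : X).
Local Notation simple := (@simple R d).
Local Notation upper := (@upper R d k i).
Local Notation double_at := (@double_at R d k i).

Definition split_star : set X :=
  [set x | [\/ simple k x, double_at x | simple (k - 2) x]].
Local Notation V := split_star.

Lemma split_starE x : V x <-> upper x \/ simple (k - 2) x.
Proof.
split=> [[h|h|h]|[/upperE[h|h]|h]].
- by left; apply/upperE; left.
- by left; apply/upperE; right.
- by right.
- exact: Or31.
- exact: Or32.
- exact: Or33.
Qed.

Lemma upper_size x : upper x -> size (rts x) == k.
Proof. by move=> [/eqP]. Qed.

Lemma simple_size x : simple (k - 2) x -> (size (rts x) == k) = false.
Proof. by move=> [-> _]; apply/eqP; lia. Qed.

Lemma near_split_star x0 e : V x0 -> 0 < e -> \forall x \near x0,
  [\/ [/\ upper x, upper x0 & seq_close e (rts x) (rts x0)],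
      [/\ simple (k - 2) x, double_at x0 & seq_close e (rts x) (drop_pair i (rts x0))] |
      [/\ simple (k - 2) x, simple (k - 2) x0 & seq_close e (rts x) (rts x0)]].
Proof.
move=> /split_starE[u0|s0] e0.
  apply: filterS (near_upper u0 e0) => x [[ux cl]|[dx sx cl]]; first exact: Or31.
  exact: Or32.
by apply: filterS (near_simple s0 e0) => x [sx cl]; exact: Or33.
Qed.

Lemma split_star_near x0 : V x0 -> \forall x \near x0, V x.
Proof.
move=> V0; apply: filterS (near_split_star V0 ltr01) => x h; apply/split_starE.
by case: h => -[h _ _]; [left|right|right].
Qed.

(** The [k - 2] roots that persist on both sides of the wall. *)
Definition low x := if size (rts x) == k then drop_pair i (rts x) else rts x.

Lemma low_upper x : upper x -> low x = drop_pair i (rts x).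
Proof. by move=> /upper_size h; rewrite /low h. Qed.

Lemma low_simple x : simple (k - 2) x -> low x = rts x.
Proof. by move=> /simple_size h; rewrite /low h. Qed.

Lemma upper_pair x : upper x -> (i.+1 < size (rts x))%N.
Proof. by move=> [-> _]. Qed.

Lemma low_strict x : V x -> size (low x) = (k - 2)%N /\ sorted <%R (low x).
Proof.
move=> /split_starE[u|s]; last by rewrite low_simple //; case: s.
rewrite low_upper //; have iu := upper_pair u; case: u => sk ns.
split; last exact: drop_pair_strict ns iu.
rewrite size_cat size_drop size_takel ?(ltnW (ltnW iu)) // sk; lia.
Qed.

Lemma low_continuous x0 j : V x0 -> continuous_at x0 (fun x => (low x)`_j).
Proof.
move=> V0; apply: near_dist_continuous => e e0.
apply: filterS (near_split_star V0 e0) => x [[u u0 cl]|[s d0 cl]|[s s0 cl]].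
- rewrite !low_upper //.
  by have [_] := seq_close_drop_pair (ltnW (upper_pair u0)) cl; apply.
- by rewrite low_simple // low_upper; [case: cl|apply/upperE; right].
- by rewrite !low_simple //; case: cl.
Qed.

(** The quadratic polynomial [(X - y)^2 + s] whose roots are the pair at [i] on
    the upper part. On the lower part any continuous [y] and any positive [s]
    that tends to [0] at the wall will do: they are found by the extension
    theorem and as a distance. *)
Lemma pair_parameters : exists y s : X -> R,
  [/\ forall x, V x -> continuous_at x y, forall x, V x -> continuous_at x s,
      forall x, upper x -> y x = ((rts x)`_i + (rts x)`_i.+1) / 2 /\
                          s x = - (((rts x)`_i.+1 - (rts x)`_i) / 2) ^+ 2 &
      forall x, simple (k - 2) x -> 0 < s x].
Proof.
have lower_near x : V x -> ~ upper x -> \forall x' \near x, ~ upper x'.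
  move=> /split_starE[//|sx] _; apply: filterS (near_simple sx ltr01) => x' [sx' _].
  by move=> /upper_size; rewrite (simple_size sx').
have oV : open V by rewrite openE => x /split_star_near.
have uV : upper `<=` V by move=> x ux; apply/split_starE; left.
have [|y [cy yE]] := @relative_extension R X V upper
  (fun x => ((rts x)`_i + (rts x)`_i.+1) / 2) oV lower_near.
  move=> x0 u0 e e0; apply: filterS (near_split_star (uV _ u0) e0) => x.
  case=> [[_ _ [_ cl]] _|[s _ _] /upper_size|[s _ _] /upper_size]; last first.
  - by rewrite (simple_size s).
  - by rewrite (simple_size s).
  have := cl i; have := cl i.+1; rewrite !ltr_norml; lra.
pose phi (z : R * R) := - ((z.2 - z.1) / 2) ^+ 2.
pose dist := @capped_distance R X upper.
pose s x := if size (rts x) == k then phi ((rts x)`_i, (rts x)`_i.+1) else dist x.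
exists y, s; split => //; last first.
- move=> x sx; rewrite /s simple_size //; apply: capped_distance_gt0; apply: lower_near.
    by apply/split_starE; right.
  by move=> /upper_size; rewrite (simple_size sx).
- by move=> x ux; rewrite /s upper_size //; split => //; exact: yE.
move=> x0 V0; apply: near_dist_continuous => e e0.
have cphi : continuous_at ((rts x0)`_i, (rts x0)`_i.+1) phi by rewrite /phi; cts.
have h : nbhs (phi ((rts x0)`_i, (rts x0)`_i.+1))
    [set u | `|u - phi ((rts x0)`_i, (rts x0)`_i.+1)| < e].
  by apply: filterS (nbhsx_ballx _ e e0) => u; rewrite /ball /= distrC.
have {h} /nbhs_ballP[e' /= e'0 he'] := cphi _ h.
have cdist : \forall x \near x0, `|dist x - dist x0| < e.
  have h : nbhs (dist x0) [set u | `|u - dist x0| < e].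
    by apply: filterS (nbhsx_ballx _ e e0) => u; rewrite /ball /= distrC.
  exact: (@capped_distance_continuous R X upper x0 _ h).
apply: filterS2 cdist (near_split_star V0 e'0) => x cdist.
case=> [[u u0 [_ cl]]|[sx dx cl]|[sx s0 cl]].
- rewrite /s !upper_size //; apply: (he' ((rts x)`_i, (rts x)`_i.+1)).
  by split; rewrite /ball /= distrC.
- have u0 : upper x0 by apply/upperE; right.
  rewrite /s (simple_size sx) (upper_size u0) /phi /=.
  have [_ /andP[_ /eqP ->]] := dx; rewrite subrr mul0r expr0n oppr0 /=.
  by move: cdist; rewrite /dist (capped_distance0 u0).
- by rewrite /s (simple_size sx) (simple_size s0).
Qed.

Lemma upper_point xs q x : near_strict i xs -> size xs = k -> positive_monic (d - k) q ->
  good d (linear_factors xs * q) /\ upper (to_point x (linear_factors xs * q)).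
Proof.
move=> ns sk qp.
have [|g rE] := @good_positive R d (d - k) xs q (near_strict_sorted ns)
  (near_strict_admissible ns) qp.
  by rewrite sk subnKC.
by split => //; rewrite /upper /= /rts pol_to_point // rE.
Qed.

(** In the first stage the complementary factor of [pol x] is moved to
    [quad y s * filler], which has the same real roots; in the second one [s]
    increases until the pair has collided and left the real line. *)
Lemma split_deformation : exists2 g : X -> X,
  deforms R V (simple (k - 2)) id g & forall x, V x -> simple (k - 2) (g x).
Proof.
have [y [s [cy cs uE ls]]] := pair_parameters.
have fp := filler_positive R kd ok.
have kd2 : (k - 2 <= d)%N by rewrite (leq_trans (leq_subr _ _)).
have dk2 : (2 + (d - k) = d - (k - 2))%N by move: ik kd; clear; lia.
have t01 (t : I) : 0 <= ival t <= 1 by rewrite ival_ge0 ival_le1.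
pose L x : {poly R} := \prod_(j < k - 2) ('X - ((low x)`_j)%:P).
have LE x : V x -> L x = linear_factors (low x).
  by move=> /low_strict[sz _]; rewrite (linear_factors_ord sz).
have cL (t : I) x0 : V x0 -> coef_continuous (t, x0) (fun z : I * X => L z.2).
  move=> V0; apply: coef_continuous_prod => j; apply: coef_continuous_XsubC.
  by apply: (@continuous_at_comp _ _ _ snd (fun x => (low x)`_j));
    [cts|exact: low_continuous].
have near2 (t : I) x : V x -> \forall z \near (t, x), V z.2.
  by move=> Vx; apply: (@near_snd _ _ (t, x)); exact: split_star_near.
have cquad (t : I) x0 (s' : I * X -> R) : V x0 -> continuous_at (t, x0) s' ->
    coef_continuous (t, x0) (fun z => L z.2 * (quad (y z.2) (s' z) * filler R d k)).
  move=> V0 cs'; apply: coef_continuousM; first exact: cL.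
  apply: coef_continuousM; last exact: coef_continuousC.
  apply: coef_continuousD; last exact: coef_continuous_polyC.
  apply: coef_continuousX; apply: coef_continuous_XsubC.
  by apply: (@continuous_at_comp _ _ _ snd y); [cts|exact: cy].
have cs2 (t : I) x0 : V x0 -> continuous_at (t, x0) (fun z : I * X => s z.2).
  by move=> V0; apply: (@continuous_at_comp _ _ _ snd s); [cts|exact: cs].
(* Membership for the lower part, and for the upper part once [s] is positive. *)
have low_point x s' : V x -> 0 < s' ->
    good d (L x * (quad (y x) s' * filler R d k)) /\
    simple (k - 2) (to_point x (L x * (quad (y x) s' * filler R d k))).
  move=> Vx s0; have [sz st] := low_strict Vx; rewrite LE //.
  apply: (simple_point kd2) => //.
  by rewrite -dk2; apply: positive_monicM => //; exact: positive_quad.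
have up_point x s' : upper x -> s x <= s' -> s' <= 0 ->
    good d (L x * (quad (y x) s' * filler R d k)) /\
    upper (to_point x (L x * (quad (y x) s' * filler R d k))).
  move=> ux ss s0; have si := upper_pair ux; have [sk ns] := ux.
  have [yE sE] := uE x ux.
  have Vx : V x by apply/split_starE; left.
  pose r := Num.sqrt (- s').
  have r0 : 0 <= r by exact: sqrtr_ge0.
  have rE : - r ^+ 2 = s' by rewrite sqr_sqrtr ?opprK ?oppr_ge0.
  have le : (rts x)`_i <= (rts x)`_i.+1.
    by have := ns i si; rewrite eqxx.
  have rle : r <= ((rts x)`_i.+1 - (rts x)`_i) / 2.
    rewrite -(@ler_pXn2r _ 2) ?nnegrE ?divr_ge0 ?subr_ge0 //.
    by rewrite -lerN2 rE -sE.
  rewrite LE // low_upper // mulrA -rE -linear_factors_spread //.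
  apply: upper_point; rewrite ?size_mkseq //.
  by apply: spread_near_strict => //; rewrite yE; lra.
pose H1 (z : I * X) :=
  mix (ival z.1) (pol z.2) (L z.2 * (quad (y z.2) (s z.2) * filler R d k)).
pose s' (z : I * X) := (1 - ival z.1) * s z.2 + ival z.1.
pose H2 (z : I * X) := L z.2 * (quad (y z.2) (s' z) * filler R d k).
have P1u t x : upper x -> good d (H1 (t, x)) /\ upper (to_point x (H1 (t, x))).
  move=> ux; have si := upper_pair ux; have [sk ns] := ux; have [yE sE] := uE x ux.
  have Vx : V x by apply/split_starE; left.
  have [q qp pE] := pol_factor x; rewrite sk in qp.
  rewrite /H1 /= LE // low_upper // pE mulrA.
  have -> : linear_factors (drop_pair i (rts x)) * quad (y x) (s x) = linear_factors (rts x).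
    rewrite (linear_factors_pair si) mulrC sE -quad_roots yE; congr (_ * _).
    by congr (('X - _%:P) * ('X - _%:P)); lra.
  by rewrite mixMl; apply: upper_point => //; exact: positive_monic_mix.
have P1l t x : simple (k - 2) x ->
    good d (H1 (t, x)) /\ simple (k - 2) (to_point x (H1 (t, x))).
  move=> sx; have Vx : V x by exact: Or33.
  have [q qp pE] := pol_factor x; have [sk st] := sx; rewrite sk in qp.
  rewrite /H1 /= LE // low_simple // pE mixMl; apply: (simple_point kd2) => //.
  apply: positive_monic_mix => //; rewrite -dk2; apply: positive_monicM => //.
  by apply: positive_quad; exact: ls.
have P2l t x : simple (k - 2) x ->
    good d (H2 (t, x)) /\ simple (k - 2) (to_point x (H2 (t, x))).
  move=> sx; apply: low_point; first exact: Or33.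
  have := ls x sx; have /andP[t0 t1] := t01 t; rewrite /s' /=; nra.
have P2u t x : upper x -> good d (H2 (t, x)) /\ V (to_point x (H2 (t, x))).
  move=> ux; have Vx : V x by apply/split_starE; left.
  have [sp|sp] := lerP (s' (t, x)) 0; last first.
    by have [g sg] := low_point x _ Vx sp; split => //; exact: Or33.
  have [|//|g ug] := up_point x (s' (t, x)) ux.
    have [_ sE] := uE x ux; have /andP[t0 t1] := t01 t.
    have : s x <= 0 by rewrite sE oppr_le0 sqr_ge0.
    by rewrite /s' /=; nra.
  by split => //; apply/split_starE; left.
have goodH H : (forall t x, upper x -> good d (H (t, x)) /\ V (to_point x (H (t, x)))) ->
    (forall t x, simple (k - 2) x ->
      good d (H (t, x)) /\ simple (k - 2) (to_point x (H (t, x)))) ->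
    forall (t : I) x, V x -> good d (H (t, x)) /\ V (to_point x (H (t, x))).
  move=> hu hl t x /split_starE[/hu//|/hl-/(_ t)[g sg]].
  by split => //; exact: Or33.
have P1 : forall (t : I) x, V x -> good d (H1 (t, x)) /\ V (to_point x (H1 (t, x))).
  apply: goodH => // t x ux; have [g ug] := P1u t x ux; split => //.
  by apply/split_starE; left.
have P2 := goodH H2 P2u P2l.
exists (fun x => to_point x (H2 (one, x))); last first.
  move=> x Vx; have s11 : s' (one, x) = 1 by rewrite /s' /= ival1; lra.
  rewrite /H2 s11; exact: (low_point x 1 Vx ltr01).2.
apply: (@deforms_trans _ _ _ _ _
  (fun x => to_point x (L x * (quad (y x) (s x) * filler R d k)))).
- exists (fun z => to_point z.2 (H1 z)); split.
  + by move=> t x Vx; exact: (P1 t x Vx).2.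
  + by move=> t x sx; exact: (P1l t x sx).2.
  + by move=> x Vx; rewrite /H1 /= ival0 mix0 to_point_pol.
  + by move=> x Vx; rewrite /H1 /= ival1 mix1.
  + move=> t x Vx; apply: to_point_continuous.
      by apply: filterS (near2 t x Vx) => -[t' x'] /= Vx'; exact: (P1 t' x' Vx').1.
    apply: coef_continuousD; apply: coef_continuousZ; [by cts| |by cts|].
      by move=> j; apply: (@continuous_at_comp _ _ _ snd (fun x => (pol x)`_j));
        [cts|exact: coef_continuous_pol].
    by apply: (cquad t x (fun z => s z.2)) => //; exact: cs2.
- exists (fun z => to_point z.2 (H2 z)); split.
  + by move=> t x Vx; exact: (P2 t x Vx).2.
  + by move=> t x sx; exact: (P2l t x sx).2.
  + by move=> x Vx; rewrite /H2 /s' /= ival0 subr0 mul1r addr0.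
  + by [].
  + move=> t x Vx; apply: to_point_continuous.
      by apply: filterS (near2 t x Vx) => -[t' x'] /= Vx'; exact: (P2 t' x' Vx').1.
    by apply: (cquad t x s') => //; rewrite /s'; cts; exact: cs2.
Qed.

End split.

Section base.
Context (R : realType) (d : nat).
Local Notation I := (unit_interval R).
Local Notation X := (poly_compl R d (Omega_reduced_ge d 2)).
Implicit Types (x : X) (k i j : nat).
Local Notation simple := (@simple R d).
Local Notation upper := (@upper R d).
Local Notation double_at := (@double_at R d).

(** The part of the space that corresponds to the vertices up to [k] of the graph
    and to the edges of the spanning path between them. *)
Definition base_part k : set X :=
  [set x | (size (rts x) <= k)%N /\ forall i, double (rts x) i -> i = 0%N].

Lemma simple_base k x : simple k x -> base_part k x.
Proof.
move=> [sk s]; split; first by rewrite sk.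
by move=> i; rewrite (negbTE (strict_doubleN i s)).
Qed.

Lemma upper_base k x : upper k 0 x -> base_part k x.
Proof.
by move=> [sk ns]; split; [rewrite sk|move=> i; exact: near_strict_double ns].
Qed.

Lemma base_upper k x : base_part k x -> upper (size (rts x)) 0 x.
Proof.
move=> [_ b]; apply/upperE; have [dx|dx] := boolP (double (rts x) 0); first by right.
left; split => //; rewrite lt_sorted_uniq_le rts_sorted andbT.
apply/(sorted_uniqN (rts_sorted x)) => i; apply/negP => di.
by move: dx; rewrite -(b i di) di.
Qed.

Lemma base_partW k k' x : (k <= k')%N -> base_part k x -> base_part k' x.
Proof. by move=> kk [sk b]; split => //; exact: leq_trans kk. Qed.

Lemma near_base k x0 : base_part k x0 -> \forall x \near x0, base_part k x.
Proof.
move=> b0; have [s0 _] := b0.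
apply: filterS (near_upper (base_upper b0) ltr01) => x [[ux _]|[_ sx _]].
  exact: base_partW s0 (upper_base ux).
exact: base_partW (leq_trans (leq_subr _ _) s0) (simple_base sx).
Qed.

(** Pushing the polynomials with [k] real roots across the wall where the two
    smallest roots collide deforms the part with at most [k] roots into the one
    with fewer roots. The deformation is slowed down by [tau], which vanishes near
    the polynomials that are not in the neighbourhood of this wall. *)
Lemma base_step k : (1 < k)%N -> (k <= d)%N -> odd k = odd d -> exists2 g : X -> X,
  deforms R (base_part k) (base_part (k - 2)) id g &
  forall x, base_part k x -> base_part (k - 2) (g x).
Proof.
move=> k1 kd ok; have [g0 [D [DV DW D0 D1 cD]] g0P] := @split_deformation R d k 0 k1 kd ok.
pose V := @split_star R d k 0.
have VE x : V x <-> upper k 0 x \/ simple (k - 2) x by exact: split_starE.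
have VM x : V x -> base_part k x.
  move=> /VE[/upper_base//|/simple_base]; apply: base_partW; exact: leq_subr.
have Mopen : open (base_part k) by rewrite openE => x; exact: near_base.
have lt_size x : base_part k x -> ~ upper k 0 x -> (size (rts x) < k)%N.
  move=> bx nu; rewrite ltn_neqAle bx.1 andbT; apply/eqP => e.
  by apply: nu; rewrite -[X in upper X]e; exact: base_upper bx.
have lt_size2 x : base_part k x -> ~ upper k 0 x -> base_part (k - 2) x.
  move=> bx nu; split; last by case: bx.
  have := lt_size x bx nu; have := odd_size_rts x; rewrite -ok.
  move: (size (rts x)) k1 => n; clear; lia.
have upper_near x : base_part k x -> ~ upper k 0 x -> \forall x' \near x, ~ upper k 0 x'.
  move=> bx nu; apply: filterS (near_base (lt_size2 x bx nu)) => x' [le _] [e _].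
  by move: le; rewrite e; move: k1; clear; lia.
pose B := [set x | base_part k x /\ ~ V x].
have [||chi [cchi chi01 chiA chiB]] := @relative_bump R X (base_part k) (upper k 0)
  Mopen upper_near B.
- by move=> x ux [_]; apply; apply/VE; left.
- move=> x bx nB; have Vx : V x by apply: contrapT => nV; exact: nB.
  have nV := split_star_near Vx; apply: filterS nV => x' Vx' Bx'; exact: Bx'.2.
pose tau x : I := clamp (2 * chi x - 1).
have tauA x : upper k 0 x -> tau x = one.
  by move=> ux; rewrite /tau chiA // clamp_ge1 //; lra.
pose H (z : I * X) := if `[< V z.2 >] then D (clamp (ival z.1 * ival (tau z.2)), z.2) else z.2.
have HV t x : V x -> H (t, x) = D (clamp (ival t * ival (tau x)), x).
  by move=> Vx; rewrite /H /= asboolT.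
have HN t x : ~ V x -> H (t, x) = x.
  by move=> Vx; rewrite /H /= asboolF.
exists (fun x => H (one, x)).
- exists H; split => //.
  + move=> t x bx; have [Vx|nV] := pselect (V x); last by rewrite HN.
    by rewrite HV //; apply/VM/DV.
  + move=> t x bx; have [Vx|nV] := pselect (V x); last by rewrite HN.
    rewrite HV //; apply/simple_base/DW; have /VE[[e _]|//] := Vx.
    by have := bx.1; rewrite e; move: k1; clear; lia.
  + move=> x bx; have [Vx|nV] := pselect (V x); last by rewrite HN.
    by rewrite HV // ival0 mul0r clamp_le0 // D0.
  + move=> t x bx; have [Vx|nV] := pselect (V x).
      apply: (@continuous_at_near _ _
        (fun z : I * X => D (clamp (ival z.1 * ival (tau z.2)), z.2))).
        apply: filterS (near_snd (p := (t, x)) (split_star_near Vx)) => -[t' x'] /= Vx'.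
        by rewrite HV.
      apply: (@continuous_at_comp _ _ _
        (fun z : I * X => (clamp (ival z.1 * ival (tau z.2)), z.2)) D).
        rewrite /tau; cts.
        by apply: (@continuous_at_comp _ _ _ snd chi); [cts|exact: cchi].
      exact: cD.
    apply: (@continuous_at_near _ _ snd); last by cts.
    have Bx : B x by [].
    have near_chi : \forall x' \near x, chi x' < 2^-1.
      have h : nbhs (chi x) [set u | u < 2^-1] by rewrite chiB //; apply: lt_nbhsl; lra.
      exact: (cchi x bx _ h).
    apply: filterS (near_snd (p := (t, x)) near_chi) => -[t' x'] /= c2.
    have [Vx'|nV'] := pselect (V x'); last by rewrite HN.
    have t0 : tau x' = zero by rewrite /tau clamp_le0 //; lra.
    by rewrite HV // t0 ival0 mulr0 clamp_le0 // D0.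
- move=> x bx; have [Vx|nV] := pselect (V x); last first.
    by rewrite HN //; apply: lt_size2 => // ux; apply: nV; apply/VE; left.
  rewrite HV //; apply: simple_base; have /VE[ux|sx] := Vx; last exact: DW.
  by rewrite tauA // ival1 mulr1 clamp_ge1 // D1 //; exact: g0P.
Qed.

Lemma base_contract k : (k <= d)%N -> odd k = odd d -> exists2 c, base_part k c &
  deforms R (base_part k) (base_part k) id (fun=> c).
Proof.
have [n] := ubnP k; elim: n k => // n IH k kn kd ok.
have [k1|k1] := leqP k 1.
  suff -> : base_part k = simple k by exact: simple_contract.
  apply/seteqP; split=> x; last exact: simple_base.
  move=> bx; have := base_upper bx; have [sk _] := bx.
  have -> : size (rts x) = k.
    have := odd_size_rts x; rewrite -ok; move: (size (rts x)) sk k1 => m; clear; lia.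
  by move=> /upperE[//|[e /andP[+ _]]]; rewrite e ltnNge k1.
have [g dg gb] := base_step k1 kd ok.
have [|||c bc dc] := IH (k - 2)%N.
- by move: k1 kn; clear; lia.
- exact: leq_trans (leq_subr _ _) kd.
- by rewrite oddB //= addbF.
exists c; first exact: base_partW (leq_subr _ _) bc.
apply: deforms_self (deforms_through dg gb _ dc) => x.
exact: base_partW (leq_subr _ _).
Qed.

End base.

(** * The wall system of the space of polynomials *)

(** The pairs [(k, i)] for the walls of polynomials with [k] real roots counted
    with multiplicity whose double root is not the smallest one; there are [i]
    real roots below it. *)
Fixpoint walls (d : nat) : seq (nat * nat) :=
  if d is e.+2 then [seq (d, i) | i <- iota 1 e] ++ walls e else [::].

Lemma wallsSS e : walls e.+2 = [seq (e.+2, i) | i <- iota 1 e] ++ walls e.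
Proof. by []. Qed.

Lemma mem_walls d k i : ((k, i) \in walls d) =
  [&& (k <= d)%N, odd k == odd d, (0 < i)%N & (i.+1 < k)%N].
Proof.
have [n] := ubnP d; elim: n d => // n IH [|[|d]] dn; last first.
  have {}IH : ((k, i) \in walls d) = [&& (k <= d)%N, odd k == odd d, (0 < i)%N & (i.+1 < k)%N].
    by apply: IH; rewrite -ltnS ltnW.
  rewrite wallsSS mem_cat IH.
  have -> : ((k, i) \in [seq (d.+2, i) | i <- iota 1 d]) = [&& k == d.+2, (0 < i)%N & (i.+1 < k)%N].
    apply/mapP/idP => [[j]|].
      rewrite mem_iota => /andP[j0 jd] [-> ->]; rewrite eqxx j0 /=; lia.
    move=> /and3P[/eqP -> i0 id]; exists i => //; rewrite mem_iota; lia.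
  by rewrite /= negbK; clear; lia.
- rewrite /= in_nil; clear; lia.
- rewrite /= in_nil; clear; lia.
Qed.

Lemma walls_uniq d : uniq (walls d).
Proof.
have [n] := ubnP d; elim: n d => // n IH [|[|d]] dn //.
rewrite wallsSS cat_uniq map_inj_uniq ?iota_uniq; last by move=> i j [].
rewrite IH ?andbT /=; last by rewrite -ltnS ltnW.
apply/hasPn => -[k i]; rewrite mem_walls => /and4P[kd _ _ _].
by apply/mapP => -[j _ [e _]]; move: kd; rewrite e; clear; lia.
Qed.

Lemma size_walls d : (1 <= d)%N -> size (walls d) =
  if odd d then ((d - 1) ^ 2 %/ 4)%N else (d * (d - 2) %/ 4)%N.
Proof.
have even e : size (walls e.*2.+2) = (e.+1 * e)%N.
  elim: e => [|e IH] //; rewrite doubleS wallsSS size_cat size_map size_iota.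
  by rewrite IH -mul2n; nia.
have odd_ e : size (walls e.*2.+1) = (e * e)%N.
  elim: e => [|e IH] //; rewrite doubleS wallsSS size_cat size_map size_iota.
  by rewrite IH -mul2n; nia.
move=> d1; rewrite -(odd_double_half d); case: (odd d) (odd_double_half d) => /= dE.
  rewrite add1n odd_ /= odd_double /= subn1 /= -mul2n expnMn mulKn //.
rewrite add0n odd_double; case: (d./2) dE => [|e] dE; first by move: d1; rewrite -dE.
rewrite doubleS even -doubleS !subn2 /= -!mul2n mulnACA mulKn //.
Qed.

Section polynomial_walls.
Context (R : realType) (d : nat).
Local Notation X := (poly_compl R d (Omega_reduced_ge d 2)).
Implicit Types (x : X) (k i j : nat).
Local Notation simple := (@simple R d).

Lemma simple_open k : open (simple k).
Proof. by rewrite openE => x sx; apply: filterS (near_simple sx ltr01) => y []. Qed.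

Lemma simple_contraction k : (k <= d)%N -> odd k = odd d -> contraction R (simple k).
Proof.
move=> kd ok; have /cid2[c sc dc] := @simple_contract R d k kd ok.
exact: deforms_contraction sc dc.
Qed.

Lemma base_contraction : contraction R (@base_part R d d).
Proof.
have /cid2[c bc dc] := @base_contract R d d (leqnn _) erefl.
exact: deforms_contraction bc dc.
Qed.

Lemma star_contraction k i : (i.+1 < k)%N -> (k <= d)%N -> odd k = odd d ->
  contraction R (@split_star R d k i).
Proof.
move=> ik kd ok; have /cid2[g dg gs] := @split_deformation R d k i ik kd ok.
have kd2 : (k - 2 <= d)%N by rewrite (leq_trans (leq_subr _ _)).
have ok2 : odd (k - 2) = odd d.
  by rewrite oddB ?addbF //; apply: leq_ltn_trans ik.
have /cid2[c sc dc] := @simple_contract R d (k - 2) kd2 ok2.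
have sV : simple (k - 2) `<=` split_star k i by move=> x; exact: Or33.
exact: deforms_contraction (sV _ sc) (deforms_through dg gs sV dc).
Qed.

Lemma nth_walls (j : 'I_(size (walls d))) (w := nth (0, 0)%N (walls d) j) :
  [/\ (w.1 <= d)%N, odd w.1 = odd d, (0 < w.2)%N & (w.2.+1 < w.1)%N].
Proof.
have : w \in walls d by rewrite mem_nth.
by case: w => k i; rewrite mem_walls => /and4P[? /eqP ? ? ?].
Qed.

(** The walls of [walls d] leave the part where only the two smallest roots may
    coincide; the other walls are interior to this part. *)
Lemma polynomial_wall_system : wall_system R X (size (walls d)).
Proof.
pose wk (j : 'I_(size (walls d))) := (nth (0, 0)%N (walls d) j).1.
pose wi (j : 'I_(size (walls d))) := (nth (0, 0)%N (walls d) j).2.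
refine (@WallSystem R X _ (@base_part R d d) (fun w => @double_at R d (wk w) (wi w))
  (fun w => simple (wk w)) (fun w => simple (wk w - 2))
  _ _ _ _ _ _ _ _ _ _ _ _ _ _).
- by rewrite openE => x; exact: near_base.
- by move=> j; exact: simple_open.
- by move=> j; exact: simple_open.
- by move=> j; rewrite openE => x; exact: split_star_near.
- move=> x; have [nd|] := pselect (forall i, double (rts x) i -> i = 0%N).
    by left; split => //; exact: size_rts_le.
  move=> /existsNP[i /not_implyP[di i0]]; right.
  have mw : (size (rts x), i) \in walls d.
    rewrite mem_walls size_rts_le odd_size_rts eqxx lt0n /=; case/andP: di => -> _.
    by rewrite andbT; apply/eqP.
  have jlt : (index (size (rts x), i) (walls d) < size (walls d))%N by rewrite index_mem.
  exists (Ordinal jlt); rewrite /wk /wi /double_at /= nth_index //.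
- move=> j x [_ dx] [_ b]; have [_ _ w0 _] := nth_walls j.
  by move: w0; rewrite -/(wi j) (b _ dx).
- move=> j l x [sj dj] [sl dl]; apply: val_inj; apply/eqP.
  rewrite -(nth_uniq (0, 0)%N (ltn_ord j) (ltn_ord l) (walls_uniq d)).
  rewrite [nth _ _ j]surjective_pairing [nth _ _ l]surjective_pairing.
  rewrite -/(wk j) -/(wk l) -/(wi j) -/(wi l) -sj -sl.
  by rewrite (@rts_admissible R d x _ _ dj dl).
- move=> j x sx; have [kd _ _ _] := nth_walls j.
  exact: base_partW kd (simple_base sx).
- move=> j x sx; have [kd _ _ _] := nth_walls j.
  exact: base_partW (leq_trans (leq_subr _ _) kd) (simple_base sx).
- move=> j x [s1 _] [s2 _]; have [_ _ _ ik] := nth_walls j.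
  by move: ik; rewrite -/(wi j) -/(wk j); move: s2; rewrite s1; clear; lia.
- exact: base_contraction.
- move=> j; have [kd ok _ ik] := nth_walls j; exact: star_contraction.
- move=> j; have [kd ok _ ik] := nth_walls j; exact: simple_contraction.
- move=> j; have [kd ok _ ik] := nth_walls j; apply: simple_contraction.
    by rewrite (leq_trans (leq_subr _ _)).
  by rewrite oddB ?addbF //; apply: leq_ltn_trans ik.
Qed.

Lemma poly_compl_normal : normal_space X.
Proof. exact: (@pseudometric_normal R X). Qed.

Lemma poly_compl_hausdorff : hausdorff_space X.
Proof.
move=> x y xy; apply: val_inj; apply: (@norm_hausdorff R 'rV[R]_d) => A B Ax By.
have [z [Az Bz]] := xy _ _ (@subtype_continuous _ X x _ Ax) (@subtype_continuous _ X y _ By).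
by exists (set_val z).
Qed.

End polynomial_walls.

Theorem theorem2p4 (R : realType) (d : nat) (hd : (1 <= d)%N) :
  let P : topologicalType := poly_compl R d (Omega_reduced_ge d 2) in
  let n : nat :=
    if odd d then ((d - 1) ^ 2 %/ 4)%N else (d * (d - 2) %/ 4)%N in
  [/\ homotopy_equivalent R P (wedge_of_circles R n),
    forall x : P, free_group_on n (fundamental_group R x) &
    forall G : groupType, free_group_on n G -> eilenberg_maclane1 R G P].
Proof.
move=> P n; have -> : n = size (walls d) by rewrite size_walls.
have ws := polynomial_wall_system R d.
have normalP := @poly_compl_normal R d.
split.
- exact: wall_system_wedge ws normalP (@poly_compl_hausdorff R d).
- exact: wall_system_pi1 ws normalP.
- exact: wall_system_eilenberg_maclane ws normalP.
Qed.
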